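(* Let $h:[0,\infty)\to[\frac{\beta u_0-1}{r},\frac{\beta u_0}{r}]$ be a decreasing solution to the HJB equation (in the sense described in the context). Then $h(z)\ge v^U(z)$ for all $z\in[0,\infty)$ and every $U\in\mathcal U$. Moreover, if $h'(0)=0$ and if $u^*(z)=u_0\mathbf 1_{\{h'(z)\ge-\beta\}}$ defines an admissible strategy via $U^*(t)=u^*(\Delta_z^{U^*}(t))$, $t\ge0$ (i.e. there is $U^*\in\mathcal U$ satisfying this relation), then $h(z)=v(z)=v^{U^*}(z)=\sup_{U\in\mathcal U}v^U(z)$ for all $z\ge0$.
   Context: Let $(\Omega,\mathcal F,\mathbb P)$ be a complete probability space carrying a standard Brownian motion $W$. Fix $\mu\in\mathbb R$, $\sigma>0$, $u_0>0$, $r>0$, $\beta>0$, $d>0$. Let $\mathcal U$ be the set of adapted processes $U$ with $0\le U(t)\le u_0$. For $U\in\mathcal U$: $X^U(t)=\mu t+\sigma W(t)-\int_0^tU(s)\,ds$, $M_z^U(t)=\max\{z,\sup_{s\le t}X^U(s)\}$, $\Delta_z^U(t)=M_z^U(t)-X^U(t)$ for $z\ge0$; $v^U(z)=\mathbb E\big[\beta\int_0^\infty e^{-rt}U(t)\,dt-\int_0^\infty e^{-rt}\mathbf 1_{\{\Delta_z^U(t)>d\}}\,dt\big]$ and $v(z)=\sup_{U\in\mathcal U}v^U(z)$. The HJB equation is $$-rh(z)-\mu h'(z)+\tfrac{\sigma^2}{2}h''(z)+\sup_{u\in[0,u_0]}\{(\beta+h'(z))u\}=\mathbf 1_{\{z>d\}}.$$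 A solution to the HJB equation is a function $h:[0,\infty)\to[\frac{\beta u_0-1}{r},\frac{\beta u_0}{r}]$ that is continuously differentiable on $[0,\infty)$, twice continuously differentiable on $[0,d]$ and on $(d,\infty)$ respectively (with $h'(0),h''(0)$ the right derivatives and $h''(d)$ the left second derivative), and satisfies the HJB equation for all $z\ge0$. *)

(* Defs.v *)
From HB Require Import structures.
From mathcomp Require Import all_boot all_order all_algebra.
From mathcomp Require Import all_classical all_reals all_analysis.
Set Implicit Arguments. Unset Strict Implicit. Unset Printing Implicit Defensive.
Import Order.TTheory GRing.Theory Num.Theory.
Import numFieldNormedType.Exports.
Local Open Scope classical_set_scope.
Local Open Scope ring_scope.

Section Model.
Context {R : realType} {dO : measure_display} {Omega : measurableType dO}.

Definition complete_prob (P : probability Omega R) : Prop :=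
  forall N : set Omega, measurable N -> P N = 0%E ->
    forall A, A `<=` N -> measurable A.

Definition filtration (F : R -> set (set Omega)) : Prop :=
  (forall t, 0 <= t -> sigma_algebra setT (F t) /\ F t `<=` measurable) /\
  (forall s t, 0 <= s -> s <= t -> F s `<=` F t).

Definition measurable_wrt (G : set (set Omega)) (f : Omega -> R) : Prop :=
  forall B : set R, measurable B -> G (f @^-1` B).

Definition std_brownian (P : probability Omega R) (F : R -> set (set Omega))
    (W : R -> Omega -> R) : Prop :=
  [/\ forall w, W 0 w = 0,
      forall w, {within `[0, +oo[, continuous (fun t => W t w)},
      forall t, 0 <= t -> measurable_wrt (F t) (W t) &
      forall s t, 0 <= s -> s < t ->
        forall A, F s A -> forall B : set R, measurable B ->
          P (A `&` ((fun w => W t w - W s w) @^-1` B)) =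
          (P A * normal_prob 0 (Num.sqrt (t - s)) B)%E].

Definition admissible (F : R -> set (set Omega)) (u0 : R)
    (U : R -> Omega -> R) : Prop :=
  [/\ forall t w, 0 <= t -> 0 <= U t w <= u0,
      forall t, 0 <= t -> measurable_wrt (F t) (U t) &
      measurable_fun setT (fun p : R * Omega => U p.1 p.2)].

Definition Xproc (mu sigma : R) (W : R -> Omega -> R) (U : R -> Omega -> R)
    (t : R) (w : Omega) : R :=
  mu * t + sigma * W t w
  - Rintegral lebesgue_measure `[0, t] (fun s => U s w).

Definition Mproc mu sigma W U (z t : R) (w : Omega) : R :=
  Num.max z (sup [set Xproc mu sigma W U s w | s in `[0, t]]).

Definition Dproc mu sigma W U (z t : R) (w : Omega) : R :=
  Mproc mu sigma W U z t w - Xproc mu sigma W U t w.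

Definition vU (P : probability Omega R) (mu sigma r beta d : R)
    (W U : R -> Omega -> R) (z : R) : R :=
  fine (\int[P]_w
    ((beta * Rintegral lebesgue_measure `[0, +oo[
                (fun t => expR (- (r * t)) * U t w)
      - Rintegral lebesgue_measure `[0, +oo[
                (fun t => expR (- (r * t)) *
                   (if d < Dproc mu sigma W U z t w then 1 else 0)))%:E)).

Definition vfun (P : probability Omega R) (F : R -> set (set Omega))
    (mu sigma u0 r beta d : R) (W : R -> Omega -> R) (z : R) : R :=
  sup [set vU P mu sigma r beta d W U z | U in admissible F u0].

End Model.

Section HJB.
Context {R : realType}.

Definition right_deriv (f : R -> R) (x l : R) : Prop :=
  (fun t => (f (x + t) - f x) / t) @ 0^'+ --> l.
Definition left_deriv (f : R -> R) (x l : R) : Prop :=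
  (fun t => (f (x + t) - f x) / t) @ 0^'- --> l.

(** h is a solution of the HJB equation, with h1 = h' and h2 = h'' (one-sided
    at 0, and h''(d) the left second derivative) *)
Definition HJB_solution (mu sigma u0 r beta d : R) (h h1 h2 : R -> R) : Prop :=
  [/\ forall z, 0 <= z -> (beta * u0 - 1) / r <= h z <= beta * u0 / r,
      [/\ forall z : R, 0 < z -> is_derive z 1 h (h1 z),
          right_deriv h 0 (h1 0) &
          {within `[0, +oo[, continuous h1}],
      [/\ forall z : R, 0 < z < d -> is_derive z 1 h1 (h2 z),
          right_deriv h1 0 (h2 0), left_deriv h1 d (h2 d) &
          {within `[0, d], continuous h2}],
      [/\ forall z : R, d < z -> is_derive z 1 h1 (h2 z) &
          {within `]d, +oo[, continuous h2}] &
      forall z, 0 <= z ->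
        - r * h z - mu * h1 z + sigma ^+ 2 / 2 * h2 z
        + sup [set (beta + h1 z) * u | u in `[0, u0]]
        = (if d < z then 1 else 0)].

End HJB.

(* Main.v *)
(**
For a drawdown process D started at z and f of class C^2 with f'(0) = 0, the running
maximum contributes nothing, and Ito's formula gives
  f z + E \int_0^oo e^{-rs} (G f)(D_s, U_s) ds = 0,
  (G f)(x, u) = - r f - mu f' + u f' + sigma^2 / 2 f'',
with >= 0 when only f'(0) <= 0 is known. By the HJB equation
(G h)(x, u) <= 1_{x > d} - beta u, with equality for the feedback control u^*, so for f = h
the two assertions follow.

No stochastic integral is needed. X is sampled on a grid of mesh 1/(n+1), the sampled drawdown
is a reflected random walk, and f is expanded to second order along it. The first and second
order noise terms average out by independence of Brownian increments, and the only error
not of order mesh^{3/2} per step comes from the overshoots below 0, whose sum is controlled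
by the running maximum. Then n tends to infinity.

Since h'' jumps at d, h is first replaced by h - c_N where c_N'' carries the jump of h'' and
smooths it over a layer of width 1/N; c_N, c_N' and c_N'' tend to 0 pointwise with c_N''
bounded, so dominated convergence suffices and no local time or occupation estimate is used.
*)
Require Import Defs.
From HB Require Import structures.
From mathcomp Require Import all_boot all_order all_algebra.
From mathcomp Require Import all_classical all_reals all_analysis.
From mathcomp Require Import measurable_realfun lebesgue_measure lebesgue_integral ring lra.
Import Order.TTheory GRing.Theory Num.Theory.
Import numFieldNormedType.Exports.
Set Implicit Arguments. Unset Strict Implicit. Unset Printing Implicit Defensive.
Local Open Scope classical_set_scope.
Local Open Scope ring_scope.

(** * Integration toolkit and Gaussian moments *)

(** The discrete expansion is proved as an inequality only, for functions whose derivative at 0 is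
    at most 0. Monotonicity of h gives that sign and with it the upper bound on every v^U; when
    h'(0) = 0 the same inequality applies to -h and yields the reverse bound. The error of a
    reflecting step is of order |xi| o, with xi the increment and o the overshoot. This product is
    replaced by eta o + |xi|^3 / eta: the overshoots have bounded total expectation, the cubes are
    of order mesh^{3/2}, and eta is sent to 0 after the mesh. A solution of the HJB equation comes
    with bounds on h alone. Bounds on h' and h'' have to be derived from the equation, and so does
    the Lipschitz continuity of h'' away from its jump, by solving the equation for h''; the height
    of the jump is then exactly 2 / sigma^2. The layer functions c_N are explicit, with c_N'' a
    multiple of (1 - N x) e^{-N x} at distance x to the right of d. *)

Section rint.
Context d (T : measurableType d) (R : realType) (mu : {measure set T -> \bar R}).
Implicit Types f g : T -> R.

Definition rint f := mu.-integrable setT (EFin \o f).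
Definition Ex f := Rintegral mu setT f.

Lemma rint_meas f : rint f -> measurable_fun setT f.
Proof. by move=> /(measurable_int mu) /measurable_EFinP. Qed.

Lemma rint_le f g : measurable_fun setT f -> (forall x, `|f x| <= g x) ->
  rint g -> rint f.
Proof.
move=> mf fg; apply: le_integrable => //; first exact/measurable_EFinP.
by move=> x _ /=; rewrite lee_fin (le_trans (fg x))// ler_norm.
Qed.

Lemma eq_rint f g : f =1 g -> rint f -> rint g.
Proof. by move=> /funext ->. Qed.

Lemma rintD f g : rint f -> rint g -> rint (fun x => f x + g x).
Proof. by move=> rf rg; have := integrableD measurableT rf rg. Qed.

Lemma rintB f g : rint f -> rint g -> rint (fun x => f x - g x).
Proof. by move=> rf rg; have := integrableB measurableT rf rg. Qed.

Lemma rintZ c f : rint f -> rint (fun x => c * f x).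
Proof. by move=> rf; have := integrableZl measurableT c rf. Qed.

Lemma rint_norm f : rint f -> rint (fun x => `|f x|).
Proof. by move=> rf; have := integrable_abse rf. Qed.

Lemma eq_Ex f g : f =1 g -> Ex f = Ex g.
Proof. by move=> /funext ->. Qed.

Lemma ExD f g : rint f -> rint g -> Ex (fun x => f x + g x) = Ex f + Ex g.
Proof. exact: RintegralD. Qed.

Lemma ExB f g : rint f -> rint g -> Ex (fun x => f x - g x) = Ex f - Ex g.
Proof. exact: RintegralB. Qed.

Lemma ExZ c f : rint f -> Ex (fun x => c * f x) = c * Ex f.
Proof. exact: RintegralZl. Qed.

Lemma ExN f : rint f -> Ex (fun x => - f x) = - Ex f.
Proof.
move=> rf; rewrite -mulN1r -ExZ//; apply: eq_Ex => x; by rewrite mulN1r.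
Qed.

Lemma le_Ex f g : rint f -> rint g -> (forall x, f x <= g x) -> Ex f <= Ex g.
Proof. by move=> rf rg fg; apply: le_Rintegral. Qed.

Lemma Ex_ge0 f : (forall x, 0 <= f x) -> 0 <= Ex f.
Proof. by move=> f0; apply: Rintegral_ge0. Qed.

Lemma ler_norm_Ex f g : rint f -> rint g -> (forall x, `|f x| <= g x) -> `|Ex f| <= Ex g.
Proof.
move=> rf rg fg; apply: (le_trans (le_normr_Rintegral _ rf)) => //.
by apply: le_Ex => //; exact: rint_norm.
Qed.

Lemma EFin_Ex f : rint f -> (Ex f)%:E = (\int[mu]_x (f x)%:E)%E.
Proof. by move=> rf; rewrite /Ex /Rintegral fineK//; exact: integrable_fin_num rf. Qed.

End rint.

Section rint_prob.
Context d (T : measurableType d) (R : realType) (P : probability T R).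

Lemma rint_cst (c : R) : rint P (fun=> c).
Proof. exact: finite_measure_integrable_cst. Qed.

Lemma rint_bnd (f : T -> R) (B : R) : measurable_fun setT f ->
  (forall x, `|f x| <= B) -> rint P f.
Proof. by move=> mf fB; apply: (rint_le mf fB); exact: rint_cst. Qed.

Lemma Ex_cst (c : R) : Ex P (fun=> c) = c.
Proof. by rewrite /Ex Rintegral_cst//= (_ : P setT = 1%E) ?mulr1//; exact: probability_setT. Qed.

Lemma rint_sqr (f : T -> R) : measurable_fun setT f ->
  rint P (fun x => f x ^+ 2) -> rint P f.
Proof.
move=> mf rf; apply: (rint_le mf _ (rintD (rint_cst 1) rf)) => x.
have := sqr_ge0 (`|f x| - 1); rewrite sqrrB1 real_normK ?num_real//.
by have := sqr_ge0 (f x); lra.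
Qed.

Lemma rint_mul (f g : T -> R) : measurable_fun setT f -> measurable_fun setT g ->
  rint P (fun x => f x ^+ 2) -> rint P (fun x => g x ^+ 2) ->
  rint P (fun x => f x * g x).
Proof.
move=> mf mg rf rg; apply: (rint_le _ _ (rintD rf rg)).
  exact: measurable_funM.
move=> x; rewrite normrM; have := sqr_ge0 (`|f x| - `|g x|).
rewrite sqrrB !real_normK ?num_real//.
have := sqr_ge0 (f x); have := sqr_ge0 (g x); nra.
Qed.

Lemma rint_bndM (f g : T -> R) (B : R) : measurable_fun setT f ->
  (forall x, `|f x| <= B) -> rint P g -> rint P (fun x => f x * g x).
Proof.
move=> mf fB rg; apply: (rint_le _ _ (rintZ B (rint_norm rg))).
  by apply: measurable_funM => //; exact: rint_meas rg.
by move=> x; rewrite normrM ler_wpM2r.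
Qed.

Lemma bounded_cvg_Ex (f_ : nat -> T -> R) (f : T -> R) (B : R) :
  (forall n, measurable_fun setT (f_ n)) -> measurable_fun setT f ->
  (forall n x, `|f_ n x| <= B) -> (forall x, f_ n x @[n --> \oo] --> f x) ->
  Ex P (f_ n) @[n --> \oo] --> Ex P f.
Proof.
move=> mf_ mf fB cf.
have mE_ n : measurable_fun setT (EFin \o f_ n) by exact/measurable_EFinP.
have mE : measurable_fun setT (EFin \o f) by exact/measurable_EFinP.
have c : {ae P, forall x, setT x -> (fun n => (EFin \o f_ n) x) @ \oo --> (EFin \o f) x}.
  apply: aeW => x _; apply: cvg_EFin; last exact: cf.
  exact: nearW.
have b : {ae P, forall x n, setT x -> (`|(EFin \o f_ n) x| <= (cst B%:E) x)%E}.
  by apply: aeW => x n _ /=; rewrite lee_fin.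
have [h1 h2 h3] := dominated_convergence measurableT mE_ mE c (rint_cst B) b.
by move: h3; rewrite -(EFin_Ex h1) => /fine_cvg.
Qed.

End rint_prob.

(** Change of variables is available with the Radon-Nikodym derivative of [normal_prob]. It
    integrates to the same value as [normal_pdf] over every measurable set, so the two agree almost
    everywhere. *)
Lemma ge0_integral_normal_prob (R : realType) (m s : R) (f : R -> \bar R) :
  (forall x, 0 <= f x)%E -> measurable_fun setT f ->
  (\int[normal_prob m s]_x f x = \int[lebesgue_measure]_x (f x * (normal_pdf m s x)%:E))%E.
Proof.
move=> f0 mf.
rewrite -(Radon_Nikodym_SigmaFinite.change_of_variables (normal_prob_dominates m s))//=.
apply: ae_eq_integral => //.
- apply: emeasurable_funM => //; apply: (measurable_int lebesgue_measure).
  exact: Radon_Nikodym_SigmaFinite.f_integrable (normal_prob_dominates m s).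
- apply: emeasurable_funM => //=; apply/measurable_EFinP.
  exact: measurable_normal_pdf.
- apply: ae_eqe_mul2l => /=.
  apply: integral_ae_eq => //=.
  + exact: Radon_Nikodym_SigmaFinite.f_integrable (normal_prob_dominates m s).
  + by apply/measurable_EFinP; exact: measurable_normal_pdf.
  + move=> E _ mE.
    by rewrite -(Radon_Nikodym_SigmaFinite.f_integral (normal_prob_dominates m s)).
Qed.

(** * Moments of the centred Gaussian law *)

Section normal_moments.
Context {R : realType}.
Variable s : R.
Hypothesis s0 : 0 < s.
Let p := @normal_pdf R 0 s.
Local Notation mu := (@lebesgue_measure R).
Let sn0 : s != 0. Proof. by rewrite gt_eqF. Qed.
Let pE : p = fun x => normal_peak s * expR (- (s ^+ 2 * 2)^-1 * x ^+ 2).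
Proof.
apply/funext => x; rewrite /p /normal_pdf (negbTE sn0)/= /normal_fun subr0.
congr (_ * expR _); rewrite -mulr_natr; field; exact: sn0.
Qed.

Lemma is_derive_normal_pdf (x : R) : is_derive x 1 p (- (x / s ^+ 2) * p x).
Proof.
have h : is_derive x 1 (fun x => - (s ^+ 2 * 2)^-1 * x ^+ 2) (- (x / s ^+ 2)).
  apply: is_derive_eq; rewrite /GRing.scale /=; field; exact: sn0.
have := @is_derive1_comp R expR (fun x => - (s ^+ 2 * 2)^-1 * x ^+ 2) x _ _ _ h.
move=> /(_ _ (is_derive_expR _)) h2.
rewrite pE.
have -> : (fun x => normal_peak s * expR (- (s ^+ 2 * 2)^-1 * x ^+ 2)) = (normal_peak s \*: (expR \o (fun x => - (s ^+ 2 * 2)^-1 * x ^+ 2))) by [].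
apply: is_derive_eq; rewrite /GRing.scale /=; ring.
Qed.

Let Phi (x : R) : R := (\int[mu]_(t in `]-oo, x]) p t)%R.

Lemma Phi_derive (x : R) : is_derive x 1 Phi (p x).
Proof.
have H1 : x < x + 1 by rewrite ltrDl.
have H2 : mu.-integrable `]-oo, (x + 1)] (EFin \o p).
  apply: (@integrableS _ _ _ mu setT) => //; exact: integrable_normal_pdf.
have H3 := @continuous_normal_pdf R 0 s sn0 x.
have [|dF dFE] := @continuous_FTC1 R p -oo%O x (x + 1) H1 H2 _ H3.
  by rewrite /= ltNyr.
split; first exact: dF.
by rewrite -derive1E; exact: dFE.
Qed.

Lemma Phi_cvg : Phi x @[x --> +oo] --> (1 : R).
Proof.
pose X0 : measurableTypeR R -> R := idfun.
have mid : X0 \in mfun by rewrite inE; exact: measurable_id.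
have := @cvg_cdfy1 _ _ R (normal_prob 0 s) (mfun_Sub mid).
by move=> /fine_cvg.
Qed.

(** With y = x^2 / (6 s^2) the exponential factor is e^{-3 y}, and y <= e^y gives y^3 e^{-3 y} <= 1.
    The constant comes from x^6 = 216 s^6 y^3. The resulting decay disposes of the boundary terms of
    both even moments. *)
Lemma bound_pdf (x : R) : 0 < x -> x ^+ 3 * p x <= 216 * s ^+ 6 * normal_peak s / x ^+ 3.
Proof.
move=> x0; rewrite pE.
set y := x ^+ 2 / (s ^+ 2 * 6).
have -> : - (s ^+ 2 * 2)^-1 * x ^+ 2 = - (y * 3%:R) by rewrite /y; field.
rewrite expRN expRM_natr.
have y0 : 0 < y by rewrite divr_gt0 ?exprn_gt0// mulr_gt0// exprn_gt0.
have e1 : y ^+ 3 <= expR y ^+ 3.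
  rewrite lerXn2r ?nnegrE ?expR_ge0 ?(ltW y0)//.
  by apply: le_trans (expR_ge1Dx _); rewrite lerDr.
rewrite ler_pdivlMr ?exprn_gt0//.
have -> : x ^+ 3 * (normal_peak s * (expR y ^+ 3)^-1) * x ^+ 3 =
  normal_peak s * (216 * s ^+ 6 * (y ^+ 3 / expR y ^+ 3)).
  rewrite /y; field.
  by rewrite gt_eqF ?expR_gt0//= sn0.
have e2 : y ^+ 3 / expR y ^+ 3 <= 1.
  by rewrite ler_pdivrMr ?mul1r// exprn_gt0// expR_gt0.
rewrite mulrC ler_wpM2r ?normal_peak_ge0//.
by rewrite ler_piMr// mulr_ge0// exprn_ge0// ltW.
Qed.

Let p_ge0 x : 0 <= p x. Proof. exact: normal_pdf_ge0. Qed.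

Lemma x3p_cvg : x ^+ 3 * p x @[x --> +oo] --> (0 : R).
Proof.
apply: (@squeeze_cvgr _ _ _ _ (cst 0) (fun x => 216 * s ^+ 6 * normal_peak s * x^-1)).
- near=> x.
  have x1 : 1 <= x by near: x; exact: nbhs_pinfty_ge.
  have x0 : 0 < x by exact: lt_le_trans x1.
  rewrite mulr_ge0 ?exprn_ge0 ?(ltW x0)//=.
  apply: (le_trans (bound_pdf x0)).
  rewrite ler_wpM2l ?mulr_ge0 ?exprn_ge0 ?(ltW s0) ?normal_peak_ge0//.
  by rewrite lef_pV2 ?posrE ?exprn_gt0// -[leLHS]expr1 ler_weXn2l.
- exact: cvg_cst.
- rewrite -(mulr0 (216 * s ^+ 6 * normal_peak s)); apply: cvgMr.
  apply/gtr0_cvgV0; first by near=> x; near: x; exact: nbhs_pinfty_gt.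
  exact: cvg_id.
Unshelve. all: by end_near. Qed.

Lemma xp_cvg : x * p x @[x --> +oo] --> (0 : R).
Proof.
apply: (@squeeze_cvgr _ _ _ _ (cst 0) (fun x => x ^+ 3 * p x)).
- near=> x.
  have x1 : 1 <= x by near: x; exact: nbhs_pinfty_ge.
  have x0 : 0 < x by exact: lt_le_trans x1.
  rewrite mulr_ge0 ?(ltW x0)//= ler_wpM2r// -[leLHS]expr1 ler_weXn2l//.
- exact: cvg_cst.
- exact: x3p_cvg.
Unshelve. all: by end_near. Qed.

Lemma half_integral (f F : R -> R) (l : R) : (forall x, 0 <= f x) ->
  continuous f -> (forall x, f (- x) = f x) ->
  (forall x : R, is_derive x 1 F (f x)) -> F x @[x --> +oo] --> l ->
  (\int[mu]_x (f x)%:E = (2 * (l - F 0))%:E)%E.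
Proof.
move=> f0 cf fe dF Fl.
rewrite ge0_symfun_integralT//; last by move=> x; rewrite /= fe.
rewrite EFinM; congr (_ * _)%E.
rewrite (_ : [set x | 0 <= x] = `[0, +oo[%classic); last first.
  by apply/seteqP; split => x /=; rewrite in_itv/= andbT.
rewrite (@ge0_continuous_FTC2y _ f F 0 l)//.
- by apply: continuous_subspaceT => x; exact: cf.
- apply: cvg_at_right_filter.
  apply: differentiable_continuous; apply/derivable1_diffP.
  by case: (dF 0).
- by move=> x _; rewrite derive1E; apply: derive_val.
Qed.

Let p_even x : p (- x) = p x. Proof. by rewrite pE sqrrN. Qed.
Let p_cont : continuous p. Proof. exact: continuous_normal_pdf. Qed.

(** The density has total mass 1, so [half_integral] with the antiderivative [Phi] reads 1 = 2 (1 -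
    [Phi 0]). *)
Lemma Phi0 : Phi 0 = 2^-1.
Proof.
have := half_integral p_ge0 p_cont p_even Phi_derive Phi_cvg.
rewrite integral_normal_pdf => -[] h; lra.
Qed.

(** [F2] and [F4] come from integration by parts with p' = - x p / s^2: they are antiderivatives of
    x^2 p and x^4 p, the second expressed through the first. *)
Let F2 (x : R) : R := s ^+ 2 * (Phi x - x * p x).
Let F4 (x : R) : R := 3 * s ^+ 2 * F2 x - s ^+ 2 * (x ^+ 3 * p x).

Let dF2 (x : R) : is_derive x 1 F2 (x ^+ 2 * p x).
Proof.
have h1 := Phi_derive x; have h2 := is_derive_normal_pdf x.
have -> : F2 = s ^+ 2 \*: (Phi - (id * p)) by [].
apply: is_derive_eq; rewrite /GRing.scale /=; field; exact: sn0.
Qed.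

Let dF4 (x : R) : is_derive x 1 F4 (x ^+ 4 * p x).
Proof.
have h1 := dF2 x; have h2 := is_derive_normal_pdf x.
have -> : F4 = (3 * s ^+ 2) \*: F2 - s ^+ 2 \*: ((fun x => x ^+ 3) * p) by [].
apply: is_derive_eq; rewrite /GRing.scale /=; field; exact: sn0.
Qed.

Let cF2 : F2 x @[x --> +oo] --> s ^+ 2.
Proof.
rewrite -[s ^+ 2 in X in _ --> X]mulr1 -[1 in X in _ --> X]subr0.
by apply: cvgMr; apply: cvgB; [exact: Phi_cvg|exact: xp_cvg].
Qed.

Let cF4 : F4 x @[x --> +oo] --> 3 * s ^+ 2 * s ^+ 2.
Proof.
rewrite -[X in _ --> X]subr0 -[0 in X in _ --> X](mulr0 (s ^+ 2)).
by apply: cvgB; apply: cvgMr; [exact: cF2|exact: x3p_cvg].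
Qed.

Let int2 : (\int[mu]_x (x ^+ 2 * p x)%:E = (s ^+ 2)%:E)%E.
Proof.
rewrite (half_integral _ _ _ dF2 cF2).
- by congr EFin; rewrite /F2 Phi0 mul0r subr0; field.
- by move=> x; rewrite mulr_ge0// sqr_ge0.
- move=> x; apply: cvgM; last exact: p_cont.
  exact: exprn_continuous.
- by move=> x; rewrite sqrrN p_even.
Qed.

Let int4 : (\int[mu]_x (x ^+ 4 * p x)%:E = (3 * s ^+ 4)%:E)%E.
Proof.
rewrite (half_integral _ _ _ dF4 cF4).
- by congr EFin; rewrite /F4 /F2 Phi0 mul0r subr0; field.
- by move=> x; rewrite mulr_ge0// exprn_even_ge0.
- move=> x; apply: cvgM; last exact: p_cont.
  exact: exprn_continuous.
- by move=> x; rewrite p_even; congr (_ * _); ring.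
Qed.

Let int1 : (\int[mu]_x (`|x| * p x)%:E = 2%:E * \int[mu]_x (Num.max x 0 * p x)%:E)%E.
Proof.
rewrite ge0_symfun_integralT//.
- congr (_ * _)%E.
  rewrite integral_mkcond; apply: eq_integral => x _.
  rewrite patchE; have [x0|x0] := leP 0 x.
    by rewrite mem_set//= ger0_norm// max_l.
  by rewrite memNset/= ?mul0r// => /(lt_le_trans x0); rewrite ltxx.
- by move=> x; rewrite mulr_ge0.
- move=> x; apply: cvgM; last exact: p_cont.
  exact: norm_continuous.
- by move=> x; rewrite /= normrN p_even.
Qed.

Local Notation N := (normal_prob 0 s).

Lemma normal_even_moment k (c : R) : ~~ odd k -> (\int[mu]_x (x ^+ k * p x)%:E = c%:E)%E ->
  rint N (fun x : R => x ^+ k) /\ Ex N (fun x : R => x ^+ k) = c.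
Proof.
move=> ek h.
have mk : measurable_fun setT (fun x : R => (x ^+ k)%:E).
  by apply/measurable_EFinP; exact: exprn_measurable.
have h0 (x : R) : (0 <= (x ^+ k)%:E)%E by rewrite lee_fin exprn_even_ge0.
have h2 : (\int[N]_x (x ^+ k)%:E = c%:E)%E.
  by rewrite ge0_integral_normal_prob// -h.
split; last by rewrite /Ex /Rintegral h2.
apply/integrableP; split => //.
under eq_integral do rewrite /= ger0_norm ?exprn_even_ge0//.
by rewrite h2 ltry.
Qed.

Lemma normal_moment2 :
  rint N (fun x : R => x ^+ 2) /\ Ex N (fun x : R => x ^+ 2) = s ^+ 2.
Proof. exact: normal_even_moment int2. Qed.

Lemma normal_moment4 :
  rint N (fun x : R => x ^+ 4) /\ Ex N (fun x : R => x ^+ 4) = 3 * s ^+ 4.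
Proof. exact: normal_even_moment int4. Qed.

(** [ge0_integral_normal_prob] requires a nonnegative integrand, so x is written as 2 max(x, 0) -
    |x|; by [int1] the two integrals cancel. *)
Lemma normal_moment1 : rint N (fun x : R => x) /\ Ex N (fun x : R => x) = 0.
Proof.
have i1 : rint N (fun x : R => x) by apply: rint_sqr => //; exact: normal_moment2.1.
have i2 : rint N (fun x : R => `|x|) by exact: rint_norm.
have mm : measurable_fun setT (fun x : R => Num.max x 0) by apply: measurable_maxr.
have i3 : rint N (fun x : R => Num.max x 0).
  by apply: (@rint_le _ _ _ N _ (fun x => `|x|)) => // x; case: (leP x 0) => x0; rewrite ?normr0.
split => //.
have -> : Ex N (fun x : R => x) = Ex N (fun x : R => 2 * Num.max x 0 - `|x|).
  apply: eq_Ex => x; case: (leP x 0) => x0; [rewrite ler0_norm//|rewrite gtr0_norm//]; lra.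
rewrite ExB//; last exact: rintZ.
rewrite ExZ//.
have -> : Ex N (fun x => `|x|) = 2 * Ex N (fun x : R => Num.max x 0).
  have m0 (x : R) : 0 <= Num.max x 0 by rewrite le_max lexx orbT.
  apply: EFin_inj; rewrite EFinM !EFin_Ex//.
  rewrite !ge0_integral_normal_prob//.
  - by apply/measurable_EFinP.
  - by apply/measurable_EFinP; exact: normr_measurable.
by rewrite subrr.
Qed.

End normal_moments.

(** * Independence of Brownian increments *)

Section law.
Context d d' (T : measurableType d) (T' : measurableType d') (R : realType)
  (P : probability T R) (X : {mfun T >-> T'}).

Lemma rint_law (f : T' -> R) : measurable_fun setT f ->
  rint P (f \o X) -> rint (distribution P X) f.
Proof.
move=> mf rf; apply: integrable_pushforward => //.
exact/measurable_EFinP.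
Qed.

Lemma Ex_law (f : T' -> R) : measurable_fun setT f ->
  rint P (f \o X) -> Ex (distribution P X) f = Ex P (f \o X).
Proof.
move=> mf rf; rewrite /Ex /Rintegral (@integral_distribution _ _ _ _ _ P X (EFin \o f))//.
exact/measurable_EFinP.
Qed.

Lemma rint_lawE (f : T' -> R) : measurable_fun setT f ->
  rint (distribution P X) f -> rint P (f \o X).
Proof.
move=> mf /integrableP[_ h]; apply/integrableP; split.
  by apply/measurable_EFinP; apply: measurableT_comp.
move: h; rewrite ge0_integral_distribution//.
by apply/measurable_EFinP; apply: measurableT_comp.
Qed.

End law.

Section independence.
Context d d' d'' (T : measurableType d) (T1 : measurableType d') (T2 : measurableType d'')
  (R : realType) (P : probability T R).
Context (Q : probability T2 R) (Y : {mfun T >-> T1}) (V : {mfun T >-> T2}).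
Hypothesis YV : forall A B, measurable A -> measurable B ->
  P (Y @^-1` A `&` V @^-1` B) = (P (Y @^-1` A) * Q B)%E.

(** The product formula on rectangles identifies the law of the pair (Y, V) with the product of the
    law of [Y] and [Q], by uniqueness of product measures. Tonelli then gives integrability and
    Fubini the value. *)
Lemma indep_Ex (f : T1 -> R) (g : T2 -> R) :
  measurable_fun setT f -> rint P (f \o Y) -> rint Q g ->
  rint P (fun w => f (Y w) * g (V w)) /\
  Ex P (fun w => f (Y w) * g (V w)) = Ex P (f \o Y) * Ex Q g.
Proof.
move=> mf rf rg.
have mg := rint_meas rg.
have mZ : (fun w => (Y w, V w)) \in mfun.
  by rewrite inE; apply: measurable_fun_pair.
pose Z : {mfun T >-> (T1 * T2)%type} := mfun_Sub mZ.
have lawE : forall A, measurable A -> (distribution P Y \x Q)%E A = distribution P Z A.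
  by apply: product_measure_unique => A B mA mB; rewrite -YV.
pose k (z : T1 * T2) := f z.1 * g z.2.
have mk : measurable_fun setT k.
  by apply: measurable_funM; apply: measurableT_comp.
have rfY := rint_law mf rf.
have rk : rint (distribution P Y \x Q)%E k.
  apply/(@integrable12ltyP _ _ _ _ _ (distribution P Y) Q); first exact/measurable_EFinP.
  under eq_integral do under eq_integral do rewrite /k /= normrM EFinM.
  have E1 x : (\int[Q]_y (`|f x|%:E * `|g y|%:E) = (`|f x| * Ex Q (fun y => `|g y|))%:E)%E.
    rewrite ge0_integralZl//; last by apply/measurable_EFinP; apply: measurableT_comp.
    by rewrite EFinM EFin_Ex//; exact: rint_norm.
  under eq_integral do rewrite E1.
  have : rint (distribution P Y) (fun x => Ex Q (fun y => `|g y|) * `|f x|).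
    by apply: rintZ; exact: rint_norm.
  move=> /integrableP[_]; apply: le_lt_trans.
  apply: ge0_le_integral => //=.
  - by move=> x _; rewrite lee_fin mulr_ge0// Ex_ge0.
  - by apply/measurable_EFinP; apply: measurable_funM => //; apply: measurableT_comp.
  - by apply/measurable_EFinP; apply: measurableT_comp => //; apply: measurable_funM => //; apply: measurableT_comp.
  - by move=> x _; rewrite lee_fin mulrC ler_norm.
have lawI h : measurable_fun setT h -> (forall x, 0 <= h x)%E ->
    (\int[distribution P Y \x Q]_x h x = \int[distribution P Z]_x h x)%E.
  by move=> mh h0; apply: eq_measure_integral => A mA _; exact: lawE.
have rkZ : rint (distribution P Z) k.
  move/integrableP : rk => [mk1 hk]; apply/integrableP; split => //.
  rewrite -lawI//; exact: measurableT_comp.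
split; first exact: (rint_lawE mk rkZ).
rewrite -[LHS]/(Ex P (k \o Z)) -(Ex_law mk (rint_lawE mk rkZ)).
apply: EFin_inj; rewrite EFinM -(Ex_law mf rf).
rewrite !EFin_Ex//.
have -> : (\int[distribution P Z]_x (k x)%:E = \int[distribution P Y \x Q]_x (k x)%:E)%E.
  by apply: eq_measure_integral => A mA _; exact/esym/lawE.
rewrite -(@integral12_prod_meas1 _ _ _ _ _ (distribution P Y) Q)//.
rewrite -EFin_Ex// -EFin_Ex// -EFinM mulrC -ExZ// EFin_Ex; last exact: rintZ.
apply: eq_integral => x _; rewrite /fubini_F /k /=.
by rewrite mulrC -ExZ// EFin_Ex//; exact: rintZ.
Qed.

End independence.

Lemma measurable_wrtS d (T : measurableType d) (R : realType) (G H : set (set T)) (f : T -> R) :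
  G `<=` H -> measurable_wrt G f -> measurable_wrt H f.
Proof. by move=> GH mf B mB; apply: GH; exact: mf. Qed.

Section measurable_wrt.
Context d (T : measurableType d) (R : realType) (G : set (set T)).
Hypothesis sG : sigma_algebra setT G.
Implicit Types f g : T -> R.

(** Regards the sub-sigma-algebra as the measurable structure of a type of its own, which gives
    access to the closure properties of measurable functions. *)
Lemma measurable_wrtP f :
  measurable_wrt G f <-> measurable_fun (setT : set (g_sigma_algebraType G)) (f : g_sigma_algebraType G -> R).
Proof.
split=> mf.
  move=> _ B mB; rewrite setTI; apply: sub_sigma_algebra; exact: mf.
move=> B mB; have : <<s G >> (f @^-1` B).
  by have := mf measurableT _ mB; rewrite setTI.
by rewrite sigma_algebra_id.
Qed.

Lemma measurable_wrt_comp (phi : R -> R) f : measurable_fun setT phi ->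
  measurable_wrt G f -> measurable_wrt G (fun w => phi (f w)).
Proof.
by move=> mphi /measurable_wrtP mf; apply/measurable_wrtP; apply: measurableT_comp.
Qed.

Lemma measurable_wrtD f g : measurable_wrt G f -> measurable_wrt G g ->
  measurable_wrt G (fun w => f w + g w).
Proof.
by move=> /measurable_wrtP mf /measurable_wrtP mg; apply/measurable_wrtP; apply: measurable_funD.
Qed.

Lemma measurable_wrt_cst (c : R) : measurable_wrt G (fun=> c).
Proof. by apply/measurable_wrtP; exact: measurable_cst. Qed.

End measurable_wrt.

(** * Adapted variables up to L^2 limits *)

Section approx.
Context d (T : measurableType d) (R : realType) (P : probability T R).
Implicit Types (G : set (set T)) (Y : T -> R).

(* The filtration is not assumed complete and the controls are only adapted and jointly
   measurable, so \int_0^t U need not be F t-measurable. Being an L^2 limit of F t-measurable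
   variables is enough for orthogonality to later increments. *)
Definition approx G Y := [/\ measurable_fun setT Y, rint P (fun w => Y w ^+ 2) &
  forall e : R, 0 < e -> exists Y', [/\ measurable_wrt G Y', rint P (fun w => Y' w ^+ 2) &
    Ex P (fun w => (Y w - Y' w) ^+ 2) <= e]].

Lemma approxS G H Y : G `<=` H -> approx G Y -> approx H Y.
Proof.
move=> GH [mY rY h]; split => // e e0; have [Y' [mY' rY' eY']] := h _ e0.
by exists Y'; split => //; exact: measurable_wrtS mY'.
Qed.

Lemma rint_sqrD (f g : T -> R) : measurable_fun setT f -> measurable_fun setT g ->
  rint P (fun w => f w ^+ 2) -> rint P (fun w => g w ^+ 2) -> rint P (fun w => (f w + g w) ^+ 2).
Proof.
move=> mf mg rf rg.
apply: (rint_le _ _ (rintD (rintZ 2 rf) (rintZ 2 rg))).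
  by apply: measurable_funX; exact: measurable_funD.
move=> w; rewrite ger0_norm ?sqr_ge0//; have := sqr_ge0 (f w - g w); nra.
Qed.

Lemma rint_sqrB (f g : T -> R) : measurable_fun setT f -> measurable_fun setT g ->
  rint P (fun w => f w ^+ 2) -> rint P (fun w => g w ^+ 2) -> rint P (fun w => (f w - g w) ^+ 2).
Proof.
move=> mf mg rf rg; apply: rint_sqrD => //; first exact: measurableT_comp.
by apply: eq_rint rg => w; rewrite sqrrN.
Qed.

Variable G : set (set T).
Hypothesis sG : sigma_algebra setT G.
Hypothesis GM : G `<=` measurable.

Lemma wrt_meas Y : measurable_wrt G Y -> measurable_fun setT Y.
Proof. by move=> mY _ B mB; rewrite setTI; apply: GM; exact: mY. Qed.

Lemma approx_wrt Y : measurable_wrt G Y -> rint P (fun w => Y w ^+ 2) -> approx G Y.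
Proof.
move=> mY rY; split => //; first exact: wrt_meas.
move=> e e0; exists Y; split => //.
under eq_Ex do rewrite subrr expr0n/=.
by rewrite Ex_cst ltW.
Qed.

Lemma approxD Y Z : approx G Y -> approx G Z -> approx G (fun w => Y w + Z w).
Proof.
move=> [mY rY hY] [mZ rZ hZ]; split; first exact: measurable_funD.
  exact: rint_sqrD.
move=> e e0; have e4 : 0 < e / 4 by lra.
have [Y' [mY' rY' eY']] := hY _ e4; have [Z' [mZ' rZ' eZ']] := hZ _ e4.
have mY2 := wrt_meas mY'; have mZ2 := wrt_meas mZ'.
exists (fun w => Y' w + Z' w); split; first exact: measurable_wrtD.
  exact: rint_sqrD.
have r1 := rint_sqrB mY mY2 rY rY'; have r2 := rint_sqrB mZ mZ2 rZ rZ'.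
apply: (@le_trans _ _ (Ex P (fun w => 2 * (Y w - Y' w) ^+ 2 + 2 * (Z w - Z' w) ^+ 2))).
  apply: le_Ex; last by move=> w; have := sqr_ge0 ((Y w - Y' w) - (Z w - Z' w)); nra.
    apply: rint_sqrB; [exact: measurable_funD|exact: measurable_funD|exact: rint_sqrD..].
  by apply: rintD; exact: rintZ.
rewrite ExD; [|exact: rintZ..]; rewrite !ExZ//; lra.
Qed.

(** Composition with [phi] multiplies the squared L^2 error by at most L^2 and keeps measurability
    with respect to [G]. It serves the positive part in the reflection, the functions [f1] and [f2],
    and multiplication by constants. *)
Lemma approx_lip (phi : R -> R) (L : R) Y : (forall x y, `|phi x - phi y| <= L * `|x - y|) ->
  measurable_fun setT phi -> approx G Y -> approx G (fun w => phi (Y w)).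
Proof.
move=> hphi mphi [mY rY hY].
have L0 : 0 <= L by have := hphi 1 0; rewrite subr0 normr1 mulr1; apply: le_trans.
have rphi (f : T -> R) : measurable_fun setT f -> rint P (fun w => f w ^+ 2) -> rint P (fun w => phi (f w) ^+ 2).
  move=> mf rf; apply: (rint_le _ _ (rintD (rint_cst P (2 * (phi 0) ^+ 2)) (rintZ (2 * L ^+ 2) rf))).
    by apply: measurable_funX; exact: measurableT_comp.
  move=> w; rewrite ger0_norm ?sqr_ge0//.
  have h1 : (phi (f w) - phi 0) ^+ 2 <= L ^+ 2 * f w ^+ 2.
    rewrite -(real_normK (num_real (_ - _))) -(real_normK (num_real (f w))) -exprMn.
    by rewrite lerXn2r ?nnegrE ?mulr_ge0//; have := hphi (f w) 0; rewrite subr0.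
  have := sqr_ge0 (phi (f w) - 2 * phi 0); nra.
split; [exact: measurableT_comp|exact: rphi|] => e e0.
have e4 : 0 < e / (L ^+ 2 + 1) by rewrite divr_gt0// ltr_wpDl// sqr_ge0.
have [Y' [mY' rY' eY']] := hY _ e4.
have mY2 := wrt_meas mY'.
exists (fun w => phi (Y' w)); split; [exact: measurable_wrt_comp|exact: rphi|].
apply: (@le_trans _ _ (Ex P (fun w => L ^+ 2 * (Y w - Y' w) ^+ 2))).
  apply: le_Ex.
  - by apply: rint_sqrB; [exact: measurableT_comp|exact: measurableT_comp|exact: rphi..].
  - by apply: rintZ; exact: rint_sqrB.
  move=> w; rewrite -(real_normK (num_real (_ - _))) -(real_normK (num_real (Y w - Y' w))) -exprMn.
  by rewrite lerXn2r ?nnegrE ?mulr_ge0.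
rewrite ExZ; last exact: rint_sqrB.
apply: (le_trans (ler_wpM2l (sqr_ge0 L) eY')).
rewrite mulrCA ger_pMr// ler_pdivrMr ?mul1r ?lerDl//.
by rewrite ltr_wpDl// sqr_ge0.
Qed.

Lemma approx_cst c : approx G (fun=> c).
Proof. apply: approx_wrt; [exact: measurable_wrt_cst|exact: rint_cst]. Qed.

Lemma approxZ c Y : approx G Y -> approx G (fun w => c * Y w).
Proof.
apply: (@approx_lip (fun x => c * x) `|c|); last exact: measurable_funM.
by move=> x y; rewrite -mulrBr normrM.
Qed.

Lemma approxB Y Z : approx G Y -> approx G Z -> approx G (fun w => Y w - Z w).
Proof.
move=> aY aZ; have := approxD aY (approxZ (-1) aZ).
by congr approx; apply/funext => w; rewrite mulN1r.
Qed.

End approx.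

(** * Time integrals of controls *)

Section time_integrals.
Context (R : realType).
Notation leb := (@lebesgue_measure R).

Lemma integrable_bnd (D : set R) (f : R -> R) (B : R) : measurable D -> (leb D < +oo)%E ->
  measurable_fun D f -> (forall x, D x -> `|f x| <= B) -> leb.-integrable D (EFin \o f).
Proof.
move=> mD fD mf fB; apply: measurable_bounded_integrable => //.
exists B; split; first exact: num_real.
by move=> M BM x Dx; apply: le_trans (fB _ Dx) _; exact: ltW.
Qed.

Lemma norm_Rint_le (D : set R) (f : R -> R) (B : R) : measurable D -> (leb D < +oo)%E ->
  measurable_fun D f -> (forall x, D x -> `|f x| <= B) -> `|Rintegral leb D f| <= B * fine (leb D).
Proof.
move=> mD fD mf fB; have fi := integrable_bnd mD fD mf fB.
apply: (le_trans (le_normr_Rintegral _ fi)) => //.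
rewrite -Rintegral_cst//; apply: le_Rintegral => //.
- exact: integrable_norm.
- by apply: (@integrable_bnd _ _ `|B|).
Qed.

Lemma leb_cc (a b : R) : a <= b -> leb `[a, b]%classic = (b - a)%:E.
Proof.
move=> ab; rewrite lebesgue_measure_itv/= lte_fin.
by case: ltgtP ab => // -> _; rewrite subrr.
Qed.

Lemma Rint_cst_cc (a b c : R) : a <= b -> Rintegral leb `[a, b] (fun=> c) = c * (b - a).
Proof.
move=> ab; rewrite Rintegral_cst//; congr (_ * _).
by have -> : b - a = fine (leb `[a, b]%classic) by rewrite leb_cc.
Qed.

Context d (T : measurableType d) (P : probability T R).

Lemma measurable_section1 (k : R * T -> R) w : measurable_fun setT k ->
  measurable_fun setT (fun s => k (s, w)).
Proof. by move=> mk; apply: measurableT_comp. Qed.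

Lemma measurable_section2 (k : R * T -> R) s : measurable_fun setT k ->
  measurable_fun setT (fun w => k (s, w)).
Proof. by move=> mk; apply: measurableT_comp. Qed.

Let ind (D : set R) (k : R * T -> R) := fun z : R * T => \1_D z.1 * k z.

Let ind_meas D k : measurable D -> measurable_fun setT k -> measurable_fun setT (ind D k).
Proof.
move=> mD mk; apply: measurable_funM => //.
by apply: measurableT_comp => //; exact: measurable_indic.
Qed.

Let Rint_ind D k w : Rintegral leb D (fun s => k (s, w)) = Rintegral leb setT (fun s => ind D k (s, w)).
Proof.
rewrite Rintegral_mkcond; apply: eq_Rintegral => s _; rewrite patchE /ind /= indicE.
by case: (s \in D); rewrite ?mul1r ?mul0r.
Qed.

(** No integrability of the sections is assumed. The positive and negative parts of the integrand
    are handled by Tonelli, their difference is measurable as an extended real, and [fine] preserves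
    measurability. *)
Lemma measurable_Rint (D : set R) (k : R * T -> R) : measurable D -> measurable_fun setT k ->
  measurable_fun setT (fun w => Rintegral leb D (fun s => k (s, w))).
Proof.
move=> mD mk; under eq_fun do rewrite Rint_ind.
have mi := ind_meas mD mk.
apply: measurableT_comp => //.
under eq_fun do rewrite integralE.
have mE : measurable_fun setT (fun z : R * T => (ind D k z)%:E) by exact/measurable_EFinP.
apply: emeasurable_funB.
  apply: (eq_measurable_fun (fubini_G leb (fun z => (fun z : R * T => (ind D k z)%:E)^\+ z)%E)).
    by move=> w _; apply: eq_integral => s _; rewrite !funeposE.
  apply: measurable_fun_fubini_tonelli_G => //; exact: measurable_funepos.
apply: (eq_measurable_fun (fubini_G leb (fun z => (fun z : R * T => (ind D k z)%:E)^\- z)%E)).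
  by move=> w _; apply: eq_integral => s _; rewrite !funenegE.
apply: measurable_fun_fubini_tonelli_G => //; exact: measurable_funeneg.
Qed.

Lemma measurable_Ex (k : R * T -> R) : measurable_fun setT k ->
  measurable_fun setT (fun s => Ex P (fun w => k (s, w))).
Proof.
move=> mk; apply: measurableT_comp => //.
under eq_fun do rewrite integralE.
have mE : measurable_fun setT (fun z : R * T => (k z)%:E) by exact/measurable_EFinP.
apply: emeasurable_funB.
  apply: (eq_measurable_fun (fubini_F P (fun z => (fun z : R * T => (k z)%:E)^\+ z)%E)).
    by move=> s _; apply: eq_integral => w _; rewrite !funeposE.
  apply: measurable_fun_fubini_tonelli_F => //; exact: measurable_funepos.
apply: (eq_measurable_fun (fubini_F P (fun z => (fun z : R * T => (k z)%:E)^\- z)%E)).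
  by move=> s _; apply: eq_integral => w _; rewrite !funenegE.
apply: measurable_fun_fubini_tonelli_F => //; exact: measurable_funeneg.
Qed.

Lemma Rint_Ex (D : set R) (k : R * T -> R) (C : R) : measurable D -> (leb D < +oo)%E ->
  measurable_fun setT k -> (forall s w, D s -> `|k (s, w)| <= C) ->
  Rintegral leb D (fun s => Ex P (fun w => k (s, w))) =
  Ex P (fun w => Rintegral leb D (fun s => k (s, w))).
Proof.
move=> mD fD mk kC; have mi := ind_meas mD mk.
have mE : measurable_fun setT (fun z : R * T => (ind D k z)%:E) by exact/measurable_EFinP.
have kC' s w : `|ind D k (s, w)| <= `|C| * \1_D s.
  rewrite /ind /= indicE; case: (boolP (s \in D)) => [/set_mem sD|_].
    by rewrite mul1r mulr1 (le_trans (kC _ _ sD))// ler_norm.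
  by rewrite mul0r mulr0 normr0.
have rD : rint leb (fun s => `|C| * \1_D s).
  apply: rintZ; apply/integrableP; split.
    by apply/measurable_EFinP; exact: measurable_indic.
  under eq_integral do rewrite /= ger0_norm//.
  by rewrite integral_indic// setIT.
have ik : (leb \x P)%E.-integrable setT (fun z : R * T => (ind D k z)%:E).
  apply/(@integrable12ltyP _ _ _ _ _ leb P) => //.
  have /integrableP[_ hD] := rD; apply: le_lt_trans hD.
  apply: ge0_le_integral => //=.
  - by move=> s _; apply: integral_ge0.
  - have := @measurable_fun_fubini_tonelli_F _ _ _ _ _ P (fun z : R * T => `|(ind D k z)%:E|%E) _ _.
    by apply => //; apply: measurableT_comp.
  - by apply/measurable_EFinP; apply: measurableT_comp => //; exact: rint_meas rD.
  move=> s _.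
  apply: (@le_trans _ _ (\int[P]_w (`|C| * \1_D s)%:E)%E).
    apply: ge0_le_integral => //=.
    - by apply/measurable_EFinP; apply: measurableT_comp => //; exact: (measurable_section2 s mi).
    - by move=> w _; rewrite lee_fin (le_trans _ (kC' s w))// .
  rewrite integral_cst//= probability_setT mule1 lee_fin ler_norm//.
have rI s : rint P (fun w => ind D k (s, w)).
  apply: (@rint_bnd _ _ _ P _ (`|C| * \1_D s)); last exact: kC'.
  exact: (measurable_section2 s mi).
have rR w : rint leb (fun s => ind D k (s, w)).
  apply: (@rint_le _ _ _ leb _ _ _ (kC' ^~ w) rD).
  exact: (measurable_section1 w mi).
have F := Fubini ik.
transitivity (Ex leb (fun s => Ex P (fun w => ind D k (s, w)))).
  rewrite Rintegral_mkcond; apply: eq_Rintegral => s _; rewrite patchE /ind /= indicE.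
  case: ifPn => sD.
    by apply: eq_Ex => w; rewrite mul1r.
  by rewrite (@eq_Ex _ _ _ P _ (fun=> 0)) ?Ex_cst// => w; rewrite mul0r.
transitivity (Ex P (fun w => Ex leb (fun s => ind D k (s, w)))); last first.
  by apply: eq_Ex => w; rewrite Rint_ind.
rewrite /Ex /Rintegral; congr fine.
under eq_integral do rewrite -/(Rintegral _ _ _) -/(Ex _ _) EFin_Ex//.
by rewrite F; apply: eq_integral => w _; rewrite -EFin_Ex.
Qed.

End time_integrals.

(** * Orthogonality of Brownian increments to the past *)

Section brownian.
Context (R : realType) d (T : measurableType d) (P : probability T R)
  (F : R -> set (set T)) (W : R -> T -> R).
Hypothesis hF : filtration F.
Hypothesis hW : std_brownian P F W.
Notation leb := (@lebesgue_measure R).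

Lemma F_sigma t : 0 <= t -> sigma_algebra setT (F t).
Proof. by move=> t0; have [h _] := hF; have [] := h _ t0. Qed.

Lemma F_meas t : 0 <= t -> F t `<=` measurable.
Proof. by move=> t0; have [h _] := hF; have [] := h _ t0. Qed.

Lemma F_mono s t : 0 <= s -> s <= t -> F s `<=` F t.
Proof. by have [_ h] := hF; exact: h. Qed.

Lemma W_meas t : 0 <= t -> measurable_fun setT (W t).
Proof. by move=> t0; have [_ _ h _] := hW; apply: (wrt_meas (F_meas t0)); exact: h. Qed.

Section increment.
Variables (s t : R).
Hypotheses (s0 : 0 <= s) (st : s < t).
Let t0 : 0 <= t. Proof. exact: le_trans (ltW st). Qed.
Let N := @normal_prob R 0 (Num.sqrt (t - s)).

Lemma incr_meas : measurable_fun setT (fun w => W t w - W s w).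
Proof. by apply: measurable_funB; exact: W_meas. Qed.

Lemma bm_indep (Y : T -> R) (g : R -> R) : measurable_wrt (F s) Y -> rint P Y -> rint N g ->
  rint P (fun w => Y w * g (W t w - W s w)) /\
  Ex P (fun w => Y w * g (W t w - W s w)) = Ex P Y * Ex N g.
Proof.
move=> mY rY rg.
have mY1 : Y \in mfun by rewrite inE; exact: (wrt_meas (F_meas s0)).
pose V : T -> measurableTypeR R := fun w => W t w - W s w.
have mV1 : V \in mfun by rewrite inE; exact: incr_meas.
apply: (@indep_Ex _ _ _ _ _ _ R P N (mfun_Sub mY1) (mfun_Sub mV1) _ idfun g) => //; last first.
  exact: measurable_id.
move=> A B mA mB; have [_ _ _ h] := hW.
by apply: h => //; exact: mY.
Qed.

Lemma bm_law (g : R -> R) : rint N g ->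
  rint P (fun w => g (W t w - W s w)) /\ Ex P (fun w => g (W t w - W s w)) = Ex N g.
Proof.
move=> rg; have [] := bm_indep (measurable_wrt_cst (F_sigma s0) 1) (rint_cst P 1) rg.
rewrite Ex_cst mul1r => h1 h2; split.
  by apply: eq_rint h1 => w; rewrite mul1r.
by rewrite -h2; apply: eq_Ex => w; rewrite mul1r.
Qed.

Let sq0 : 0 < Num.sqrt (t - s). Proof. by rewrite sqrtr_gt0 subr_gt0. Qed.
Let sq2 : Num.sqrt (t - s) ^+ 2 = t - s. Proof. by rewrite sqr_sqrtr// subr_ge0 ltW. Qed.

Lemma incr_moment2 : rint P (fun w => (W t w - W s w) ^+ 2) /\
  Ex P (fun w => (W t w - W s w) ^+ 2) = t - s.
Proof.
have [h1 h2] := normal_moment2 sq0; have [h3 h4] := bm_law h1.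
by split => //; rewrite h4 h2 sq2.
Qed.

Lemma incr_moment4 : rint P (fun w => (W t w - W s w) ^+ 4) /\
  Ex P (fun w => (W t w - W s w) ^+ 4) = 3 * (t - s) ^+ 2.
Proof.
have [h1 h2] := normal_moment4 sq0; have [h3 h4] := bm_law h1.
by split => //; rewrite h4 h2 -[in RHS]sq2 -exprM.
Qed.

(** For a variable measurable with respect to [F s] the product has mean 0 by independence. An
    approximation [Y'] therefore leaves only E[(Y - Y') V], which a weighted Young inequality makes
    arbitrarily small. *)
Lemma approx_mean0 (Y : T -> R) (g : R -> R) : measurable_fun setT g ->
  rint N (fun x => g x ^+ 2) -> Ex N g = 0 -> approx P (F s) Y ->
  rint P (fun w => Y w * g (W t w - W s w)) /\
  Ex P (fun w => Y w * g (W t w - W s w)) = 0.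
Proof.
move=> mg rg Eg [mY rY hY].
have rg1 : rint N g by apply: (@rint_sqr _ _ _ N).
have [rV EV] := bm_law rg.
have mV : measurable_fun setT (fun w => g (W t w - W s w)).
  by apply: measurableT_comp => //; exact: incr_meas.
have rYV := rint_mul mY mV rY rV.
split => //.
set V := (fun w => g (W t w - W s w)) in mV rV EV rYV *.
have EV0 : 0 <= Ex P (fun w => V w ^+ 2) by apply: Ex_ge0 => w; exact: sqr_ge0.
set v := Ex P (fun w => V w ^+ 2) in EV0.
(* The weight [l] in Young's inequality and the squared error l^-2 in the approximation make both
   halves of the bound of order 1 / l. *)
have bound l : 0 < l -> `|Ex P (fun w => Y w * V w)| <= (l^-1 + v / l) / 2.
  move=> l0.
  have l2 : 0 < l^-1 ^+ 2 by rewrite exprn_gt0// invr_gt0.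
  have [Y' [mY' rY' eY']] := hY _ l2.
  have mY2 := wrt_meas (F_meas s0) mY'.
  have [rYV' EYV'] := bm_indep mY' (rint_sqr mY2 rY') rg1.
  rewrite Eg mulr0 in EYV'.
  have -> : Ex P (fun w => Y w * V w) = Ex P (fun w => (Y w - Y' w) * V w).
    under [RHS]eq_Ex do rewrite mulrBl.
    by rewrite ExB// EYV' subr0.
  have rD := rint_sqrB mY mY2 rY rY'.
  have mD := measurable_funB mY mY2.
  apply: (@le_trans _ _ (Ex P (fun w => l / 2 * (Y w - Y' w) ^+ 2 + (l^-1 / 2) * V w ^+ 2))).
    apply: ler_norm_Ex; [exact: rint_mul|by apply: rintD; exact: rintZ|].
    move=> w; rewrite normrM.
    have li : l * l^-1 = 1 by rewrite mulfV ?gt_eqF.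
    rewrite -(real_normK (num_real (Y w - Y' w))) -(real_normK (num_real (V w))).
    set a := `|Y w - Y' w|; set b := `|V w|.
    have : 0 <= l * (a - l^-1 * b) ^+ 2 by rewrite mulr_ge0 ?sqr_ge0// ltW.
    have -> : l * (a - l^-1 * b) ^+ 2 = l * a ^+ 2 - (l * l^-1) * 2 * a * b + (l * l^-1) * l^-1 * b ^+ 2 by ring.
    rewrite li; lra.
  rewrite ExD; [|exact: rintZ..]; rewrite !ExZ// -/v.
  have h : l / 2 * Ex P (fun w => (Y w - Y' w) ^+ 2) <= l / 2 * l^-1 ^+ 2.
    by rewrite ler_wpM2l// divr_ge0// ltW.
  apply: (le_trans (lerD h (lexx _))).
  have -> : l / 2 * l^-1 ^+ 2 = l^-1 / 2 by field; rewrite gt_eqF.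
  by rewrite mulrDl lerD2l mulrC mulrA.
apply/eqP; rewrite -normr_le0; apply/ler_addgt0Pr => e e0; rewrite add0r.
have v1 : 0 < 1 + v by rewrite ltr_pwDl.
have l0 : 0 < (1 + v) / e by rewrite divr_gt0.
apply: (le_trans (bound _ l0)).
rewrite -[X in X + _]mul1r -mulrDl invf_div mulrCA divff ?gt_eqF// mulr1; lra.
Qed.

Lemma approx_incr0 (Y : T -> R) : approx P (F s) Y ->
  rint P (fun w => Y w * (W t w - W s w)) /\ Ex P (fun w => Y w * (W t w - W s w)) = 0.
Proof.
have [h1 h2] := normal_moment2 sq0; have [_ h4] := normal_moment1 sq0.
by apply: (@approx_mean0 Y idfun) => //; exact: measurable_id.
Qed.

(** [approx_mean0] is applied to the centred square x^2 - (t - s), whose square integrability rests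
    on the fourth Gaussian moment. *)
Lemma approx_incr2 (Y : T -> R) : approx P (F s) Y ->
  rint P (fun w => Y w * (W t w - W s w) ^+ 2) /\
  Ex P (fun w => Y w * (W t w - W s w) ^+ 2) = (t - s) * Ex P Y.
Proof.
move=> aY; have [mY rY _] := aY.
have [h1 h2] := normal_moment2 sq0; have [h3 h4] := normal_moment4 sq0.
have [|||r0 E0] := @approx_mean0 Y (fun x => x ^+ 2 - (t - s)) _ _ _ aY.
- by apply: measurable_funB => //; exact: exprn_measurable.
- apply: (eq_rint _ (rintD (rintB h3 (rintZ (2 * (t - s)) h1)) (rint_cst N ((t - s) ^+ 2)))) => x /=.
  ring.
- by rewrite ExB// ?Ex_cst ?h2 ?sq2 ?subrr//; exact: rint_cst.
have rY1 := rint_sqr mY rY.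
have r1 : rint P (fun w => Y w * (W t w - W s w) ^+ 2).
  apply: (eq_rint _ (rintD r0 (rintZ (t - s) rY1))) => w; ring.
split => //; rewrite -ExZ//; apply/eqP; rewrite -subr_eq0 -ExB//; last exact: rintZ.
by rewrite -E0; apply/eqP; apply: eq_Ex => w; ring.
Qed.

End increment.

Lemma approx_W t : 0 <= t -> approx P (F t) (W t).
Proof.
move=> t0; have [W0 _ mW _] := hW.
apply: approx_wrt; [exact: F_meas|exact: mW|].
move: t0; rewrite le_eqVlt => /predU1P[<-|t0].
  by apply: eq_rint (rint_cst P 0) => w; rewrite W0 expr0n.
have [r0 _] := incr_moment2 (lexx 0) t0.
by apply: eq_rint r0 => w; rewrite W0 subr0.
Qed.

End brownian.

(** * Integrated controls as L^2 limits of adapted variables *)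

Section control.
Context (R : realType) d (T : measurableType d) (P : probability T R)
  (F : R -> set (set T)) (u0 : R) (U : R -> T -> R).
Hypothesis hF : filtration F.
Hypothesis hU : admissible F u0 U.
Hypothesis u00 : 0 < u0.
Notation leb := (@lebesgue_measure R).

Let U0 t w : 0 <= t -> 0 <= U t w.
Proof. by move=> t0; have [h _ _] := hU; have /andP[] := h t w t0. Qed.

Let Uu t w : 0 <= t -> U t w <= u0.
Proof. by move=> t0; have [h _ _] := hU; have /andP[] := h t w t0. Qed.

Lemma U_norm t w : 0 <= t -> `|U t w| <= u0.
Proof. by move=> t0; rewrite ger0_norm ?Uu// U0. Qed.

Let mU : measurable_fun setT (fun p : R * T => U p.1 p.2).
Proof. by have [] := hU. Qed.

Lemma U_meas w : measurable_fun setT (fun s => U s w).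
Proof. exact: (measurable_section1 w mU). Qed.

Lemma leb_ccy (a b : R) : (leb `[a, b]%classic < +oo)%E.
Proof. by rewrite lebesgue_measure_itv/=; case: ifP => _; rewrite ?ltry// -EFinB ltry. Qed.

Lemma integrable_U (a b : R) w : 0 <= a -> leb.-integrable `[a, b] (EFin \o (fun s => U s w)).
Proof.
move=> a0; apply: (@integrable_bnd _ _ _ u0) => //; first exact: leb_ccy.
  by apply: measurable_funTS; exact: U_meas.
by move=> s /=; rewrite in_itv/= => /andP[as_ _]; apply: U_norm; exact: le_trans as_.
Qed.

Definition IU (t : R) (w : T) : R := Rintegral leb `[0, t] (fun s => U s w).

Lemma IU_meas t : measurable_fun setT (IU t).
Proof. exact: (@measurable_Rint _ _ _ `[0, t]%classic (fun p : R * T => U p.1 p.2)). Qed.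

Lemma IU_incr s t w : 0 <= s -> s <= t ->
  IU t w - IU s w = Rintegral leb `[s, t] (fun r => U r w).
Proof.
move=> s0 st; rewrite /IU Rintegral_itvB ?bnd_simp//; last exact: integrable_U.
rewrite Rintegral_itv_obnd_cbnd//.
apply: integrableS (integrable_U t w s0) => //.
by apply: subset_itvr; rewrite bnd_simp.
Qed.

Lemma IU_incr_bnd s t w : 0 <= s -> s <= t -> 0 <= IU t w - IU s w <= u0 * (t - s).
Proof.
move=> s0 st; rewrite IU_incr//; apply/andP; split.
  by apply: Rintegral_ge0 => x /=; rewrite in_itv/= => /andP[sx _]; apply: U0; exact: le_trans sx.
apply: le_trans (ler_norm _) _.
have -> : t - s = fine (leb `[s, t]%classic) by rewrite leb_cc.
apply: norm_Rint_le => //; first exact: leb_ccy.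
  by apply: measurable_funTS; exact: U_meas.
by move=> x /=; rewrite in_itv/= => /andP[sx _]; apply: U_norm; exact: le_trans sx.
Qed.

Lemma IU0 w : IU 0 w = 0.
Proof. by rewrite /IU set_itv1 Rintegral_set1. Qed.

Lemma IU_bnd t w : 0 <= t -> 0 <= IU t w <= u0 * t.
Proof. by move=> t0; have := IU_incr_bnd w (lexx 0) t0; rewrite IU0 !subr0. Qed.

Section monte_carlo.
Variable t : R.
Hypothesis t0 : 0 < t.
Let t0' := ltW t0.
Let Fs := F_sigma hF t0'.
Let Fm := F_meas hF t0'.
Let I := IU t.
Let mI : measurable_fun setT I. Proof. exact: IU_meas. Qed.
Let Z s w := t * U s w - I w.
Let mUs s : measurable_fun setT (U s).
Proof. exact: (measurable_section2 s mU). Qed.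

Let Z_bnd s w : 0 <= s -> `|Z s w| <= t * u0.
Proof.
move=> s0; have /andP[i0 iu] := IU_bnd w t0'.
rewrite ler_norml /Z; have := U0 w s0; have := Uu w s0 => h1 h2.
have := ler_wpM2l t0' h1; have := mulr_ge0 t0' h2; rewrite /I; lra.
Qed.

Let I_bnd w : `|I w| <= t * u0.
Proof. by have /andP[i0 iu] := IU_bnd w t0'; rewrite ger0_norm// mulrC. Qed.

(* Z s averages to 0 over s in [0, t], so a time with small correlation with A exists. *)
Lemma sample_exists (A : T -> R) (B : R) : measurable_fun setT A -> (forall w, `|A w| <= B) ->
  exists s, [/\ 0 <= s, s <= t & Ex P (fun w => A w * Z s w) <= 1].
Proof.
move=> mA AB; apply: contrapT => hn.
have h s : 0 <= s -> s <= t -> 1 < Ex P (fun w => A w * Z s w).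
  by move=> s0 st; rewrite ltNge; apply/negP => h; apply: hn; exists s.
pose k (z : R * T) := A z.2 * Z z.1 z.2.
have mk : measurable_fun setT k.
  apply: measurable_funM; first exact: measurableT_comp.
  apply: measurable_funB; first exact: measurable_funM.
  exact: measurableT_comp.
have B0 (w : T) : 0 <= B by apply: le_trans (AB w).
have kB s w : 0 <= s -> `|k (s, w)| <= B * (t * u0).
  by move=> s0; rewrite /k normrM ler_pM//=; exact: Z_bnd.
have E := @Rint_Ex R _ T P `[0, t]%classic k (B * (t * u0)) _ (leb_ccy 0 t) mk.
have {}E : Rintegral leb `[0, t] (fun s => Ex P (fun w => k (s, w))) =
  Ex P (fun w => Rintegral leb `[0, t] (fun s => k (s, w))).
  by apply: E => // s w /=; rewrite in_itv/= => /andP[s0 _]; exact: kB.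
have Ez : Ex P (fun w => Rintegral leb `[0, t] (fun s => k (s, w))) = 0.
  transitivity (Ex P (fun=> (0 : R))); last exact: Ex_cst.
  apply: eq_Ex => w; rewrite /k /=.
  rewrite RintegralZl//; last first.
    apply: (@integrable_bnd _ _ _ (t * u0)) => //; first exact: leb_ccy.
      apply: measurable_funB => //; apply: measurable_funM => //.
      by apply: measurable_funTS; exact: U_meas.
    by move=> s /=; rewrite in_itv/= => /andP[s0 _]; exact: Z_bnd.
  rewrite RintegralB//; last 2 first.
  - apply: (@integrable_bnd _ _ _ (t * u0)) => //; first exact: leb_ccy.
      by apply: measurable_funM => //; apply: measurable_funTS; exact: U_meas.
    by move=> s /=; rewrite in_itv/= => /andP[s0 _]; rewrite normrM ger0_norm// ler_wpM2l// U_norm.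
  - by apply: (@integrable_bnd _ _ _ (t * u0)) => //; exact: leb_ccy.
  rewrite RintegralZl//; last exact: integrable_U.
  rewrite Rint_cst_cc// subr0 -/(IU t w) /I.
  ring.
have : Rintegral leb `[0, t] (fun s => 1) <= Rintegral leb `[0, t] (fun s => Ex P (fun w => k (s, w))).
  apply: le_Rintegral => //.
  - by apply: (@integrable_bnd _ _ _ 1) => //; [exact: leb_ccy|move=> s _; rewrite normr1].
  - have rk s : 0 <= s -> rint P (fun w => k (s, w)).
      move=> s0; apply: (@rint_bnd _ _ _ _ _ (B * (t * u0))); first exact: (measurable_section2 s mk).
      by move=> w; exact: kB.
    apply: (@integrable_bnd _ _ _ (B * (t * u0))) => //; first exact: leb_ccy.
    + by apply: measurable_funTS; exact: measurable_Ex.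
    + move=> s /=; rewrite in_itv/= => /andP[s0 _].
      by rewrite -(Ex_cst P (B * (t * u0))); apply: ler_norm_Ex => //; [exact: rk|exact: rint_cst|move=> w; exact: kB].
  - by move=> s /=; rewrite in_itv/= => /andP[s0 st]; apply: ltW; exact: h.
rewrite E Ez Rint_cst_cc// subr0 mul1r.
by move=> /(lt_le_trans t0); rewrite ltxx.
Qed.

(* A Monte Carlo sum with sampling times chosen one after the other: each new summand is nearly
   uncorrelated with the accumulated error, whose second moment thus grows like n, not n^2. *)
Lemma sample_mean n : exists S : T -> R, [/\ measurable_wrt (F t) S, (exists B, forall w, `|S w| <= B) &
  Ex P (fun w => (t * S w - n%:R * I w) ^+ 2) <= n%:R * (2 + (t * u0) ^+ 2)].
Proof.
elim: n => [|n [S [mS [B SB] ES]]].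
  exists (fun=> 0); split; [exact: measurable_wrt_cst|by exists 0 => w; rewrite normr0|].
  rewrite mul0r; under eq_Ex do rewrite mulr0 mul0r subrr expr0n/=.
  by rewrite Ex_cst.
pose A w := t * S w - n%:R * I w.
have mS2 := wrt_meas Fm mS.
have mA : measurable_fun setT A by apply: measurable_funB; exact: measurable_funM.
have AB w : `|A w| <= t * B + n%:R * (t * u0).
  apply: (le_trans (ler_normB _ _)); rewrite !normrM (ger0_norm t0') normr_nat.
  by rewrite lerD// ler_wpM2l.
have [s [s0 st hs]] := sample_exists mA AB.
have [_ hUa _] := hU.
exists (fun w => S w + U s w); split.
- apply: measurable_wrtD => //; apply: (measurable_wrtS (F_mono hF s0 st)); exact: hUa.
- by exists (B + u0) => w; apply: (le_trans (ler_normD _ _)); rewrite lerD// U_norm.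
have mZ : measurable_fun setT (Z s).
  by apply: measurable_funB => //; exact: measurable_funM.
have rA : rint P (fun w => A w ^+ 2).
  apply: (@rint_bnd _ _ _ _ _ ((t * B + n%:R * (t * u0)) ^+ 2)); first exact: measurable_funX.
  by move=> w; rewrite normrX lerXn2r ?nnegrE// (le_trans _ (AB w)).
have rZ : rint P (fun w => Z s w ^+ 2).
  apply: (@rint_bnd _ _ _ _ _ ((t * u0) ^+ 2)); first exact: measurable_funX.
  by move=> w; rewrite normrX lerXn2r ?nnegrE ?Z_bnd// (le_trans _ (Z_bnd w s0)).
have rAZ := rint_mul mA mZ rA rZ.
have -> : Ex P (fun w => (t * (S w + U s w) - n.+1%:R * I w) ^+ 2) =
  Ex P (fun w => A w ^+ 2 + (2 * (A w * Z s w) + Z s w ^+ 2)).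
  by apply: eq_Ex => w; rewrite /A /Z -natr1; ring.
rewrite ExD//; last by apply: rintD => //; exact: rintZ.
rewrite ExD//; last exact: rintZ.
rewrite ExZ//.
have EZ : Ex P (fun w => Z s w ^+ 2) <= (t * u0) ^+ 2.
  rewrite -[leRHS](Ex_cst P); apply: le_Ex => //; first exact: rint_cst.
  move=> w; rewrite -(real_normK (num_real _)) lerXn2r ?nnegrE ?Z_bnd//.
  by rewrite (le_trans _ (Z_bnd w s0)).
rewrite -natr1 mulrDl mul1r.
by rewrite -/A in ES; lra.
Qed.

Lemma approx_I : approx P (F t) I.
Proof.
have rI : rint P (fun w => I w ^+ 2).
  apply: (@rint_bnd _ _ _ _ _ ((t * u0) ^+ 2)); first exact: measurable_funX.
  by move=> w; rewrite normrX lerXn2r ?nnegrE ?(le_trans _ (I_bnd w)).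
split => // e e0.
(* The growth per sample in [sample_mean]: 2 from the cross term and (t u0)^2 from the square of the
   new summand. After division by n the squared error is at most C / n. *)
pose C := 2 + (t * u0) ^+ 2.
have C0 : 0 < C by rewrite ltr_wpDr// sqr_ge0.
pose n := (Num.truncn (C / e)).+1.
have n0 : 0 < n%:R :> R by rewrite ltr0n.
have nC : C / e < n%:R by exact: truncnS_gt.
have [S [mS [B SB] ES]] := sample_mean n.
have mS2 := wrt_meas Fm mS.
pose Y w := (t / n%:R) * S w.
have mY : measurable_fun setT Y by exact: measurable_funM.
have YB w : `|Y w| <= (t / n%:R) * B.
  by rewrite normrM ger0_norm ?divr_ge0 ?ler_wpM2l ?divr_ge0// ltW.
have rY : rint P (fun w => Y w ^+ 2).
  apply: (@rint_bnd _ _ _ _ _ ((t / n%:R * B) ^+ 2)); first exact: measurable_funX.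
  by move=> w; rewrite normrX lerXn2r ?nnegrE// (le_trans _ (YB w)).
exists Y; split => //.
  by apply: (measurable_wrt_comp Fs _ mS); exact: measurable_funM.
have -> : Ex P (fun w => (I w - Y w) ^+ 2) = Ex P (fun w => (n%:R ^+ 2)^-1 * (t * S w - n%:R * I w) ^+ 2).
  by apply: eq_Ex => w; rewrite /Y; field; rewrite pnatr_eq0.
rewrite ExZ; last first.
  apply: (@eq_rint _ _ _ P (fun w => n%:R ^+ 2 * (I w - Y w) ^+ 2)).
    by move=> w; rewrite /Y; field; rewrite pnatr_eq0.
  by apply: rintZ; exact: rint_sqrB.
have h := ler_wpM2l (ltW (_ : 0 < (n%:R ^+ 2)^-1)) ES.
apply: (le_trans (h _)); first by rewrite invr_gt0 exprn_gt0.
have -> : (n%:R ^+ 2)^-1 * (n%:R * (2 + (t * u0) ^+ 2)) = C / n%:R.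
  by rewrite /C; field; rewrite pnatr_eq0.
by rewrite ler_pdivrMr// mulrC -ler_pdivrMr// ltW.
Qed.

End monte_carlo.

Lemma approx_IU t : 0 <= t -> approx P (F t) (IU t).
Proof.
rewrite le_eqVlt => /predU1P[<-|]; last exact: approx_I.
have -> : IU 0 = fun=> 0 by apply/funext => w; rewrite IU0.
exact: approx_cst (F_sigma hF (lexx 0)) (F_meas hF (lexx 0)) 0.
Qed.

End control.

(** * Discrete Dynkin inequality *)

Section one_step.
Context (R : realType).

(** The bounds and Lipschitz conditions hold on all of R, so that the functions compose with
    arbitrary random variables; the expansion is asked only between nonnegative points, where
    drawdowns live. It is this expansion that ties [f1] and [f2] to [f]. *)
Definition taylor2 (B L : R) (f f1 f2 : R -> R) := [/\
  [/\ forall x, `|f x| <= B, forall x, `|f1 x| <= B & forall x, `|f2 x| <= B],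
  [/\ forall x y, `|f x - f y| <= L * `|x - y|,
      forall x y, `|f1 x - f1 y| <= L * `|x - y| &
      forall x y, `|f2 x - f2 y| <= L * `|x - y|] &
  forall x y, 0 <= x -> 0 <= y ->
    `|f y - f x - f1 x * (y - x) - f2 x * (y - x) ^+ 2 / 2| <= L * `|y - x| ^+ 3].

Variables (B L : R) (f f1 f2 : R -> R).
Hypothesis fT : taylor2 B L f f1 f2.
Hypothesis f10 : f1 0 <= 0.

Lemma taylor2_B0 : 0 <= B.
Proof. by have [[h _ _] _ _] := fT; apply: le_trans (h 0). Qed.

Lemma taylor2_L0 : 0 <= L.
Proof. by have [_ [h _ _] _] := fT; have := h 1 0; rewrite subr0 normr1 mulr1; apply: le_trans. Qed.

(** Without overshoot this is the Taylor expansion. With overshoot o = xi - x > 0 the walk is put at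
    0 and [f] is expanded from x to 0. The excess first-order term f1 x o is at most L x o because
    f1 0 <= 0, and the excess second-order term is at most B (x o + o^2 / 2); both are dominated by
    multiples of xi o. *)
Lemma reflected_step (x xi : R) : 0 <= x ->
  f (Num.max (x - xi) 0) <= f x - f1 x * xi + f2 x * xi ^+ 2 / 2 + L * `|xi| ^+ 3
    + (L + B) * (`|xi| * Num.max (xi - x) 0).
Proof.
move=> x0; have [[_ _ b2] [_ l1 _] tay] := fT.
have B0 := taylor2_B0; have L0 := taylor2_L0.
case: (leP xi x) => h.
  have y0 : 0 <= x - xi by rewrite subr_ge0.
  rewrite (max_l y0) max_r ?subr_le0// !mulr0 addr0.
  have := tay x (x - xi) x0 y0; rewrite (_ : x - xi - x = - xi); last by ring.
  rewrite normrN sqrrN => /(le_trans (ler_norm _)).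
  lra.
have y0 : x - xi <= 0 by rewrite subr_le0 ltW.
have o0 : 0 <= xi - x by rewrite subr_ge0 ltW.
rewrite (max_r y0) (max_l o0).
have xi0 : 0 < xi by exact: le_lt_trans h.
rewrite (gtr0_norm xi0).
have := tay x 0 x0 (lexx 0); rewrite sub0r normrN sqrrN (ger0_norm x0) => /(le_trans (ler_norm _)) t1.
have := l1 x 0; rewrite subr0 (ger0_norm x0) => /(le_trans (ler_norm _)) l1x.
have /ler_normlP [b2l b2u] := b2 x.
set o := xi - x in o0 *.
have -> : xi = x + o by rewrite /o addrC subrK.
have e1 : f1 x * o <= L * x * o.
  by rewrite ler_wpM2r//; move: l1x; rewrite lerBlDr => /le_trans; apply; rewrite gerDl.
have e2 : - f2 x * (x * o + o ^+ 2 / 2) <= B * (x * o + o ^+ 2 / 2).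
  by rewrite ler_wpM2r// addr_ge0// ?divr_ge0 ?sqr_ge0// mulr_ge0.
have e3 : L * x ^+ 3 <= L * (x + o) ^+ 3.
  rewrite ler_wpM2l// lerXn2r ?nnegrE//; first exact: addr_ge0.
  by rewrite lerDl.
have e4 : 0 <= L * o ^+ 2 by rewrite mulr_ge0 ?sqr_ge0.
have e5 : 0 <= B * o ^+ 2 by rewrite mulr_ge0 ?sqr_ge0.
nra.
Qed.

Variables (A sigma : R).
Hypotheses (A0 : 0 <= A) (sigma0 : 0 <= sigma).

(** The first summand comes from the cross term and the squared drift in the second-order term. The
    factor 4 (A^3 + sigma^3) stems from the bound on |xi|^3, which enters with weight L from the
    Taylor remainder and (L + B) / eta from splitting |xi| o. *)
Definition Kerr (eta : R) : R :=
  B * (A * sigma + A ^+ 2) + (L + (L + B) / eta) * (4 * (A ^+ 3 + sigma ^+ 3)).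

Lemma cube_le (a b : R) : `|a + b| ^+ 3 <= 4 * (`|a| ^+ 3 + `|b| ^+ 3).
Proof.
have h : `|a + b| ^+ 3 <= (`|a| + `|b|) ^+ 3 by rewrite lerXn2r ?nnegrE ?addr_ge0 ?ler_normD.
apply: le_trans h _.
have h : 0 <= (`|a| + `|b|) * (`|a| - `|b|) ^+ 2 by rewrite mulr_ge0 ?sqr_ge0 ?addr_ge0.
nra.
Qed.

(* q is the square root of the mesh and w the Brownian increment, so that each term of the
   remainder has expectation of order q ^+ 3. *)
Lemma expanded_step (eta q x a w : R) : 0 <= x -> 0 < eta -> 0 < q -> q <= 1 -> `|a| <= A * q ^+ 2 ->
  f (Num.max (x - (a + sigma * w)) 0) <=
    f x - f1 x * a - sigma * (f1 x * w) + sigma ^+ 2 / 2 * (f2 x * w ^+ 2)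
    + (L + B) * eta * Num.max (a + sigma * w - x) 0
    + Kerr eta * (q ^+ 3 + q * w ^+ 2 + q^-1 * w ^+ 4).
Proof.
move=> x0 eta0 q0 q1 ha.
have B0 := taylor2_B0; have L0 := taylor2_L0.
have [[_ _ b2] _ _] := fT.
set xi := a + sigma * w; set o := Num.max (xi - x) 0.
set r := q ^+ 3 + q * w ^+ 2 + q^-1 * w ^+ 4.
have o0 : 0 <= o by rewrite le_max lexx orbT.
have ox : o <= `|xi|.
  by rewrite ge_max normr_ge0 andbT; apply: le_trans (ler_norm _); lra.
apply: (le_trans (reflected_step xi x0)); rewrite -/o.
have qi : q * q^-1 = 1 by rewrite mulfV ?gt_eqF.
have qi0 : 0 < q^-1 by rewrite invr_gt0.
have q30 : 0 <= q ^+ 3 by rewrite exprn_ge0// ltW.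
have qw0 : 0 <= q * w ^+ 2 by rewrite mulr_ge0 ?sqr_ge0// ltW.
have w40 : 0 <= q^-1 * w ^+ 4 by rewrite mulr_ge0 ?exprn_even_ge0// ltW.
(* Odd powers of |w| are traded for even ones by completing a square with weight q, so that only the
   second and fourth Gaussian moments are needed. *)
have w1 : q ^+ 2 * `|w| <= r.
  have : 0 <= q * (q - `|w|) ^+ 2 by rewrite mulr_ge0 ?sqr_ge0// ltW.
  have : `|w| ^+ 2 = w ^+ 2 by rewrite real_normK// num_real.
  rewrite /r; nra.
have w3 : `|w| ^+ 3 <= r.
  have : 0 <= q^-1 * (w ^+ 2 - q * `|w|) ^+ 2 by rewrite mulr_ge0 ?sqr_ge0// ltW.
  have e : `|w| ^+ 2 = w ^+ 2 by rewrite real_normK// num_real.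
  have -> : q^-1 * (w ^+ 2 - q * `|w|) ^+ 2 =
    q^-1 * w ^+ 4 - 2 * (q * q^-1) * w ^+ 2 * `|w| + (q * q^-1) * q * `|w| ^+ 2 by ring.
  rewrite qi e (_ : `|w| ^+ 3 = w ^+ 2 * `|w|); last by rewrite -e; ring.
  have := mulr_ge0 (sqr_ge0 w) (normr_ge0 w).
  rewrite /r; lra.
have q4 : q ^+ 4 <= q ^+ 3 by rewrite ler_wiXn2l// ltW.
have q6 : q ^+ 6 <= q ^+ 3 by rewrite ler_wiXn2l// ltW.
have a3 : `|a| ^+ 3 <= A ^+ 3 * r.
  apply: (@le_trans _ _ ((A * q ^+ 2) ^+ 3)).
    by rewrite lerXn2r ?nnegrE// mulr_ge0 ?sqr_ge0.
  rewrite exprMn -exprM ler_wpM2l ?exprn_ge0//.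
  by apply: (le_trans q6); rewrite /r; lra.
have xi3 : `|xi| ^+ 3 <= 4 * (A ^+ 3 + sigma ^+ 3) * r.
  apply: (le_trans (cube_le _ _)).
  rewrite normrM (ger0_norm sigma0) exprMn -mulrA ler_pM2l// mulrDl lerD//.
  by rewrite ler_wpM2l// exprn_ge0.
have a2 : a ^+ 2 <= A ^+ 2 * r.
  rewrite -(real_normK (num_real a)).
  apply: (@le_trans _ _ ((A * q ^+ 2) ^+ 2)).
    by rewrite lerXn2r ?nnegrE// mulr_ge0 ?sqr_ge0.
  rewrite exprMn -exprM ler_wpM2l ?exprn_ge0//.
  by apply: (le_trans q4); rewrite /r; lra.
have aw : `|a * (sigma * w)| <= A * sigma * r.
  rewrite !normrM (ger0_norm sigma0).
  apply: (@le_trans _ _ ((A * q ^+ 2) * (sigma * `|w|))).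
    by rewrite ler_wpM2r// mulr_ge0.
  have -> : A * q ^+ 2 * (sigma * `|w|) = A * sigma * (q ^+ 2 * `|w|) by ring.
  by rewrite ler_wpM2l// mulr_ge0.
have e2 : f2 x * xi ^+ 2 / 2 <= sigma ^+ 2 / 2 * (f2 x * w ^+ 2) + B * (A * sigma + A ^+ 2) * r.
  have -> : f2 x * xi ^+ 2 / 2 = sigma ^+ 2 / 2 * (f2 x * w ^+ 2) + f2 x * (a * (sigma * w) + a ^+ 2 / 2).
    by rewrite /xi; field.
  rewrite lerD2l; apply: (le_trans (ler_norm _)); rewrite normrM -mulrA ler_pM//.
  apply: (le_trans (ler_normD _ _)); rewrite [X in _ + X]ger0_norm ?divr_ge0 ?sqr_ge0//.
  have := sqr_ge0 a; lra.
(* The overshoot is kept to the first power with the small factor [eta]: a single overshoot is not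
   controlled by q^3, while the sum of their expectations stays bounded. The remaining term uses o
   <= |xi|. *)
have e3 : `|xi| * o <= eta * o + eta^-1 * `|xi| ^+ 3.
  have ei : eta * eta^-1 = 1 by rewrite mulfV ?gt_eqF.
  have ei0 : 0 < eta^-1 by rewrite invr_gt0.
  have : 0 <= eta^-1 * (o * (eta - `|xi|) ^+ 2) by apply: mulr_ge0 (ltW ei0) (mulr_ge0 o0 (sqr_ge0 _)).
  have -> : eta^-1 * (o * (eta - `|xi|) ^+ 2) = (eta * eta^-1) * eta * o - 2 * (eta * eta^-1) * (o * `|xi|) + eta^-1 * (`|xi| ^+ 2 * o) by ring.
  rewrite ei !mul1r mulr1.
  have : eta^-1 * (`|xi| ^+ 2 * o) <= eta^-1 * `|xi| ^+ 3.
    by rewrite ler_pM2l// [leRHS]exprSr ler_wpM2l ?sqr_ge0.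
  have := mulr_ge0 (normr_ge0 xi) o0; nra.
have e4 : (L + B) * (`|xi| * o) <= (L + B) * eta * o + (L + B) / eta * `|xi| ^+ 3.
  have := ler_wpM2l (addr_ge0 L0 B0) e3; rewrite mulrDr !mulrA; lra.
have e5 : (L + (L + B) / eta) * `|xi| ^+ 3 <= (L + (L + B) / eta) * (4 * (A ^+ 3 + sigma ^+ 3)) * r.
  have c0 : 0 <= L + (L + B) / eta by apply: addr_ge0 => //; apply: divr_ge0 (ltW eta0); exact: addr_ge0.
  by have := ler_wpM2l c0 xi3; rewrite [in X in _ <= X -> _]mulrA.
rewrite /Kerr mulrDl.
have -> : f1 x * xi = f1 x * a + sigma * (f1 x * w) by rewrite /xi; ring.
lra.
Qed.

End one_step.

Lemma lipschitz_continuous (R : realType) (L : R) (f : R -> R) :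
  (forall x y, `|f x - f y| <= L * `|x - y|) -> continuous f.
Proof.
move=> lf x.
have L0 : 0 <= L by have := lf 1 0; rewrite subr0 normr1 mulr1; apply: le_trans.
have L1 : 0 < L + 1 by rewrite ltr_wpDl.
apply/cvgrPdist_le => e e0.
have h : 0 < e / (L + 1) by exact: divr_gt0.
near=> y.
apply: (le_trans (lf _ _)).
apply: (@le_trans _ _ ((L + 1) * (e / (L + 1)))); last by rewrite mulrC divfK// gt_eqF.
apply: ler_pM => //; first by rewrite lerDl.
Unshelve. all: by end_near. Qed.

Lemma lipschitz_measurable (R : realType) (L : R) (f : R -> R) :
  (forall x y, `|f x - f y| <= L * `|x - y|) -> measurable_fun setT f.
Proof. by move=> /lipschitz_continuous; exact: continuous_measurable_fun. Qed.

(** At index 0 the value is [z] and [x 0] is ignored; along the grid this agrees with the maximum,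
    since [X] starts at 0 and [z] is nonnegative. *)
Fixpoint runmax (R : realType) (x : nat -> R) (z : R) (k : nat) : R :=
  if k is k'.+1 then Num.max (runmax x z k') (x k) else z.

(** * The sampled drawdown as a reflected random walk *)

Section scheme.
Context (R : realType) d (T : measurableType d) (P : probability T R)
  (F : R -> set (set T)) (W U : R -> T -> R) (mu sigma u0 z : R).
Hypotheses (hF : filtration F) (hW : std_brownian P F W) (hU : admissible F u0 U).
Hypotheses (sigma0 : 0 < sigma) (u00 : 0 < u0) (z0 : 0 <= z).
Notation leb := (@lebesgue_measure R).
Notation X := (Xproc mu sigma W U).

Let A := `|mu| + u0.
Let A0 : 0 <= A. Proof. by rewrite addr_ge0// ltW. Qed.

Variable n : nat.
Definition mesh : R := n.+1%:R^-1.
Definition grid (k : nat) : R := k%:R * mesh.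

Lemma mesh_gt0 : 0 < mesh. Proof. by rewrite invr_gt0 ltr0n. Qed.

Lemma mesh_le1 : mesh <= 1. Proof. by rewrite invf_le1 ?ltr0n// ler1n. Qed.
Let q := Num.sqrt mesh.
Let q0 : 0 < q. Proof. by rewrite sqrtr_gt0 mesh_gt0. Qed.
Let q2 : q ^+ 2 = mesh. Proof. by rewrite sqr_sqrtr// ltW// mesh_gt0. Qed.
Let q1 : q <= 1.
Proof. by rewrite -(ler_pXn2r (isT : (0 < 2)%N)) ?nnegrE ?(ltW q0)// q2 expr1n mesh_le1. Qed.

Lemma grid_ge0 k : 0 <= grid k.
Proof. by rewrite mulr_ge0 ?ler0n// ltW// mesh_gt0. Qed.

Lemma gridS k : grid k.+1 = grid k + mesh.
Proof. by rewrite /grid -natr1 mulrDl mul1r. Qed.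

Lemma gridB k : grid k.+1 - grid k = mesh.
Proof. by rewrite gridS addrAC subrr add0r. Qed.

Lemma grid_lt k : grid k < grid k.+1.
Proof. by rewrite gridS ltrDl mesh_gt0. Qed.

Definition Dg k w := runmax (fun j => X (grid j) w) z k - X (grid k) w.
Let a k w := mu * mesh - (IU U (grid k.+1) w - IU U (grid k) w).
Let dW k w := W (grid k.+1) w - W (grid k) w.
(* The increment of the running maximum between two grid points. *)
Definition overshoot k w := Num.max (a k w + sigma * dW k w - Dg k w) 0.

Let X_incr k w : X (grid k.+1) w - X (grid k) w = a k w + sigma * dW k w.
Proof. by rewrite /Xproc /a /dW /IU -(gridB k); ring. Qed.

Let X0 w : X 0 w = 0.
Proof.
have [W0 _ _ _] := hW.
by rewrite /Xproc W0 -/(IU U 0 w) IU0; ring.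
Qed.

Lemma Dg0 w : Dg 0 w = z.
Proof. by rewrite /Dg /grid mul0r X0 subr0. Qed.

Lemma DgS k w : Dg k.+1 w = Num.max (Dg k w - (a k w + sigma * dW k w)) 0.
Proof.
rewrite -X_incr /Dg /=; set M := runmax _ _ k.
by rewrite addr_maxl subrr; congr (Num.max _ _); ring.
Qed.

Lemma Dg_ge0 k w : 0 <= Dg k w.
Proof. by case: k => [|k]; rewrite ?Dg0// DgS le_max lexx orbT. Qed.

Lemma DgS_overshoot k w : Dg k.+1 w = Dg k w - (X (grid k.+1) w - X (grid k) w) + overshoot k w.
Proof.
rewrite DgS X_incr /overshoot; set xi := a k w + _; set D := Dg k w.
by case: (leP xi D) => h; [rewrite max_l ?max_r|rewrite max_r ?max_l]; rewrite ?subr_le0 ?subr_ge0 ?(ltW h)//; ring.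
Qed.

Let approx_a k : approx P (F (grid k.+1)) (a k).
Proof.
have sF := F_sigma hF (grid_ge0 k.+1); have mF := F_meas hF (grid_ge0 k.+1).
apply: approxB => //; first exact: approx_cst.
apply: approxB => //; first exact: (approx_IU P hF hU (grid_ge0 _)).
apply: approxS (approx_IU P hF hU (grid_ge0 _)).
by apply: (F_mono hF); [exact: grid_ge0|exact/ltW/grid_lt].
Qed.

(** The recursion [DgS] builds the next drawdown from the current one, the drift and the Brownian
    increment by sums and the Lipschitz map max(x, 0), all of which preserve [approx]. *)
Lemma Dg_approx k : approx P (F (grid k)) (Dg k).
Proof.
elim: k => [|k IH].
  rewrite (_ : Dg 0 = fun=> z); last by apply/funext => w; exact: Dg0.
  exact: approx_cst (F_sigma hF (grid_ge0 0)) (F_meas hF (grid_ge0 0)) z.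
have sF := F_sigma hF (grid_ge0 k.+1); have mF := F_meas hF (grid_ge0 k.+1).
have FS : F (grid k) `<=` F (grid k.+1).
  by apply: (F_mono hF); [exact: grid_ge0|exact/ltW/grid_lt].
rewrite (_ : Dg k.+1 = fun w => Num.max (Dg k w - (a k w + sigma * dW k w)) 0); last first.
  by apply/funext => w; exact: DgS.
apply: (@approx_lip _ _ _ _ _ sF mF (fun x => Num.max x 0) 1).
- move=> x y; rewrite mul1r.
  by case: (leP x 0) => hx; case: (leP y 0) => hy; rewrite ?subrr ?normr0// ler_norml;
    have := ler_norm (x - y); have := ler_norm (- (x - y)); rewrite normrN; lra.
- by apply: measurable_maxr.
- apply: approxB => //; first exact: (approxS FS IH).
  apply: approxD => //.
  apply: approxZ => //.
  apply: approxB => //; first exact: (approx_W hF hW (grid_ge0 _)).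
  by exact: (approxS FS (approx_W hF hW (grid_ge0 k))).
Qed.

Lemma Dg_meas k : measurable_fun setT (Dg k).
Proof. by have [] := Dg_approx k. Qed.

Let a_meas k : measurable_fun setT (a k).
Proof. by have [] := approx_a k. Qed.

Let a_bnd k w : `|a k w| <= A * mesh.
Proof.
have /andP[i0 iu] := IU_incr_bnd hU w (grid_ge0 k) (ltW (grid_lt k)).
rewrite gridB in iu.
apply: (le_trans (ler_normB _ _)); rewrite normrM (gtr0_norm mesh_gt0) mulrDl lerD2l.
by rewrite ger0_norm.
Qed.

Let m2 k := incr_moment2 hF hW (grid_ge0 k) (grid_lt k).
Let m4 k := incr_moment4 hF hW (grid_ge0 k) (grid_lt k).

Let dW_meas k : measurable_fun setT (dW k).
Proof. exact: (incr_meas hF hW (grid_ge0 k) (grid_lt k)). Qed.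

Let dW_rint k : rint P (dW k).
Proof. exact: rint_sqr (dW_meas k) (m2 k).1. Qed.

Let Dg_rint k : rint P (Dg k).
Proof. by have [mD rD _] := Dg_approx k; exact: rint_sqr. Qed.

Let a_rint k : rint P (a k).
Proof. exact: rint_bnd (a_meas k) (a_bnd k). Qed.

Lemma overshoot_meas k : measurable_fun setT (overshoot k).
Proof.
apply: measurable_maxr => //; apply: measurable_funB; last exact: Dg_meas.
by apply: measurable_funD => //; exact: measurable_funM.
Qed.

Lemma overshoot_rint k : rint P (overshoot k).
Proof.
apply: (rint_le (overshoot_meas k) _ (rint_norm (rintB (rintD (a_rint k) (rintZ sigma (dW_rint k))) (Dg_rint k)))) => w.
rewrite /overshoot; case: (leP (a k w + sigma * dW k w - Dg k w) 0) => //; by rewrite normr0.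
Qed.

Section step.
Variables (B L : R) (f f1 f2 : R -> R).
Hypothesis fT : taylor2 B L f f1 f2.
Hypothesis f10 : f1 0 <= 0.

Lemma step_Ex (eta : R) k : 0 < eta ->
  Ex P (fun w => f (Dg k.+1 w)) <= Ex P (fun w => f (Dg k w) - f1 (Dg k w) * a k w + sigma ^+ 2 / 2 * mesh * f2 (Dg k w))
   + (L + B) * eta * Ex P (overshoot k) + Kerr B L A sigma eta * (5 * q ^+ 3).
Proof.
move=> eta0.
have [[b0 b1 b2] [l0 l1 l2] _] := fT.
have mf := lipschitz_measurable l0; have mf1 := lipschitz_measurable l1; have mf2 := lipschitz_measurable l2.
have sF := F_sigma hF (grid_ge0 k); have mF := F_meas hF (grid_ge0 k).
have mD j : measurable_fun setT (Dg j) by exact: Dg_meas.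
have af1 := approx_lip sF mF l1 mf1 (Dg_approx k).
have af2 := approx_lip sF mF l2 mf2 (Dg_approx k).
have [r1 E1] := approx_incr0 hF hW (grid_ge0 k) (grid_lt k) af1.
have [r2 E2] := approx_incr2 hF hW (grid_ge0 k) (grid_lt k) af2.
have rf j : rint P (fun w => f (Dg j w)) by apply: (@rint_bnd _ _ _ P _ B) => //; exact: measurableT_comp.
have rf1 : rint P (fun w => f1 (Dg k w) * a k w).
  by apply: (@rint_bndM _ _ _ P _ _ B) => //; exact: measurableT_comp.
have rf2 : rint P (fun w => f2 (Dg k w)) by apply: (@rint_bnd _ _ _ P _ B) => //; exact: measurableT_comp.
have [rm2 Em2] := m2 k; have [rm4 Em4] := m4 k.
set K := Kerr B L A sigma eta.
have rr : rint P (fun w => q ^+ 3 + q * dW k w ^+ 2 + q^-1 * dW k w ^+ 4).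
  by apply: rintD; [apply: rintD; [exact: rint_cst|exact: rintZ]|exact: rintZ].
have ro := overshoot_rint k.
have rA := rintB (rf k) rf1.
have rB := rintB rA (rintZ sigma r1).
have rC := rintD rB (rintZ (sigma ^+ 2 / 2) r2).
have rD := rintD rC (rintZ ((L + B) * eta) ro).
apply: (@le_trans _ _ (Ex P (fun w => f (Dg k w) - f1 (Dg k w) * a k w - sigma * (f1 (Dg k w) * dW k w)
   + sigma ^+ 2 / 2 * (f2 (Dg k w) * dW k w ^+ 2) + (L + B) * eta * overshoot k w
   + K * (q ^+ 3 + q * dW k w ^+ 2 + q^-1 * dW k w ^+ 4)))).
  apply: le_Ex => //; first by apply: rintD => //; exact: rintZ.
  move=> w; rewrite DgS; apply: expanded_step => //; first exact: ltW.
    exact: Dg_ge0.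
  by rewrite q2.
rewrite (ExD rD (rintZ K rr)) (ExD rC (rintZ ((L + B) * eta) ro)) (ExD rB (rintZ (sigma ^+ 2 / 2) r2)).
rewrite (ExB rA (rintZ sigma r1)).
rewrite !ExZ// E1 mulr0 subr0 E2 gridB.
rewrite (ExD rA (rintZ _ rf2)) ExZ//.
rewrite (ExD (rintD (rint_cst _ _) (rintZ q rm2)) (rintZ q^-1 rm4)) (ExD (rint_cst _ _) (rintZ q rm2)) Ex_cst !ExZ//.
rewrite Em2 Em4 gridB -q2.
(* The 5 is 1 + 1 + 3, with 3 from the Gaussian fourth moment. *)
have -> : q ^+ 3 + q * q ^+ 2 + q^-1 * (3 * q ^+ 2 ^+ 2) = 5 * q ^+ 3 by field; rewrite gt_eqF.
by rewrite !mulrA.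
Qed.

End step.

Let X_meas t : 0 <= t -> measurable_fun setT (X t).
Proof.
move=> t0; apply: measurable_funB; last exact: IU_meas hU t.
apply: measurable_funD => //; apply: measurable_funM => //.
exact: (W_meas hF hW t0).
Qed.

Lemma Ex_W2 t : 0 <= t -> rint P (fun w => W t w ^+ 2) /\ Ex P (fun w => W t w ^+ 2) <= t.
Proof.
have [W0 _ _ _] := hW.
rewrite le_eqVlt => /predU1P[<-|t0].
  split; first by apply: eq_rint (rint_cst P 0) => w; rewrite W0 expr0n.
  by rewrite (@eq_Ex _ _ _ P _ (fun=> 0)) ?Ex_cst// => w; rewrite W0 expr0n.
have [r0 E0] := incr_moment2 hF hW (lexx 0) t0.
split; first by apply: eq_rint r0 => w; rewrite W0 subr0.
rewrite -[leRHS]subr0 -E0 le_eqVlt; apply/orP; left; apply/eqP.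
by apply: eq_Ex => w; rewrite W0 subr0.
Qed.

Let c := A + 2 * A ^+ 2 + 2 * sigma ^+ 2.

Let c0 : 0 <= c.
Proof. by have := sqr_ge0 A; have := sqr_ge0 sigma; have := A0; rewrite /c; lra. Qed.

(** A discrete Gronwall estimate. Reflection does not increase squares, the product of [Dg k] with
    the next Brownian increment has mean 0, and the drift cross term is at most A mesh (1 + x^2),
    whence the factor 1 + A mesh per step. The constant [c] collects what does not multiply x^2: A
    from that cross term, 2 A^2 from the squared drift and 2 sigma^2 from the noise. *)
Lemma Dg_moment2 k : Ex P (fun w => Dg k w ^+ 2) <= (1 + A * mesh) ^+ k * (z ^+ 2 + c * grid k).
Proof.
have d0 := mesh_gt0; have d1 := mesh_le1.
elim: k => [|k IH].
  rewrite expr0 mul1r /grid mul0r mulr0 addr0.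
  by under eq_Ex do rewrite Dg0; rewrite Ex_cst.
have [mD rD _] := Dg_approx k; have [mD1 rD1 _] := Dg_approx k.+1.
have [r1 E1] := approx_incr0 hF hW (grid_ge0 k) (grid_lt k) (Dg_approx k).
have [rm2 Em2] := m2 k.
have rA := rintD (rintZ (1 + A * mesh) rD) (rint_cst P (A * mesh + 2 * A ^+ 2 * mesh)).
have rB := rintB rA (rintZ (2 * sigma) r1).
apply: (@le_trans _ _ (Ex P (fun w => (1 + A * mesh) * Dg k w ^+ 2 + (A * mesh + 2 * A ^+ 2 * mesh)
   - 2 * sigma * (Dg k w * dW k w) + 2 * sigma ^+ 2 * dW k w ^+ 2))).
  apply: le_Ex => //; first by apply: rintD => //; exact: rintZ.
  move=> w; rewrite DgS; set x := Dg k w; set v := dW k w; set b := a k w.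
  have x0 : 0 <= x by exact: Dg_ge0.
  have hb : `|b| <= A * mesh by exact: a_bnd.
  apply: (@le_trans _ _ ((x - (b + sigma * v)) ^+ 2)).
    by case: (leP (x - (b + sigma * v)) 0) => h; rewrite ?expr0n/= ?sqr_ge0.
  have h1 : - (2 * x * b) <= A * mesh * (1 + x ^+ 2).
    have : - (2 * x * b) <= (2 * x) * `|b|.
      by rewrite -mulrN ler_wpM2l ?mulr_ge0// -normrN ler_norm.
    have : (2 * x) * `|b| <= (2 * x) * (A * mesh) by rewrite ler_wpM2l ?mulr_ge0.
    have : (2 * x) * (A * mesh) <= (1 + x ^+ 2) * (A * mesh).
      rewrite ler_wpM2r ?mulr_ge0 ?(ltW d0)//; have := sqr_ge0 (1 - x); nra.
    lra.
  have h2 : b ^+ 2 <= A ^+ 2 * mesh.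
    rewrite -(real_normK (num_real b)).
    apply: (@le_trans _ _ ((A * mesh) ^+ 2)); first by rewrite lerXn2r ?nnegrE// mulr_ge0// ltW.
    by rewrite exprMn ler_wpM2l ?sqr_ge0// expr2 ger_pMl.
  have := sqr_ge0 (b - sigma * v); nra.
rewrite (ExD rB (rintZ _ rm2)) (ExB rA (rintZ _ r1)) (ExD (rintZ _ rD) (rint_cst _ _)) !ExZ// Ex_cst.
rewrite E1 mulr0 subr0 Em2 gridB gridS [(1 + A * mesh) ^+ k.+1]exprS.
have a1 : 1 <= 1 + A * mesh by rewrite lerDl mulr_ge0// ltW.
have a0 : 0 <= 1 + A * mesh by exact: le_trans a1.
have h := ler_wpM2l a0 IH.
have h1 : c * mesh <= (1 + A * mesh) ^+ k.+1 * (c * mesh).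
  by rewrite ler_peMl ?mulr_ge0 ?(ltW d0)// exprn_ege1.
rewrite [(1 + A * mesh) ^+ k.+1]exprS in h1.
have -> : (1 + A * mesh) * (1 + A * mesh) ^+ k * (z ^+ 2 + c * (grid k + mesh)) =
  (1 + A * mesh) * ((1 + A * mesh) ^+ k * (z ^+ 2 + c * grid k)) + (1 + A * mesh) * (1 + A * mesh) ^+ k * (c * mesh) by ring.
have -> : A * mesh + 2 * A ^+ 2 * mesh = c * mesh - 2 * sigma ^+ 2 * mesh by rewrite /c; ring.
lra.
Qed.

Let X_rint j : rint P (X (grid j)).
Proof.
apply: rint_sqr; first exact: X_meas (grid_ge0 j).
have sF := F_sigma hF (grid_ge0 j); have mF := F_meas hF (grid_ge0 j).
have [] // : approx P (F (grid j)) (X (grid j)).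
apply: approxB => //; last exact: (approx_IU P hF hU (grid_ge0 j)).
apply: approxD => //; first exact: approx_cst.
by apply: approxZ => //; exact: (approx_W hF hW (grid_ge0 j)).
Qed.

(* Telescoping: overshoots are increments of the maximum D + X. *)
Lemma overshoot_sum k :
  \sum_(j < k) Ex P (overshoot j) = Ex P (fun w => Dg k w + X (grid k) w) - z.
Proof.
elim: k => [|k IH].
  rewrite big_ord0 (@eq_Ex _ _ _ P _ (fun=> z)) ?Ex_cst ?subrr// => w.
  by rewrite Dg0 /grid mul0r X0 addr0.
rewrite big_ord_recr /= IH addrAC -ExD; [|by apply: rintD|exact: overshoot_rint].
by congr (_ - _); apply: eq_Ex => w; rewrite DgS_overshoot; ring.
Qed.

(** Bounds the expected running maximum of the sampled path up to time [m], with first moments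
    estimated by second ones through x <= 1 + x^2. What matters is that the mesh does not occur in
    it. *)
Definition Kov (m : R) : R := 1 + expR (A * m) * (z ^+ 2 + c * m) + `|mu| * m + sigma * (1 + m).

Lemma overshoot_sum_le k m : grid k <= m -> \sum_(j < k) Ex P (overshoot j) <= Kov m.
Proof.
move=> km; have t0 := grid_ge0 k.
have m0 : 0 <= m by exact: le_trans km.
have [mD rD _] := Dg_approx k.
have [rW EW] := Ex_W2 t0.
rewrite overshoot_sum.
have rA := rintD (rint_cst P (1 + `|mu| * m)) rD.
have rB := rintZ sigma (rintD (rint_cst P 1) rW).
have h : Ex P (fun w => Dg k w + X (grid k) w) <=
  Ex P (fun w => (1 + `|mu| * m + Dg k w ^+ 2) + sigma * (1 + W (grid k) w ^+ 2)).
  have key w : Dg k w + X (grid k) w <= (1 + `|mu| * m + Dg k w ^+ 2) + sigma * (1 + W (grid k) w ^+ 2).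
    have D0 := Dg_ge0 k w.
    have e1 : Dg k w <= 1 + Dg k w ^+ 2 by have := sqr_ge0 (1 - Dg k w); nra.
    have e2 : mu * grid k <= `|mu| * m.
      by apply: (@le_trans _ _ (`|mu| * grid k)); [rewrite ler_wpM2r// ler_norm|rewrite ler_wpM2l].
    have e3 : sigma * W (grid k) w <= sigma * (1 + W (grid k) w ^+ 2).
      by rewrite ler_pM2l//; have := sqr_ge0 (1 - W (grid k) w); have := sqr_ge0 (W (grid k) w); nra.
    have /andP[i0 _] := IU_bnd hU w t0.
    by rewrite /Xproc -/(IU U (grid k) w); lra.
  by apply: le_Ex => //; exact: rintD.
rewrite (ExD rA rB) (ExD (rint_cst _ _) rD) (ExZ sigma (rintD (rint_cst P 1) rW)) (ExD (rint_cst _ _) rW) !Ex_cst in h.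
have hD : Ex P (fun w => Dg k w ^+ 2) <= expR (A * m) * (z ^+ 2 + c * m).
  apply: (le_trans (Dg_moment2 k)); apply: ler_pM.
  - by rewrite exprn_ge0// addr_ge0// mulr_ge0// ltW// mesh_gt0.
  - by rewrite addr_ge0 ?sqr_ge0// mulr_ge0.
  - apply: (@le_trans _ _ (expR (A * grid k))).
      rewrite /grid mulrCA expRM_natl lerXn2r ?nnegrE ?expR_ge0//.
        by rewrite addr_ge0// mulr_ge0// ltW// mesh_gt0.
      exact: expR_ge1Dx.
    by rewrite ler_expR ler_wpM2l.
  - by rewrite lerD2l ler_wpM2l.
have hW2 : sigma * (1 + Ex P (fun w => W (grid k) w ^+ 2)) <= sigma * (1 + m).
  by rewrite ler_pM2l// lerD2l (le_trans EW).
by rewrite /Kov; move: z0; lra.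
Qed.

End scheme.

Lemma measurable_truncn (R : realType) (k : nat) (c : R) : 0 < c -> measurable [set s : R | Num.truncn (s / c) = k].
Proof.
move=> c0.
have h j : measurable [set s : R | (Num.truncn (s / c) <= j)%N].
  rewrite (_ : [set s : R | _] = `]-oo, (j.+1%:R * c)[%classic)//.
  by apply/seteqP; split => s /=; rewrite in_itv/= truncn_le_nat ltr_pdivrMr.
case: k => [|k].
  rewrite (_ : [set s : R | _] = [set s : R | (Num.truncn (s / c) <= 0)%N]); first exact: h.
  by apply/seteqP; split => s /=; rewrite leqn0 => /eqP.
rewrite (_ : [set s : R | _] = [set s : R | (Num.truncn (s / c) <= k.+1)%N] `\` [set s : R | (Num.truncn (s / c) <= k)%N]); first exact: measurableD.
apply/seteqP; split => s /=; first by move=> ->; rewrite ltnn.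
by move=> [h1 h2]; apply/eqP; rewrite eqn_leq h1 ltnNge; exact/negP.
Qed.

(** The preimage splits along the countably many level sets of [kap]. With [kap] the index of the
    current grid cell, step processes become jointly measurable. *)
Lemma measurable_select (R : realType) d (T : measurableType d) (Y : nat -> T -> R) (kap : R -> nat) :
  (forall k, measurable [set s | kap s = k]) -> (forall k, measurable_fun setT (Y k)) ->
  measurable_fun setT (fun p : R * T => Y (kap p.1) p.2).
Proof.
move=> mk mY _ B mB; rewrite setTI.
rewrite (_ : _ @^-1` B = \bigcup_k ([set s | kap s = k] `*` (Y k @^-1` B))).
  apply: bigcup_measurable => k _; apply: measurableX => //.
  by have := mY k measurableT _ mB; rewrite setTI.
apply/seteqP; split => [[s w] /= h|[s w] [k _ [/= <-]]//].
by exists (kap s).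
Qed.

Lemma expR_lip (R : realType) (x y : R) : 0 <= x -> 0 <= y -> `|expR (- x) - expR (- y)| <= `|x - y|.
Proof.
wlog xy : x y / x <= y.
  move=> h x0 y0; case: (leP x y) => xy; first exact: h.
  by rewrite distrC (distrC x); apply: h => //; exact: ltW.
move=> x0 y0.
rewrite ger0_norm ?subr_ge0 ?ler_expR ?lerN2// distrC ger0_norm ?subr_ge0//.
have -> : - y = - x + (x - y) by ring.
rewrite expRD.
have h := expR_ge1Dx (x - y).
have e1 : expR (- x) <= 1 by rewrite expR_le1 oppr_le0.
have e0 := expR_gt0 (- x).
have : expR (- x) * (1 - expR (x - y)) <= 1 * (y - x).
  apply: ler_pM => //; [by rewrite subr_ge0 expR_le1 subr_le0|lra].
lra.
Qed.

Lemma discount_meas (R : realType) (r : R) : measurable_fun setT (fun s : R => expR (- (r * s))).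
Proof.
apply: (measurableT_comp (@measurable_expR R)).
apply: (measurableT_comp (@oppr_measurable R setT)).
exact: mulrl_measurable.
Qed.

Lemma discount01 (R : realType) (r s : R) : 0 <= r -> 0 <= s -> 0 <= expR (- (r * s)) <= 1.
Proof. by move=> r0 s0; rewrite expR_ge0 expR_le1 oppr_le0 mulr_ge0. Qed.

Lemma discount_lip (R : realType) (r s b : R) : 0 <= r -> 0 <= s -> s <= b ->
  `|expR (- (r * b)) - expR (- (r * s))| <= r * (b - s).
Proof.
move=> r0 s0 sb; have b0 : 0 <= b by exact: le_trans sb.
apply: (le_trans (expR_lip (mulr_ge0 r0 b0) (mulr_ge0 r0 s0))).
by rewrite -mulrBr normrM (ger0_norm r0) ger0_norm ?subr_ge0.
Qed.

(** A discrete product rule for the discount. Since the sign of [y] is free, e' - e - r dl e has to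
    be bounded on both sides; the lower bound 0 and the upper bound r^2 dl^2 both follow from e^x >=
    1 + x. *)
Lemma discount_diff (R : realType) (r dl t y B : R) : 0 <= r -> 0 <= dl -> 0 <= t -> `|y| <= B ->
  (expR (- (r * (t + dl))) - expR (- (r * t))) * y <=
  - r * dl * expR (- (r * (t + dl))) * y + r ^+ 2 * B * dl ^+ 2.
Proof.
move=> r0 d0 t0 yB.
set e := expR (- (r * (t + dl))); set e' := expR (- (r * t)).
have e0 : 0 <= e by exact: expR_ge0.
have e'0 : 0 <= e' by exact: expR_ge0.
have e'1 : e' <= 1 by case/andP: (discount01 r0 t0).
have h1 : 0 <= e' - e - r * dl * e.
  have -> : e' = e * expR (r * dl) by rewrite -expRD; congr expR; ring.
  have h : 0 <= expR (r * dl) - 1 - r * dl by rewrite -addrA -opprD subr_ge0 expR_ge1Dx.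
  have := mulr_ge0 e0 h; lra.
have h2 : e' - e - r * dl * e <= r ^+ 2 * dl ^+ 2.
  have -> : e = e' * expR (- (r * dl)) by rewrite -expRD; congr expR; ring.
  have h := expR_ge1Dx (- (r * dl)).
  have rd : 0 <= 1 + r * dl by rewrite addr_ge0// mulr_ge0.
  have h3 := ler_wpM2l e'0 (ler_wpM2r rd h).
  have h4 : e' * (r ^+ 2 * dl ^+ 2) <= r ^+ 2 * dl ^+ 2.
    by rewrite ler_piMl// mulr_ge0 ?sqr_ge0.
  lra.
have h3 : `|(e' - e - r * dl * e) * - y| <= r ^+ 2 * dl ^+ 2 * B.
  by rewrite normrM normrN ler_pM// ger0_norm.
have := le_trans (ler_norm _) h3; lra.
Qed.

Section half_open.
Context (R : realType).
Notation leb := (@lebesgue_measure R).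

Lemma leb_coE (a b : R) : a <= b -> leb `[a, b[%classic = (b - a)%:E.
Proof.
move=> ab; rewrite lebesgue_measure_itv/= lte_fin.
by case: ltgtP ab => // -> _; rewrite subrr.
Qed.

Lemma leb_coy (a b : R) : (leb `[a, b[%classic < +oo)%E.
Proof. by rewrite lebesgue_measure_itv/=; case: ifP => _; rewrite ?ltry// -EFinB ltry. Qed.

Lemma Rint_cst_co (a b e : R) : a <= b -> Rintegral leb `[a, b[ (fun=> e) = e * (b - a).
Proof.
move=> ab; rewrite Rintegral_cst//; congr (_ * _).
by have -> : b - a = fine (leb `[a, b[%classic) by rewrite leb_coE.
Qed.

Lemma discounted_le (r s C x : R) : 0 <= r -> 0 <= s -> `|x| <= C -> `|expR (- (r * s)) * x| <= C.
Proof.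
move=> r0 s0 hx; rewrite normrM ger0_norm ?expR_ge0// -[leRHS]mul1r.
by apply: ler_pM => //; rewrite expR_le1 oppr_le0 mulr_ge0.
Qed.

Lemma integrable_discounted (r a b C : R) (g : R -> R) : 0 <= r -> 0 <= a -> measurable_fun setT g ->
  (forall s, a <= s -> `|g s| <= C) ->
  leb.-integrable `[a, b[ (EFin \o (fun s => expR (- (r * s)) * g s)).
Proof.
move=> r0 a0 mg gC; apply: (@integrable_bnd _ _ _ C) => //; first exact: leb_coy.
  by apply: measurable_funTS; apply: measurable_funM => //; exact: discount_meas.
move=> s /=; rewrite in_itv/= => /andP[s1 _].
by apply: discounted_le => //; [exact: le_trans s1|exact: gC].
Qed.

Lemma weighted_ge (phi g : R -> R) (r a b C : R) : 0 <= r -> a <= b ->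
  measurable_fun setT phi -> measurable_fun setT g ->
  (forall s, a <= s -> 0 <= phi s <= 1) ->
  (forall s, a <= s -> s <= b -> `|phi b - phi s| <= r * (b - s)) ->
  (forall s, a <= s -> `|g s| <= C) ->
  phi b * Rintegral leb `[a, b[ g <=
  Rintegral leb `[a, b[ (fun s => phi s * g s) + C * r * (b - a) ^+ 2.
Proof.
move=> r0 ab mphi mg hphi lphi gC.
have C0 : 0 <= C by apply: le_trans (gC _ (lexx a)).
have ig : leb.-integrable `[a, b[ (EFin \o g).
  apply: (@integrable_bnd _ _ _ C) => //; first exact: leb_coy.
    exact: measurable_funTS.
  by move=> s /=; rewrite in_itv/= => /andP[s1 _]; exact: gC.
have i1 : leb.-integrable `[a, b[ (EFin \o (fun s => phi s * g s)).
  apply: (@integrable_bnd _ _ _ C) => //; first exact: leb_coy.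
    by apply: measurable_funTS; exact: measurable_funM.
  move=> s /=; rewrite in_itv/= => /andP[s1 _]; have /andP[p0 p1] := hphi _ s1.
  by rewrite normrM (ger0_norm p0) -[leRHS]mul1r ler_pM// gC.
have i2 : leb.-integrable `[a, b[ (EFin \o (fun s => phi b * g s)).
  apply: (@integrable_bnd _ _ _ (`|phi b| * C)) => //; first exact: leb_coy.
    by apply: measurable_funTS; exact: measurable_funM.
  by move=> s /=; rewrite in_itv/= => /andP[s1 _]; rewrite normrM ler_wpM2l// gC.
rewrite -lerBlDl -RintegralZl// -RintegralB//.
apply: (le_trans (ler_norm _)).
have -> : C * r * (b - a) ^+ 2 = (C * r * (b - a)) * fine (leb `[a, b[%classic).
  by rewrite leb_coE//=; ring.
apply: norm_Rint_le => //; first exact: leb_coy.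
  by apply: measurable_funTS; apply: measurable_funB; exact: measurable_funM.
move=> s /=; rewrite in_itv/= => /andP[s1 s2].
rewrite -mulrBl normrM mulrC -mulrA ler_pM//; first exact: gC.
apply: (le_trans (lphi _ s1 (ltW s2))); rewrite ler_wpM2l//; lra.
Qed.

End half_open.

(** * Discounted expansion along the grid *)

Section discounted.
Context (R : realType) d (T : measurableType d) (P : probability T R)
  (F : R -> set (set T)) (W U : R -> T -> R) (mu sigma u0 z r : R).
Hypotheses (hF : filtration F) (hW : std_brownian P F W) (hU : admissible F u0 U).
Hypotheses (sigma0 : 0 < sigma) (u00 : 0 < u0) (z0 : 0 <= z) (r0 : 0 < r).
Notation leb := (@lebesgue_measure R).
Variables (B L : R) (f f1 f2 : R -> R).
Hypothesis fT : taylor2 B L f f1 f2.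

Let A := `|mu| + u0.
Let A0 : 0 <= A. Proof. by rewrite addr_ge0// ltW. Qed.
Let B0 : 0 <= B. Proof. exact: taylor2_B0 fT. Qed.
Let L0 : 0 <= L. Proof. exact: taylor2_L0 fT. Qed.

Definition gen (x u : R) : R :=
  - r * f x - mu * f1 x + f1 x * u + sigma ^+ 2 / 2 * f2 x.
Definition gen_bnd : R := B * (r + A + sigma ^+ 2 / 2).

Lemma gen_le x u : `|u| <= u0 -> `|gen x u| <= gen_bnd.
Proof.
move=> hu; have [[b0 b1 b2] _ _] := fT.
have s2 := sqr_ge0 sigma.
rewrite /gen /gen_bnd /A.
apply: (le_trans (ler_normD _ _)); apply: (le_trans (lerD (ler_normD _ _) (lexx _))).
apply: (le_trans (lerD (lerD (ler_normB _ _) (lexx _)) (lexx _))).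
have s20 : 0 <= sigma ^+ 2 / 2 by rewrite divr_ge0.
have -> : `|- r * f x| = r * `|f x| by rewrite normrM normrN (gtr0_norm r0).
have -> : `|mu * f1 x| = `|mu| * `|f1 x| by rewrite normrM.
have -> : `|f1 x * u| = `|f1 x| * `|u| by rewrite normrM.
have -> : `|sigma ^+ 2 / 2 * f2 x| = sigma ^+ 2 / 2 * `|f2 x| by rewrite normrM (ger0_norm s20).
have := ler_wpM2l (ltW r0) (b0 x).
have := ler_wpM2l (normr_ge0 mu) (b1 x).
have := ler_pM (normr_ge0 (f1 x)) (normr_ge0 u) (b1 x) hu.
have := ler_wpM2l s20 (b2 x).
lra.
Qed.

Let mf : measurable_fun setT f. Proof. by have [_ [l _ _] _] := fT; exact: lipschitz_measurable l. Qed.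
Let mf1 : measurable_fun setT f1. Proof. by have [_ [_ l _] _] := fT; exact: lipschitz_measurable l. Qed.
Let mf2 : measurable_fun setT f2. Proof. by have [_ [_ _ l] _] := fT; exact: lipschitz_measurable l. Qed.

Lemma measurable_gen (D V : R * T -> R) : measurable_fun setT D -> measurable_fun setT V ->
  measurable_fun setT (fun p => gen (D p) (V p)).
Proof.
move=> mD mV.
apply: measurable_funD; last by apply: measurable_funM => //; exact: measurableT_comp.
apply: measurable_funD; last by apply: measurable_funM => //; exact: measurableT_comp.
apply: measurable_funB; first by apply: measurable_funM => //; exact: measurableT_comp.
by apply: measurable_funM => //; exact: measurableT_comp.
Qed.

Section fixed_mesh.
Variable n : nat.
Notation D := (Dg W U mu sigma z n).
Notation gr := (grid R n).
Notation dl := (mesh R n).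

Definition Dstep (s : R) (w : T) : R := D (Num.truncn (s / dl)) w.

Lemma Dstep_meas : measurable_fun setT (fun p : R * T => Dstep p.1 p.2).
Proof.
apply: (@measurable_select R d T D (fun s => Num.truncn (s / dl))) => k.
  exact: measurable_truncn (mesh_gt0 R n).
exact: (Dg_meas mu sigma z hF hW hU).
Qed.

(** The drawdown is frozen at the last grid point but the control is taken at the true time. The
    generator is affine in the control, so its time integral over a cell contains exactly the
    increment of the integrated control, and no regularity of [U] in time is involved. *)
Definition kern (p : R * T) : R := expR (- (r * p.1)) * gen (Dstep p.1 p.2) (U p.1 p.2).

Lemma kern_meas : measurable_fun setT kern.
Proof.
have [_ _ mU] := hU.
apply: measurable_funM; first exact: (measurableT_comp (discount_meas r) measurable_fst).
by apply: (measurable_gen (D := fun p => Dstep p.1 p.2) (V := fun p => U p.1 p.2)) => //; exact: Dstep_meas.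
Qed.

Lemma kern_bnd s w : 0 <= s -> `|kern (s, w)| <= gen_bnd.
Proof.
move=> s0; rewrite /kern normrM ger0_norm ?expR_ge0//= -[leRHS]mul1r.
apply: ler_pM => //; first by rewrite expR_le1 oppr_le0 mulr_ge0// ltW.
by apply: gen_le; exact: (U_norm hU).
Qed.

Lemma kern_int a b w : 0 <= a -> leb.-integrable `[a, b[ (EFin \o (fun s => kern (s, w))).
Proof.
move=> a0; apply: (@integrable_bnd _ _ _ gen_bnd) => //; first exact: leb_coy.
  by apply: measurable_funTS; exact: (measurable_section1 w kern_meas).
by move=> s /=; rewrite in_itv/= => /andP[as_ _]; apply: kern_bnd; exact: le_trans as_.
Qed.

Lemma Dstep_eq s k w : gr k <= s -> s < gr k.+1 -> Dstep s w = D k w.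
Proof.
move=> ks sk; rewrite /Dstep (@truncn_def _ _ k)//.
by rewrite ler_pdivlMr ?ltr_pdivrMr ?mesh_gt0// ks.
Qed.

(** The term r^2 B comes from [discount_diff], and [gen_bnd] times r from moving the discount factor
    inside the time integral by [weighted_ge]; both multiply the square of the mesh. *)
Definition cdisc : R := r ^+ 2 * B + gen_bnd * r.

Lemma discount_step k w :
  expR (- (r * gr k.+1)) * (f (D k w) - f1 (D k w) * (mu * dl - (IU U (gr k.+1) w - IU U (gr k) w))
     + sigma ^+ 2 / 2 * dl * f2 (D k w)) <=
  expR (- (r * gr k)) * f (D k w) + Rintegral leb `[gr k, gr k.+1[ (fun s => kern (s, w)) + cdisc * dl ^+ 2.
Proof.
have d0 := mesh_gt0 R n; have g0 := grid_ge0 R n k; have gS := gridS R n k.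
have gk : gr k <= gr k.+1 by rewrite gS lerDl ltW.
have g1 : 0 <= gr k.+1 by exact: le_trans gk.
set x := D k w.
have [[b0 b1 b2] _ _] := fT.
set I := IU U (gr k.+1) w - IU U (gr k) w.
have IE : Rintegral leb `[gr k, gr k.+1[ (fun s => U s w) = I.
  rewrite /I (IU_incr hU)// Rintegral_itv_bndo_bndc//.
  apply: integrableS (integrable_U hU (gr k.+1) w g0) => //.
  by apply: subset_itvl; rewrite bnd_simp.
have iU : leb.-integrable `[gr k, gr k.+1[ (EFin \o (fun s => U s w)).
  apply: integrableS (integrable_U hU (gr k.+1) w g0) => //.
  by apply: subset_itvl; rewrite bnd_simp.
have mUw := U_meas hU w.
have mg : measurable_fun setT (fun s => gen x (U s w)).
  apply: measurable_funD => //; apply: measurable_funD => //; exact: measurable_funM.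
have igen : leb.-integrable `[gr k, gr k.+1[ (EFin \o (fun s => gen x (U s w))).
  apply: (@integrable_bnd _ _ (fun s => gen x (U s w)) gen_bnd) => //; first exact: leb_coy.
    exact: measurable_funTS.
  move=> s /=; rewrite in_itv/= => /andP[s1 _]; apply: gen_le; apply: (U_norm hU).
  exact: le_trans s1.
have HE : Rintegral leb `[gr k, gr k.+1[ (fun s => gen x (U s w)) =
   (- r * f x - mu * f1 x + sigma ^+ 2 / 2 * f2 x) * dl + f1 x * I.
  transitivity (Rintegral leb `[gr k, gr k.+1[ (fun s => (- r * f x - mu * f1 x + sigma ^+ 2 / 2 * f2 x) + f1 x * U s w)).
    by apply: eq_Rintegral => s _; rewrite /gen; ring.
  rewrite RintegralD//; last 2 first.
  - apply: (@integrable_bnd _ _ _ `|- r * f x - mu * f1 x + sigma ^+ 2 / 2 * f2 x|) => //.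
    exact: leb_coy.
  - apply: (@integrable_bnd _ _ _ (B * u0)) => //; first exact: leb_coy.
      by apply: measurable_funTS; exact: measurable_funM.
    move=> s /=; rewrite in_itv/= => /andP[s1 _]; rewrite normrM ler_pM//.
    by apply: (U_norm hU); exact: le_trans s1.
  by rewrite Rint_cst_co// gridB RintegralZl// IE.
have KE : Rintegral leb `[gr k, gr k.+1[ (fun s => kern (s, w)) =
  Rintegral leb `[gr k, gr k.+1[ (fun s => expR (- (r * s)) * gen x (U s w)).
  apply: eq_Rintegral => s; rewrite inE/= in_itv/= => /andP[s1 s2].
  by rewrite /kern /= (Dstep_eq _ s1 s2).
have ik : leb.-integrable `[gr k, gr k.+1[ (EFin \o (fun s => expR (- (r * s)) * gen x (U s w))).
  apply: (@integrable_discounted _ r _ _ gen_bnd (fun s => gen x (U s w)) (ltW r0) g0 mg) => s s1.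
  by apply: gen_le; apply: (U_norm hU); exact: le_trans s1.
have key1 : expR (- (r * gr k.+1)) * Rintegral leb `[gr k, gr k.+1[ (fun s => gen x (U s w)) <=
  Rintegral leb `[gr k, gr k.+1[ (fun s => kern (s, w)) + gen_bnd * r * dl ^+ 2.
  rewrite {}KE -(gridB R n k).
  apply: (@weighted_ge _ (fun s => expR (- (r * s))) (fun s => gen x (U s w)) r _ _ _ (ltW r0) gk (discount_meas r) mg).
  - by move=> s s1; exact: (discount01 (ltW r0) (le_trans g0 s1)).
  - by move=> s s1 s2; exact: (discount_lip (ltW r0) (le_trans g0 s1) s2).
  - by move=> s s1; apply: gen_le; apply: (U_norm hU); exact: le_trans s1.
have key2 := discount_diff (ltW r0) (ltW d0) g0 (b0 x).
rewrite -gS in key2; rewrite {}HE in key1.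
move: (expR (- (r * gr k.+1))) (expR (- (r * gr k))) key1 key2 => e e' key1 key2.
rewrite /cdisc. clearbody I x. clear igen iU IE mUw mg ik. lra.
Qed.

Hypothesis f10 : f1 0 <= 0.
Let q := Num.sqrt dl.

Lemma Kerr_ge0 (eta : R) : 0 < eta -> 0 <= Kerr B L A sigma eta.
Proof.
move=> eta0; apply: addr_ge0.
  by apply: mulr_ge0 => //; apply: addr_ge0; [apply: mulr_ge0 => //; exact: ltW|exact: sqr_ge0].
apply: mulr_ge0; first by apply: addr_ge0 => //; apply: divr_ge0 (ltW eta0); exact: addr_ge0.
by apply: mulr_ge0 => //; apply: addr_ge0; apply: exprn_ge0 => //; exact: ltW.
Qed.

Let combine (a b e I1 I2 C o so K5 v kk y : R) : a <= b + C * o + K5 * (5 * v) ->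
  forall x, b <= e + I2 + x -> e <= y + I1 + C * so + kk * (5 * K5 * v + x) ->
  a <= y + (I1 + I2) + C * (so + o) + (kk + 1) * (5 * K5 * v + x).
Proof. move=> h1 x h2 h3; lra. Qed.

Lemma discrete_dynkin (eta : R) k : 0 < eta ->
  expR (- (r * gr k)) * Ex P (fun w => f (D k w)) <=
  f z + Ex P (fun w => Rintegral leb `[0, gr k[ (fun s => kern (s, w)))
   + (L + B) * eta * (\sum_(j < k) Ex P (overshoot W U mu sigma z n j))
   + k%:R * (5 * Kerr B L A sigma eta * q ^+ 3 + cdisc * dl ^+ 2).
Proof.
move=> eta0; have d0 := mesh_gt0 R n.
have [[b0 b1 b2] [l0 l1 l2] _] := fT.
have K0 := Kerr_ge0 eta0.
set K := Kerr B L A sigma eta in K0 *.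
have mD j : measurable_fun setT (D j) by exact: (Dg_meas mu sigma z hF hW hU).
have rf j : rint P (fun w => f (D j w)) by apply: (@rint_bnd _ _ _ P _ B) => //; exact: measurableT_comp.
have rK a b : 0 <= a -> a <= b -> rint P (fun w => Rintegral leb `[a, b[ (fun s => kern (s, w))).
  move=> a0 ab; apply: (@rint_bnd _ _ _ P _ (gen_bnd * fine (leb `[a, b[%classic))).
    exact: measurable_Rint _ kern_meas.
  move=> w; apply: norm_Rint_le => //; first exact: leb_coy.
    by apply: measurable_funTS; exact: (measurable_section1 w kern_meas).
  by move=> s /=; rewrite in_itv/= => /andP[as_ _]; apply: kern_bnd; exact: le_trans as_.
elim: k => [|k IH].
  rewrite /grid !mul0r mulr0 oppr0 expR0 mul1r big_ord0 mulr0 !addr0.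
  under eq_Ex do rewrite (Dg0 U mu sigma z hW).
  rewrite Ex_cst -[leLHS]addr0 lerD2l (@eq_Ex _ _ _ P _ (fun=> 0)) ?Ex_cst// => w.
  by rewrite set_itvco0 Rintegral_set0.
have g0 := grid_ge0 R n k; have gk : gr k <= gr k.+1 by exact/ltW/grid_lt.
have g1 : 0 <= gr k.+1 by exact: le_trans gk.
set e := expR (- (r * gr k.+1)); set e' := expR (- (r * gr k)) in IH *.
have e0 : 0 <= e by exact: expR_ge0.
have e1 : e <= 1 by rewrite expR_le1 oppr_le0 mulr_ge0// ltW.
have step := step_Ex mu hF hW hU sigma0 u00 z0 n fT f10 k eta0.
rewrite -/A -/K -/q in step.
set H := (fun w : T => _ - _ + _) in step.
set o := Ex P (overshoot W U mu sigma z n k) in step.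
have o0 : 0 <= o by apply: Ex_ge0 => w; rewrite /overshoot le_max lexx orbT.
have q30 : 0 <= q ^+ 3 by rewrite exprn_ge0// sqrtr_ge0.
have c10 : 0 <= (L + B) * eta by apply: mulr_ge0 (ltW eta0); exact: addr_ge0.
have rH : rint P H.
  apply: rintD; [apply: rintB => //|].
    apply: (@rint_bndM _ _ _ P _ _ B) => //; first exact: measurableT_comp.
    apply: rintB; first exact: rint_cst.
    apply: (@rint_bnd _ _ _ P _ (u0 * (gr k.+1 - gr k))).
      by apply: measurable_funB; exact: (IU_meas hU).
    by move=> w; have /andP[h1 h2] := IU_incr_bnd hU w g0 gk; rewrite ger0_norm.
  by apply: rintZ; apply: (@rint_bnd _ _ _ P _ B) => //; exact: measurableT_comp.
have s1 : e * Ex P (fun w => f (D k.+1 w)) <= e * Ex P H + (L + B) * eta * o + K * (5 * q ^+ 3).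
  apply: (le_trans (ler_wpM2l e0 step)); rewrite !mulrDr -!addrA lerD2l.
  by apply: lerD; apply: ler_piMl => //; apply: mulr_ge0 => //; apply: mulr_ge0.
have s2 : e * Ex P H <= e' * Ex P (fun w => f (D k w)) + Ex P (fun w => Rintegral leb `[gr k, gr k.+1[ (fun s => kern (s, w))) + cdisc * dl ^+ 2.
  rewrite -ExZ// -ExZ// -ExD; [|exact: rintZ|exact: rK].
  rewrite -[X in _ + X](Ex_cst P) -ExD; [|by apply: rintD; [exact: rintZ|exact: rK]|exact: rint_cst].
  apply: le_Ex; [exact: rintZ| |by move=> w; exact: discount_step].
  by apply: rintD; [apply: rintD; [exact: rintZ|exact: rK]|exact: rint_cst].
have s3 : Ex P (fun w => Rintegral leb `[0, gr k.+1[ (fun s => kern (s, w))) =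
  Ex P (fun w => Rintegral leb `[0, gr k[ (fun s => kern (s, w))) +
  Ex P (fun w => Rintegral leb `[gr k, gr k.+1[ (fun s => kern (s, w))).
  rewrite -ExD; [|exact: rK|exact: rK]; apply: eq_Ex => w.
  have E : `[0, gr k.+1[%classic = `[0, gr k[%classic `|` `[gr k, gr k.+1[%classic.
    by rewrite -itv_bndbnd_setU// bnd_simp.
  rewrite E Rintegral_setU// -?E; first exact: kern_int.
  apply/disj_setPS => s [/=]; rewrite !in_itv/= => /andP[_ h1] /andP[h2 _].
  by have := lt_le_trans h1 h2; rewrite ltxx.
rewrite s3 big_ord_recr /= -/o -[k.+1%:R]natr1.
exact: (combine s1 s2 IH).
Qed.

End fixed_mesh.

End discounted.

(** * Vanishing mesh *)

Lemma within_cvg_seq (R : realType) (A : set R) (g : R -> R) (x : nat -> R) (s : R) :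
  {within A, continuous g} -> (forall n, A (x n)) -> A s -> x n @[n --> \oo] --> s ->
  g (x n) @[n --> \oo] --> g s.
Proof.
move=> /subspace_continuousP cg Ax As xs.
apply: (cvg_comp x g _ (cg _ As)) => P /= wP.
have : \forall n \near \oo, A (x n) -> P (x n) by apply: (xs (fun y => A y -> P y)).
by apply: filterS => n; apply.
Qed.

Lemma lipschitz_within (R : realType) (A : set R) (L : R) (g : R -> R) :
  (forall a b, A a -> A b -> `|g a - g b| <= L * `|a - b|) -> {within A, continuous g}.
Proof.
move=> lip; apply/subspace_continuousP => s As; apply/cvgrPdist_le => e e0.
have L1 : 0 < `|L| + 1 by rewrite ltr_wpDl.
have h : 0 < e / (`|L| + 1) by exact: divr_gt0.
near=> y.
have Ay : A y by near: y; exact: withinT.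
apply: (le_trans (lip _ _ As Ay)).
apply: (@le_trans _ _ ((`|L| + 1) * (e / (`|L| + 1)))); last by rewrite mulrC divfK// gt_eqF.
apply: (@le_trans _ _ ((`|L| + 1) * `|s - y|)).
  by rewrite ler_wpM2r// (le_trans (ler_norm _))// lerDl.
rewrite ler_pM2l//; near: y; apply: cvg_within.
exact: (@cvgr_dist_le _ _ _ _ _ id s cvg_id _ h).
Unshelve. all: by end_near. Qed.

Lemma cvg_maxl (R : realType) (x : nat -> R) (z l : R) : x n @[n --> \oo] --> l ->
  Num.max z (x n) @[n --> \oo] --> Num.max z l.
Proof.
have E (a b : R) : Num.max a b = (a + b + `|a - b|) / 2.
  by case: (leP a b) => ab; [rewrite ler0_norm ?subr_le0//|rewrite gtr0_norm ?subr_gt0//]; field.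
move=> xl; rewrite E; under eq_fun do rewrite E.
apply: cvgMl; apply: cvgD; first by apply: cvgD => //; exact: cvg_cst.
by apply: cvg_norm; apply: cvgB => //; exact: cvg_cst.
Qed.

Lemma runmax_ge (R : realType) (x : nat -> R) z k j : x 0%N <= z -> (j <= k)%N -> x j <= runmax x z k.
Proof.
move=> x0; elim: k => [|k IH]; first by rewrite leqn0 => /eqP ->.
by rewrite leq_eqVlt => /predU1P[->|jk] /=; rewrite le_max ?lexx ?orbT// IH.
Qed.

Lemma runmax_ge0 (R : realType) (x : nat -> R) z k : z <= runmax x z k.
Proof. by elim: k => //= k IH; rewrite le_max IH. Qed.

Lemma runmax_le (R : realType) (x : nat -> R) z k m : z <= m -> (forall j, (j <= k)%N -> x j <= m) ->
  runmax x z k <= m.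
Proof.
move=> zm; elim: k => //= k IH h; rewrite ge_max IH ?h// => j jk; apply: h.
exact: leq_trans jk _.
Qed.

Section mesh_limit.
Context (R : realType).

Lemma mesh_cvg0 : mesh R n @[n --> \oo] --> 0.
Proof. exact: cvg_harmonic. Qed.

Definition floor_grid (n : nat) (s : R) := grid R n (Num.truncn (s / mesh R n)).

Lemma floor_grid_itv n (s : R) : 0 <= s -> s - mesh R n <= floor_grid n s <= s.
Proof.
move=> s0; have d0 := mesh_gt0 R n.
have /truncn_itv/andP[h1 h2] : 0 <= s / mesh R n by rewrite divr_ge0// ltW.
rewrite /floor_grid /grid -ler_pdivlMr// h1 andbT lerBlDr.
rewrite ltr_pdivrMr// -natr1 mulrDl mul1r in h2.
exact: ltW.
Qed.

Lemma floor_grid_cvg (s : R) : 0 <= s -> floor_grid n s @[n --> \oo] --> s.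
Proof.
move=> s0; apply: (@squeeze_cvgr _ _ _ _ (fun n => s - mesh R n) (cst s)).
- by near=> n; exact: floor_grid_itv.
- by rewrite -[s in X in _ --> X]subr0; apply: cvgB; [exact: cvg_cst|exact: mesh_cvg0].
- exact: cvg_cst.
Unshelve. all: by end_near. Qed.

End mesh_limit.

Section drawdown_limit.
Context (R : realType) d (T : measurableType d) (P : probability T R)
  (F : R -> set (set T)) (W U : R -> T -> R) (mu sigma u0 z : R).
Hypotheses (hF : filtration F) (hW : std_brownian P F W) (hU : admissible F u0 U).
Hypotheses (u00 : 0 < u0) (z0 : 0 <= z).
Notation X := (Xproc mu sigma W U).
Notation Dt := (Dproc mu sigma W U z).
Notation Dn := (Dstep W U mu sigma z).

Lemma X_within w : {within `[0, +oo[, continuous (fun t => X t w)}.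
Proof.
have [_ cW _ _] := hW.
have cI : {within `[0, +oo[, continuous (fun t => IU U t w)}.
  apply: (@lipschitz_within _ _ u0) => a b; rewrite /= !in_itv/= !andbT.
  wlog ab : a b / a <= b.
    move=> h a0 b0; case: (leP a b) => ab; first exact: h.
    by rewrite distrC (distrC a); apply: h => //; exact: ltW.
  move=> a0 b0; have /andP[h1 h2] := IU_incr_bnd hU w a0 ab.
  by rewrite distrC (distrC a) !ger0_norm ?subr_ge0// -subr_ge0.
apply/subspace_continuousP => s s0.
have /subspace_continuousP/(_ _ s0) c1 := cW w.
have /subspace_continuousP/(_ _ s0) c2 := cI.
apply: cvgB => //; apply: cvgD; last exact: cvgMr.
by apply: cvgMr; exact: cvg_within.
Qed.

Lemma X_cvg w (x : nat -> R) (s : R) : (forall n, 0 <= x n) -> 0 <= s -> x n @[n --> \oo] --> s ->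
  X (x n) w @[n --> \oo] --> X s w.
Proof.
move=> x0 s0 xs.
have h1 n : `[0, +oo[%classic (x n) by rewrite /= in_itv/= andbT.
have h2 : `[0, +oo[%classic s by rewrite /= in_itv/= andbT.
exact: (@within_cvg_seq R _ (fun t => X t w) x s (@X_within w) h1 h2 xs).
Qed.

Lemma X_at0 w : X 0 w = 0.
Proof.
have [W0 _ _ _] := hW.
by rewrite /Xproc W0 -/(IU U 0 w) IU0; ring.
Qed.

Lemma X_attains_max w (t : R) : 0 <= t -> exists s, [/\ 0 <= s, s <= t &
  forall s', 0 <= s' -> s' <= t -> X s' w <= X s w].
Proof.
move=> t0.
have cX : {within `[0, t], continuous (fun s => X s w)}.
  by apply: continuous_subspaceW (@X_within w); exact: subset_itvl.
have [s] := EVT_max t0 cX; rewrite in_itv/= => /andP[s0 st] hs.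
by exists s; split => // s' s'0 s't; apply: hs; rewrite in_itv/= s'0.
Qed.

Lemma Mproc_max w (t s : R) : 0 <= s -> s <= t -> (forall s', 0 <= s' -> s' <= t -> X s' w <= X s w) ->
  Mproc mu sigma W U z t w = Num.max z (X s w).
Proof.
move=> s0 st hs; rewrite /Mproc; congr (Num.max _ _).
apply/eqP; rewrite eq_le; apply/andP; split.
  apply: ge_sup.
    by exists (X s w); exists s => //=; rewrite in_itv/= s0 st.
  by move=> y [s' /=]; rewrite in_itv/= => /andP[h1 h2] <-; exact: hs.
apply: sup_upper_bound.
  split; first by exists (X s w); exists s => //=; rewrite in_itv/= s0 st.
  by exists (X s w) => y [s' /=]; rewrite in_itv/= => /andP[h1 h2] <-; exact: hs.
by exists s => //=; rewrite in_itv/= s0 st.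
Qed.

Lemma Dproc_ge0 w (t : R) : 0 <= t -> 0 <= Dt t w.
Proof.
move=> t0; have [s [s0 st hs]] := X_attains_max w t0.
by rewrite /Dproc (Mproc_max s0 st hs) subr_ge0 le_max hs ?orbT.
Qed.

(** The maximum of the path on [0, t] is attained at some s. The grid maximum lies below it and
    above the value at the last grid point up to s, which converges to the maximum by continuity of
    the path. *)
Lemma Dstep_cvg w (t : R) : 0 <= t -> Dn n t w @[n --> \oo] --> Dt t w.
Proof.
move=> t0; have [s [s0 st hs]] := X_attains_max w t0.
have fg_ge0 n a : 0 <= floor_grid (R := R) n a by exact: grid_ge0.
have cs : X (floor_grid n s) w @[n --> \oo] --> X s w.
  by apply: X_cvg => //; exact: floor_grid_cvg.
have ct : X (floor_grid n t) w @[n --> \oo] --> X t w.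
  by apply: X_cvg => //; exact: floor_grid_cvg.
rewrite /Dproc (Mproc_max s0 st hs).
apply: (@squeeze_cvgr _ _ _ _ (fun n => Num.max z (X (floor_grid n s) w) - X (floor_grid n t) w)
  (fun n => Num.max z (X s w) - X (floor_grid n t) w)).
- near=> n; rewrite /Dstep /Dg !lerD2r; apply/andP; split.
    rewrite ge_max runmax_ge0/=.
    apply: (@runmax_ge _ (fun j => X (grid R n j) w)).
      by rewrite /grid mul0r X_at0.
    by apply: le_truncn; rewrite ler_wpM2r// invr_ge0 ltW// mesh_gt0.
  apply: runmax_le; first by rewrite le_max lexx.
  move=> j jt; rewrite le_max hs ?orbT ?grid_ge0//.
  apply: (@le_trans _ _ (floor_grid n t)); last by have /andP[] := floor_grid_itv n t0.
  by rewrite /floor_grid /grid ler_wpM2r ?(ltW (mesh_gt0 _ _))// ler_nat.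
- by apply: cvgB => //; exact: cvg_maxl.
- by apply: cvgB => //; exact: cvg_cst.
Unshelve. all: by end_near. Qed.

End drawdown_limit.

Lemma dominated_cvg_Rintegral d (T : measurableType d) (R : realType) (m : {measure set T -> \bar R})
  (D : set T) (f_ : nat -> T -> R) (f g : T -> R) : measurable D ->
  (forall n, measurable_fun D (f_ n)) -> measurable_fun D f -> m.-integrable D (EFin \o g) ->
  (forall n x, D x -> `|f_ n x| <= g x) ->
  (forall x, D x -> f_ n x @[n --> \oo] --> f x) ->
  Rintegral m D (f_ n) @[n --> \oo] --> Rintegral m D f.
Proof.
move=> mD mf_ mf ig fg cf.
have mE_ n : measurable_fun D (EFin \o f_ n) by exact/measurable_EFinP.
have mE : measurable_fun D (EFin \o f) by exact/measurable_EFinP.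
have c : {ae m, forall x, D x -> (fun n => (EFin \o f_ n) x) @ \oo --> (EFin \o f) x}.
  by apply: aeW => x Dx; apply: cvg_EFin; [exact: nearW|exact: cf].
have b : {ae m, forall x n, D x -> (`|(EFin \o f_ n) x| <= (EFin \o g) x)%E}.
  by apply: aeW => x n Dx /=; rewrite lee_fin fg.
have [h1 h2] := dominated_convergence mD mE_ mE c ig b.
have -> : (\int[m]_(x in D) (EFin \o f) x = (Rintegral m D f)%:E)%E.
  by rewrite /Rintegral fineK//; exact: integrable_fin_num h1.
by move=> /fine_cvg.
Qed.

(** * Time integrals against an integrable weight *)

Section weighted.
Context (R : realType) d (T : measurableType d) (P : probability T R).
Notation leb := (@lebesgue_measure R).
Variables (phi : R -> R) (D : set R).
Hypotheses (mD : measurable D) (mphi : measurable_fun setT phi)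
  (phi0 : forall s, D s -> 0 <= phi s) (iphi : leb.-integrable D (EFin \o phi)).

Lemma wint_integrable (g : R -> R) (C : R) : measurable_fun setT g ->
  (forall s, D s -> `|g s| <= C) -> leb.-integrable D (EFin \o (fun s => phi s * g s)).
Proof.
move=> mg gC.
have iC : leb.-integrable D (fun s => (`|C|%:E * (EFin \o phi) s)%E) by exact: integrableZl.
apply: (le_integrable _ _ _ iC) => //.
  apply/measurable_EFinP; apply: measurable_funTS; exact: measurable_funM.
move=> s Ds /=; rewrite lee_fin normrM (ger0_norm (phi0 Ds)) normrM normr_id (ger0_norm (phi0 Ds)) mulrC.
by apply: ler_wpM2r; [exact: phi0|exact: le_trans (gC _ Ds) (ler_norm _)].
Qed.

Lemma wint_norm_le (g : R -> R) (C : R) : measurable_fun setT g ->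
  (forall s, D s -> `|g s| <= C) ->
  `|Rintegral leb D (fun s => phi s * g s)| <= C * Rintegral leb D phi.
Proof.
move=> mg gC; have ig := wint_integrable mg gC.
apply: (le_trans (le_normr_Rintegral _ ig)) => //.
rewrite -RintegralZl//; apply: le_Rintegral => //.
- exact: integrable_norm.
- have iC : leb.-integrable D (fun s => (C%:E * (EFin \o phi) s)%E) by exact: integrableZl.
  exact: iC.
by move=> s Ds; rewrite normrM (ger0_norm (phi0 Ds)) mulrC; apply: ler_wpM2r; [exact: phi0|exact: gC].
Qed.

Lemma wint_cvg (g_ : nat -> R -> R) (g : R -> R) (C : R) : (forall n, measurable_fun setT (g_ n)) ->
  measurable_fun setT g -> (forall n s, D s -> `|g_ n s| <= C) ->
  (forall s, D s -> g_ n s @[n --> \oo] --> g s) ->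
  Rintegral leb D (fun s => phi s * g_ n s) @[n --> \oo] --> Rintegral leb D (fun s => phi s * g s).
Proof.
move=> mg_ mg gC cg.
have iC : leb.-integrable D (fun s => (C%:E * (EFin \o phi) s)%E) by exact: integrableZl.
have m1 n : measurable_fun D (fun s : R => phi s * g_ n s).
  by apply: measurable_funTS; exact: measurable_funM.
have m2 : measurable_fun D (fun s : R => phi s * g s).
  by apply: measurable_funTS; exact: measurable_funM.
apply: (@dominated_cvg_Rintegral _ _ _ leb D _ _ (fun s => C * phi s) mD m1 m2 iC).
- move=> n s Ds; rewrite normrM (ger0_norm (phi0 Ds)) mulrC.
  by apply: ler_wpM2r; [exact: phi0|exact: gC].
- by move=> s Ds; apply: cvgMr; exact: cg.
Qed.

Lemma wint_meas (k : R * T -> R) : measurable_fun setT k ->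
  measurable_fun setT (fun w => Rintegral leb D (fun s => phi s * k (s, w))).
Proof.
move=> mh; apply: (@measurable_Rint _ _ _ D (fun p : R * T => phi p.1 * k p)) => //.
by apply: measurable_funM => //; apply: measurableT_comp.
Qed.

Lemma wint_Ex_cvg (k_ : nat -> R * T -> R) (k : R * T -> R) (C : R) :
  (forall n, measurable_fun setT (k_ n)) -> measurable_fun setT k ->
  (forall n s w, D s -> `|k_ n (s, w)| <= C) ->
  (forall s w, D s -> k_ n (s, w) @[n --> \oo] --> k (s, w)) ->
  Ex P (fun w => Rintegral leb D (fun s => phi s * k_ n (s, w))) @[n --> \oo] -->
  Ex P (fun w => Rintegral leb D (fun s => phi s * k (s, w))).
Proof.
move=> mk_ mk kC ck.
apply: (@bounded_cvg_Ex _ _ _ P (fun n w => Rintegral leb D (fun s => phi s * k_ n (s, w)))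
  (fun w => Rintegral leb D (fun s => phi s * k (s, w))) (C * Rintegral leb D phi)).
- by move=> n; exact: wint_meas.
- exact: wint_meas.
- move=> n w; apply: wint_norm_le; first exact: (measurable_section1 w (mk_ n)).
  by move=> s Ds; exact: kC.
- move=> w; apply: (@wint_cvg (fun n s => k_ n (s, w)) (fun s => k (s, w)) C).
  + by move=> n; exact: (measurable_section1 w (mk_ n)).
  + exact: (measurable_section1 w mk).
  + by move=> n s Ds; exact: kC.
  + by move=> s Ds; exact: ck.
Qed.

Lemma wint_rint (k : R * T -> R) (C : R) : measurable_fun setT k ->
  (forall s w, D s -> `|k (s, w)| <= C) ->
  rint P (fun w => Rintegral leb D (fun s => phi s * k (s, w))).
Proof.
move=> mk kC; apply: (@rint_bnd _ _ _ P _ (C * Rintegral leb D phi)); first exact: wint_meas.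
move=> w; apply: wint_norm_le; first exact: (measurable_section1 w mk).
by move=> s Ds; exact: kC.
Qed.

Lemma wint_ExZ (c : R) (k : R * T -> R) (C : R) : measurable_fun setT k ->
  (forall s w, D s -> `|k (s, w)| <= C) ->
  Ex P (fun w => Rintegral leb D (fun s => phi s * (c * k (s, w)))) =
  c * Ex P (fun w => Rintegral leb D (fun s => phi s * k (s, w))).
Proof.
move=> mk kC; rewrite -(ExZ _ (wint_rint mk kC)); apply: eq_Ex => w.
under eq_Rintegral do rewrite mulrCA.
apply: RintegralZl => //; apply: wint_integrable; first exact: (measurable_section1 w mk).
by move=> s Ds; exact: kC.
Qed.

Lemma wint_Ex_le (k k' : R * T -> R) (C C' : R) : measurable_fun setT k -> measurable_fun setT k' ->
  (forall s w, D s -> `|k (s, w)| <= C) -> (forall s w, D s -> `|k' (s, w)| <= C') ->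
  (forall s w, D s -> k (s, w) <= k' (s, w)) ->
  Ex P (fun w => Rintegral leb D (fun s => phi s * k (s, w))) <=
  Ex P (fun w => Rintegral leb D (fun s => phi s * k' (s, w))).
Proof.
move=> mk mk' kC kC' kk'; apply: le_Ex; [exact: (wint_rint mk kC)|exact: (wint_rint mk' kC')|move=> w].
apply: le_Rintegral => //.
- apply: wint_integrable; first exact: (measurable_section1 w mk).
  by move=> s Ds; exact: kC.
- apply: wint_integrable; first exact: (measurable_section1 w mk').
  by move=> s Ds; exact: kC'.
- by move=> s Ds; apply: ler_wpM2l; [exact: phi0|exact: kk'].
Qed.

End weighted.

Lemma wint_head_le (R : realType) (phi g : R -> R) (C m : R) : 0 <= m ->
  measurable_fun setT phi -> (forall s, 0 <= s -> 0 <= phi s) ->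
  (@lebesgue_measure R).-integrable `[0, +oo[ (EFin \o phi) ->
  measurable_fun setT g -> (forall s, 0 <= s -> `|g s| <= C) ->
  Rintegral lebesgue_measure `[0, m[ (fun s => phi s * g s) <=
  Rintegral lebesgue_measure `[0, +oo[ (fun s => phi s * g s) + C * Rintegral lebesgue_measure `[m, +oo[ phi.
Proof.
move=> m0 mphi phi0 iphi mg gC.
have p0 s : `[0, +oo[%classic s -> 0 <= phi s by rewrite /= in_itv/= andbT; exact: phi0.
have gC0 s : `[0, +oo[%classic s -> `|g s| <= C by rewrite /= in_itv/= andbT; exact: gC.
have pm s : `[m, +oo[%classic s -> 0 <= phi s.
  by rewrite /= in_itv/= andbT => ms; apply: phi0; exact: le_trans ms.
have gCm s : `[m, +oo[%classic s -> `|g s| <= C.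
  by rewrite /= in_itv/= andbT => ms; apply: gC; exact: le_trans ms.
have ipm : (@lebesgue_measure R).-integrable `[m, +oo[ (EFin \o phi).
  apply: integrableS iphi => //; apply: subset_itvr; by rewrite bnd_simp.
have ig := wint_integrable (measurable_itv _) mphi p0 iphi mg gC0.
have E : `[0, +oo[%classic = `[0, m[%classic `|` `[m, +oo[%classic.
  by rewrite -itv_bndbnd_setU// bnd_simp.
rewrite E Rintegral_setU// -?E//; last first.
  apply/disj_setPS => s [/=]; rewrite !in_itv/= andbT => /andP[_ h1] h2.
  by have := lt_le_trans h1 h2; rewrite ltxx.
have := wint_norm_le (measurable_itv _) mphi pm ipm mg gCm.
move=> /ler_normlP[h _]; lra.
Qed.

Section discount_integral.
Context (R : realType) (r : R).
Hypothesis r0 : 0 < r.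
Notation leb := (@lebesgue_measure R).
Let phi (s : R) : R := expR (- (r * s)).

Let F (s : R) : R := - r^-1 * expR (- (r * s)).

Let dF (s : R) : is_derive s 1 F (phi s).
Proof.
have h : is_derive s 1 (fun s => - (r * s)) (- r).
  have -> : (fun s => - (r * s)) = (- r) \*: (id : R -> R) by apply/funext => x; rewrite /= scaleNr.
  by apply: is_derive_eq; rewrite /GRing.scale /= mulr1.
have h2 := @is_derive1_comp R expR (fun s => - (r * s)) s _ _ (is_derive_expR _) h.
have -> : F = (- r^-1) \*: (expR \o (fun s => - (r * s))) by [].
apply: is_derive_eq; rewrite /GRing.scale /= /phi; field.
by rewrite gt_eqF.
Qed.

Lemma cvg_discount : expR (- (r * s)) @[s --> +oo] --> (0 : R).
Proof.
apply: (@cvg_comp _ _ _ (fun s => r * s) (fun x => expR (- x)) _ (@pinfty_nbhs R)); last exact: cvgr_expR.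
by apply: gt0_cvgMry => //; exact: cvg_id.
Qed.

Let FTC m : (\int[leb]_(s in `[m, +oo[) (phi s)%:E = (expR (- (r * m)) / r)%:E)%E.
Proof.
rewrite (@ge0_continuous_FTC2y _ phi F m 0).
- by rewrite -EFinB sub0r /F mulNr opprK mulrC.
- by move=> x _; exact: expR_ge0.
- apply: continuous_subspaceT => x.
  apply: (@continuous_comp _ _ _ (fun s => - (r * s)) expR); last exact: continuous_expR.
  by apply: cvgN; apply: cvgMr; exact: cvg_id.
- rewrite -(mulr0 (- r^-1)); apply: cvgMr; exact: cvg_discount.
- by move=> x _; case: (dF x).
- apply: cvg_at_right_filter; apply: differentiable_continuous; apply/derivable1_diffP.
  by case: (dF m).
- by move=> x _; rewrite derive1E; have := dF x; move=> h; apply: derive_val.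
Qed.

Lemma discount_integrable m : leb.-integrable `[m, +oo[ (EFin \o (fun s => expR (- (r * s)))).
Proof.
apply/integrableP; split.
  by apply/measurable_EFinP; apply: measurable_funTS; exact: discount_meas.
under eq_integral do rewrite /= ger0_norm ?expR_ge0//.
by rewrite FTC ltry.
Qed.

Lemma discount_integral m : Rintegral leb `[m, +oo[ (fun s => expR (- (r * s))) = expR (- (r * m)) / r.
Proof. by rewrite /Rintegral FTC. Qed.

End discount_integral.

Lemma dynkin_combine (R : realDomainType) (a b c x y u v w j : R) :
  - a <= b -> b <= x + y + u + v -> y <= j + c -> u <= w -> - (a + c) <= x + j + w + v.
Proof. lra. Qed.

Lemma affine_cvg (R : realType) (a b c e e' x : R) (x_ y_ y'_ : nat -> R) :
  x_ n @[n --> \oo] --> x -> y_ n @[n --> \oo] --> 0 -> y'_ n @[n --> \oo] --> 0 ->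
  a + x_ n + b + c * (e * y_ n + e' * y'_ n) @[n --> \oo] --> a + x + b.
Proof.
move=> hx hy hy'.
rewrite -[a + x + b]addr0 -[X in _ + _ + _ + X](mulr0 c) -[X in _ + c * X](addr0 0).
rewrite -[X in c * (X + _)](mulr0 e) -[X in c * (_ + X)](mulr0 e').
apply: cvgD.
  by apply: cvgD; [apply: cvgD => //; exact: cvg_cst|exact: cvg_cst].
by apply: cvgMr; apply: cvgD; apply: cvgMr.
Qed.

(** * Dynkin inequality in continuous time *)

Section dynkin.
Context (R : realType) d (T : measurableType d) (P : probability T R)
  (F : R -> set (set T)) (W U : R -> T -> R) (mu sigma u0 z r : R).
Hypotheses (hF : filtration F) (hW : std_brownian P F W) (hU : admissible F u0 U).
Hypotheses (sigma0 : 0 < sigma) (u00 : 0 < u0) (z0 : 0 <= z) (r0 : 0 < r).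
Notation leb := (@lebesgue_measure R).

(* Negative times are clipped, so that joint measurability holds on all of R * T. *)
Definition Dlim (p : R * T) : R := Dproc mu sigma W U z (Num.max p.1 0) p.2.

(** The supremum over an uncountable set of times is reached as a pointwise limit of step processes,
    which are jointly measurable by construction. *)
Lemma Dlim_meas : measurable_fun setT Dlim.
Proof.
have mk : measurable_fun setT (fun p : R * T => (Num.max p.1 0, p.2)).
  apply: measurable_fun_pair => //; apply: measurable_maxr => //.
have h1 n : measurable_fun setT (fun p : R * T => Dstep W U mu sigma z n (Num.max p.1 0) p.2).
  exact: (measurableT_comp (Dstep_meas mu sigma z hF hW hU n) mk).
have h2 (p : R * T) : setT p -> Dstep W U mu sigma z n (Num.max p.1 0) p.2 @[n --> \oo] --> Dlim p.
  have h3 : 0 <= Num.max p.1 0 by rewrite le_max lexx orbT.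
  by move=> _; exact: (@Dstep_cvg _ _ _ _ _ _ _ mu sigma _ _ hW hU z0 p.2 _ h3).
exact: (measurable_fun_cvg h1 h2).
Qed.

Lemma DlimE s w : 0 <= s -> Dlim (s, w) = Dproc mu sigma W U z s w.
Proof. by move=> s0; rewrite /Dlim /= max_l. Qed.

Variables (B L : R) (f f1 f2 : R -> R).
Hypothesis fT : taylor2 B L f f1 f2.
Hypothesis f10 : f1 0 <= 0.
Notation G := (gen mu sigma r f f1 f2).
Notation BG := (gen_bnd mu sigma u0 r B).

Let J_ n := Ex P (fun w => Rintegral leb `[0, +oo[ (fun s => expR (- (r * s)) * G (Dstep W U mu sigma z n s w) (U s w))).

Let J := Ex P (fun w => Rintegral leb `[0, +oo[ (fun s => expR (- (r * s)) * G (Dlim (s, w)) (U s w))).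

Let phi0 (s : R) : `[0, +oo[%classic s -> 0 <= expR (- (r * s)).
Proof. by move=> _; exact: expR_ge0. Qed.

Let kn n (p : R * T) := G (Dstep W U mu sigma z n p.1 p.2) (U p.1 p.2).
Let k (p : R * T) := G (Dlim p) (U p.1 p.2).

Let mkn n : measurable_fun setT (kn n).
Proof.
have [_ _ mU] := hU.
exact: (measurable_gen mu sigma r fT (Dstep_meas mu sigma z hF hW hU n) mU).
Qed.

Let mk : measurable_fun setT k.
Proof. by have [_ _ mU] := hU; exact: (measurable_gen mu sigma r fT Dlim_meas mU). Qed.

Let kn_bnd n s w : `[0, +oo[%classic s -> `|kn n (s, w)| <= BG.
Proof. by rewrite /= in_itv/= andbT => s0; apply: (gen_le mu sigma r0 fT); exact: (U_norm hU). Qed.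

Let kn_cvg s w : `[0, +oo[%classic s -> kn n (s, w) @[n --> \oo] --> k (s, w).
Proof.
rewrite /= in_itv/= andbT => s0; rewrite /k /kn /=.
have [_ [l0 l1 l2] _] := fT.
have cD := @Dstep_cvg _ _ _ _ _ _ _ mu sigma _ _ hW hU z0 w s s0.
rewrite -(DlimE _ s0) in cD.
have lc (g : R -> R) : (forall x y, `|g x - g y| <= L * `|x - y|) ->
    g (Dstep W U mu sigma z n s w) @[n --> \oo] --> g (Dlim (s, w)).
  by move=> lg; apply: (cvg_comp _ g cD); exact: (@lipschitz_continuous _ _ _ lg (Dlim (s, w))).
rewrite /gen; apply: cvgD; last by apply: cvgMr; exact: lc.
apply: cvgD; last by apply: cvgMl; exact: lc.
by apply: cvgB; apply: cvgMr; exact: lc.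
Qed.

Lemma J_cvg : J_ n @[n --> \oo] --> J.
Proof.
exact: (wint_Ex_cvg (measurable_itv `[0, +oo[) (discount_meas r) phi0 (@discount_integrable R r r0 0) mkn mk kn_bnd kn_cvg).
Qed.

Let q n := Num.sqrt (mesh R n).

Let q_cvg : q n @[n --> \oo] --> 0.
Proof.
rewrite -(@sqrtr0 R).
exact: (cvg_comp (mesh R) (@Num.sqrt R) (@mesh_cvg0 R) (@sqrt_continuous R 0)).
Qed.

Let dynkin_mesh (eta : R) (m n : nat) : 0 < eta ->
  - ((B + BG / r) * expR (- (r * m%:R))) <=
  f z + J_ n + (L + B) * eta * Kov mu sigma u0 z m%:R
  + m%:R * (5 * Kerr B L (`|mu| + u0) sigma eta * q n + cdisc mu sigma u0 r B * mesh R n).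
Proof.
move=> eta0.
have [[b0 _ _] [l0 _ _] _] := fT.
have B0 := taylor2_B0 fT; have L0 := taylor2_L0 fT.
(* With mesh 1 / (n + 1) this number of steps ends exactly at the horizon m, and errors of order
   mesh^{3/2} per step add up to order m mesh^{1/2}. *)
pose N := (m * n.+1)%N.
have nn : n.+1%:R * mesh R n = 1 by rewrite /mesh mulfV// pnatr_eq0.
have gN : grid R n N = m%:R by rewrite /grid /N natrM -mulrA nn mulr1.
have D := discrete_dynkin mu hF hW hU sigma0 u00 z0 r0 fT n f10 N eta0.
have q2 : q n ^+ 2 = mesh R n by rewrite sqr_sqrtr// ltW// mesh_gt0.
have e1 : N%:R * (5 * Kerr B L (`|mu| + u0) sigma eta * Num.sqrt (mesh R n) ^+ 3 + cdisc mu sigma u0 r B * mesh R n ^+ 2)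
  = m%:R * (5 * Kerr B L (`|mu| + u0) sigma eta * q n + cdisc mu sigma u0 r B * mesh R n).
  rewrite -/(q n) (_ : q n ^+ 3 = mesh R n * q n); last by rewrite -q2; ring.
  rewrite /N natrM.
  transitivity (m%:R * (n.+1%:R * mesh R n) * (5 * Kerr B L (`|mu| + u0) sigma eta * q n + cdisc mu sigma u0 r B * mesh R n)); first by ring.
  by rewrite nn mulr1.
rewrite gN e1 in D.
have e2 : \sum_(j < N) Ex P (overshoot W U mu sigma z n j) <= Kov mu sigma u0 z m%:R.
  by apply: (overshoot_sum_le mu hF hW hU sigma0 u00 z0); rewrite gN.
have e3 : (L + B) * eta * \sum_(j < N) Ex P (overshoot W U mu sigma z n j) <= (L + B) * eta * Kov mu sigma u0 z m%:R.
  by apply: ler_wpM2l e2; apply: mulr_ge0 (ltW eta0); exact: addr_ge0.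
have e4 : - (B * expR (- (r * m%:R))) <= expR (- (r * m%:R)) * Ex P (fun w => f (Dg W U mu sigma z n N w)).
  rewrite mulrC -mulrN; apply: ler_wpM2l; first exact: expR_ge0.
  rewrite -[leLHS](Ex_cst P); apply: le_Ex; first exact: rint_cst.
    apply: (@rint_bnd _ _ _ P _ B) => //.
    exact: (measurableT_comp (lipschitz_measurable l0) (Dg_meas mu sigma z hF hW hU n N)).
  by move=> w; have /ler_normlP[h _] := b0 (Dg W U mu sigma z n N w); lra.
have e5 : Ex P (fun w => Rintegral leb `[0, m%:R[ (fun s => kern W U mu sigma z r f f1 f2 n (s, w))) <=
   J_ n + BG * (expR (- (r * m%:R)) / r).
  have rJ : rint P (fun w => Rintegral leb `[0, +oo[ (fun s => expR (- (r * s)) * kn n (s, w))).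
    exact: (wint_rint P (measurable_itv `[0, +oo[) (discount_meas r) phi0 (@discount_integrable R r r0 0) (mkn n) (@kn_bnd n)).
  rewrite -[X in _ + X](Ex_cst P) -ExD//; last exact: rint_cst.
  apply: le_Ex.
  - apply: (@rint_bnd _ _ _ P _ (BG * fine (leb `[0, m%:R[%classic))).
      exact: (measurable_Rint _ (kern_meas mu sigma z r hF hW hU fT n)).
    move=> w; apply: norm_Rint_le => //; first exact: leb_coy.
      by apply: measurable_funTS; exact: (measurable_section1 w (kern_meas mu sigma z r hF hW hU fT n)).
    by move=> s /=; rewrite in_itv/= => /andP[s0 _]; exact: (kern_bnd W mu sigma z hU r0 fT n w s0).
  - by apply: rintD => //; exact: rint_cst.
  move=> w; rewrite -(discount_integral r0).
  apply: (@wint_head_le R (fun s => expR (- (r * s))) (fun s => kn n (s, w)) BG m%:R) => //.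
  - exact: discount_meas.
  - exact: discount_integrable.
  - exact: (measurable_section1 w (mkn n)).
  - by move=> s s0; apply: kn_bnd; rewrite /= in_itv/= s0.
have -> : (B + BG / r) * expR (- (r * m%:R)) = B * expR (- (r * m%:R)) + BG * (expR (- (r * m%:R)) / r) by ring.
exact: (dynkin_combine e4 D e5 e3).
Qed.

Let dynkin_eta (eta : R) (m : nat) : 0 < eta ->
  - ((B + BG / r) * expR (- (r * m%:R))) <= f z + J + (L + B) * eta * Kov mu sigma u0 z m%:R.
Proof.
move=> eta0.
have c := @affine_cvg R (f z) ((L + B) * eta * Kov mu sigma u0 z m%:R) m%:R
  (5 * Kerr B L (`|mu| + u0) sigma eta) (cdisc mu sigma u0 r B) _ _ _ _ J_cvg q_cvg (@mesh_cvg0 R).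
by apply: (cvgr_to_ge c); near=> n; exact: dynkin_mesh.
Unshelve. all: by end_near. Qed.

(** The order of the limits is forced. The mesh goes to 0 at fixed eta, since [Kerr] contains 1 /
    eta; then eta goes to 0 at a fixed horizon m, since [Kov] grows with m; the horizon goes last,
    when the discount removes the boundary and tail terms. *)
Theorem dynkin_ge0 : 0 <= f z + J.
Proof.
have B0 := taylor2_B0 fT; have L0 := taylor2_L0 fT.
have LB : 0 <= L + B by exact: addr_ge0.
have h m : - ((B + BG / r) * expR (- (r * m%:R))) <= f z + J.
  apply/ler_addgt0Pr => e e0.
  set K := Kov mu sigma u0 z m%:R.
  have k1 : 0 < (L + B) * `|K| + 1 by rewrite ltr_wpDl// mulr_ge0.
  have eta0 : 0 < e / ((L + B) * `|K| + 1) by exact: divr_gt0.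
  apply: (le_trans (dynkin_eta m eta0)); rewrite lerD2l -/K.
  apply: (@le_trans _ _ ((L + B) * `|K| * (e / ((L + B) * `|K| + 1)))).
    rewrite mulrAC; apply: ler_wpM2r; first exact: ltW.
    by apply: ler_wpM2l => //; exact: ler_norm.
  by rewrite mulrA ler_pdivrMr// mulrC ler_pM2l// lerDl.
have c : - ((B + BG / r) * expR (- (r * m%:R))) @[m --> \oo] --> - ((B + BG / r) * 0).
  apply: cvgN; apply: cvgMr.
  apply: (@cvg_comp _ _ _ (fun m : nat => m%:R) (fun s => expR (- (r * s))) _ (@pinfty_nbhs R)); last exact: (cvg_discount r0).
  exact: cvgr_idn.
rewrite mulr0 oppr0 in c.
by apply: (cvgr_to_le c); near=> m; exact: h.
Unshelve. all: by end_near. Qed.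

End dynkin.

(** * Smoothing the jump of the second derivative *)

Section mean_value.
Context (R : realType).
Variable d : R.

Let mvt_smooth (q dq : R -> R) (K x y : R) : {within `[0, +oo[, continuous q} ->
  (forall z : R, 0 < z -> z != d -> is_derive z 1 q (dq z)) -> 0 <= x -> x <= y ->
  (forall z, x < z -> z < y -> z != d) ->
  (forall z, x < z -> z < y -> `|dq z| <= K) -> `|q y - q x| <= K * (y - x).
Proof.
move=> cq dqE x0; rewrite le_eqVlt => /predU1P[->|xy] hd hK.
  by rewrite !subrr normr0 mulr0.
have dE z : z \in `]x, y[ -> is_derive z 1 q (dq z).
  rewrite in_itv/= => /andP[xz zy]; apply: dqE; last exact: hd.
  exact: le_lt_trans xz.
have cxy : {within `[x, y], continuous q}.
  apply: continuous_subspaceW cq => z /=; rewrite !in_itv/= andbT => /andP[xz _].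
  exact: le_trans xz.
have [c] := MVT xy dE cxy; rewrite in_itv/= => /andP[xc cy] ->.
have yx0 : 0 <= y - x by rewrite subr_ge0 ltW.
by rewrite normrM (ger0_norm yx0) ler_wpM2r// hK.
Qed.

(** [q] may fail to be differentiable at [d], as a first derivative does when the second one jumps;
    the interval is then split there. The two conditions on [z] say that it lies between [x] and [y]
    without fixing their order. *)
Lemma mvt_bound (q dq : R -> R) (K x y : R) : {within `[0, +oo[, continuous q} ->
  (forall z : R, 0 < z -> z != d -> is_derive z 1 q (dq z)) -> 0 <= x -> 0 <= y ->
  (forall z, 0 < z -> `|z - x| <= `|y - x| -> `|z - y| <= `|y - x| -> `|dq z| <= K) -> `|q y - q x| <= K * `|y - x|.
Proof.
move=> cq dqE.
have main a b : 0 <= a -> a <= b -> (forall z, a < z -> z < b -> `|dq z| <= K) -> `|q b - q a| <= K * (b - a).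
  move=> a0 ab hK.
  have [/andP[ad db]|nd] := boolP (a < d < b); last first.
    apply: (mvt_smooth cq dqE a0 ab _ hK) => z az zb.
    by apply: contra nd => /eqP <-; rewrite az.
  have d0 : 0 <= d by exact: le_trans (ltW ad).
  have h1 : `|q d - q a| <= K * (d - a).
    apply: (mvt_smooth cq dqE a0 (ltW ad)) => z az zd; first by rewrite lt_eqF.
    by apply: hK => //; exact: lt_trans db.
  have h2 : `|q b - q d| <= K * (b - d).
    apply: (mvt_smooth cq dqE d0 (ltW db)) => z az zd; first by rewrite gt_eqF.
    by apply: hK => //; exact: lt_trans az.
  have -> : q b - q a = (q b - q d) + (q d - q a) by ring.
  rewrite (_ : K * (b - a) = K * (b - d) + K * (d - a)); last by ring.
  by apply: (le_trans (ler_normD _ _)); exact: lerD.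
move=> x0 y0 hK; case: (leP x y) => xy.
  have yx0 : 0 <= y - x by rewrite subr_ge0.
  rewrite (ger0_norm yx0); apply: main => // z xz zy.
  apply: hK; first exact: le_lt_trans xz.
    by rewrite !ger0_norm ?subr_ge0 ?(ltW xz)// lerD2r ltW.
  by rewrite distrC !ger0_norm ?subr_ge0 ?(ltW zy)// lerD2l lerN2 ltW.
have xy0 : 0 <= x - y by rewrite subr_ge0 ltW.
rewrite distrC (distrC y) (ger0_norm xy0); apply: main => //; first exact: ltW.
move=> z yz zx; apply: hK; first exact: le_lt_trans yz.
  by rewrite !ler0_norm ?subr_le0 ?(ltW xy) ?(ltW zx)// !opprB lerD2l lerN2 ltW.
by rewrite (distrC y) !ger0_norm ?subr_ge0 ?(ltW yz) ?(ltW xy)// lerD2r ltW.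
Qed.

Lemma taylor1_of_lipschitz (f1 f2 : R -> R) (L x y : R) : {within `[0, +oo[, continuous f1} ->
  (forall z : R, 0 < z -> z != d -> is_derive z 1 f1 (f2 z)) ->
  (forall z, 0 <= z -> `|f2 z - f2 x| <= L * `|z - x|) -> 0 <= L -> 0 <= x -> 0 <= y ->
  `|f1 y - f1 x - f2 x * (y - x)| <= L * `|y - x| ^+ 2.
Proof.
move=> c1 d1 l2 L0 x0 y0.
pose q t := f1 t - f2 x * t.
have -> : f1 y - f1 x - f2 x * (y - x) = q y - q x by rewrite /q; ring.
rewrite [_ ^+ 2]expr2 mulrA.
apply: (@mvt_bound q (fun t => f2 t - f2 x)) => //.
- apply: within_continuousB => //; apply: continuous_subspaceT => t.
  by apply: cvgMr; exact: cvg_id.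
- move=> z z0 zd; have h := d1 z z0 zd.
  have -> : q = f1 - f2 x \*: (id : R -> R) by [].
  by apply: is_derive_eq; rewrite /GRing.scale /= mulr1.
- move=> z z0 zx _; apply: (le_trans (l2 _ (ltW z0))); exact: ler_wpM2l.
Qed.

(** The mean value inequality is applied to [f] minus its quadratic expansion at [x], whose
    derivative is the remainder bounded in [taylor1_of_lipschitz]. The price is the loss of the
    factorial denominators. *)
Lemma taylor2_of_lipschitz (f f1 f2 : R -> R) (L x y : R) : {within `[0, +oo[, continuous f} ->
  {within `[0, +oo[, continuous f1} ->
  (forall z : R, 0 < z -> z != d -> is_derive z 1 f (f1 z)) ->
  (forall z : R, 0 < z -> z != d -> is_derive z 1 f1 (f2 z)) ->
  (forall z, 0 <= z -> `|f2 z - f2 x| <= L * `|z - x|) -> 0 <= L -> 0 <= x -> 0 <= y ->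
  `|f y - f x - f1 x * (y - x) - f2 x * (y - x) ^+ 2 / 2| <= L * `|y - x| ^+ 3.
Proof.
move=> c0 c1 d0 d1 l2 L0 x0 y0.
pose q t := f t - f1 x * t - f2 x * (t - x) ^+ 2 / 2.
have -> : f y - f x - f1 x * (y - x) - f2 x * (y - x) ^+ 2 / 2 = q y - q x by rewrite /q; ring.
rewrite [_ ^+ 3]exprSr mulrA.
apply: (@mvt_bound q (fun t => f1 t - f1 x - f2 x * (t - x))) => //.
- apply: within_continuousB; first apply: within_continuousB => //.
    by apply: continuous_subspaceT => t; apply: cvgMr; exact: cvg_id.
  apply: continuous_subspaceT => t; apply: cvgMl; apply: cvgMr.
  apply: (@continuous_comp _ _ _ (fun t => t - x) (fun t => t ^+ 2)); last exact: exprn_continuous.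
  by apply: cvgB; [exact: cvg_id|exact: cvg_cst].
- move=> z z0 zd; have h := d0 z z0 zd.
  have -> : q = f - f1 x \*: (id : R -> R) - (f2 x / 2) \*: ((id - cst x) ^+ 2 : R -> R).
    by apply/funext => t; rewrite /q !fctE /= /GRing.scale /=; ring.
  by apply: is_derive_eq; rewrite /GRing.scale /= expr1 !fctE /=; field.
- move=> z z0 zx _; apply: (le_trans (taylor1_of_lipschitz c1 d1 l2 L0 x0 (ltW z0))).
  by apply: ler_wpM2l => //; rewrite lerXn2r ?nnegrE.
Qed.

End mean_value.

(** * Explicit layer functions at the jump *)

Section cutoff.
Context (R : realType).
Variables (kap d N : R).
Hypotheses (kap0 : 0 <= kap) (N1 : 1 <= N).
Let N0 : 0 < N. Proof. exact: lt_le_trans N1. Qed.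

Let E z := expR (- (N * (z - d))).
(** The factor 1 - N (z - d) gives [S2] integral 0 over the half-line beyond [d]. Its antiderivative
    [S1] vanishing at [d] then also vanishes at infinity, and the next one, [S0], stays bounded. A
    plain exponential in [S2] would make the corresponding [S0] grow linearly. *)
Let S0 z := kap * (N ^- 2 - ((z - d) / N + N ^- 2) * E z).
Let S1 z := kap * ((z - d) * E z).
Let S2 z := kap * ((1 - N * (z - d)) * E z).

(* cut2 carries a jump of height kap at d: removing it from a function with that jump leaves
   kap * ramp, which is Lipschitz. *)
Definition cut0 z := if z <= d then 0 else S0 z.
Definition cut1 z := if z <= d then 0 else S1 z.
Definition cut2 z := if z <= d then 0 else S2 z.
Definition ramp z : R := if z <= d then 0 else 1 - (1 - N * (z - d)) * E z.

Let dE (z : R) : is_derive z 1 E (- N * E z).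
Proof.
have h : is_derive z 1 (fun z => - (N * (z - d))) (- N).
  have -> : (fun z => - (N * (z - d))) = (- N) \*: (id - cst d : R -> R).
    by apply/funext => t; rewrite !fctE /= /GRing.scale /=; ring.
  by apply: is_derive_eq; rewrite /GRing.scale /=; ring.
have h2 := @is_derive1_comp R expR (fun z => - (N * (z - d))) z _ _ (is_derive_expR _) h.
have -> : E = expR \o (fun z => - (N * (z - d))) by [].
by apply: is_derive_eq; rewrite mulrC.
Qed.

Let dS0 (z : R) : is_derive z 1 S0 (S1 z).
Proof.
have h := dE z.
have -> : S0 = kap \*: (cst (N ^- 2) - (N^-1 \*: (id - cst d : R -> R) + cst (N ^- 2)) * E).
  by apply/funext => t; rewrite /S0 !fctE /= /GRing.scale /=; ring.
apply: is_derive_eq; rewrite /S1 /GRing.scale /= ?fctE /= /GRing.scale /=; field.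
by rewrite gt_eqF.
Qed.

Let dS1 (z : R) : is_derive z 1 S1 (S2 z).
Proof.
have h := dE z.
have -> : S1 = kap \*: ((id - cst d : R -> R) * E).
  by apply/funext => t; rewrite /S1 !fctE /= /GRing.scale /=; ring.
apply: is_derive_eq; rewrite /S2 /GRing.scale /= ?fctE /= /GRing.scale /=; ring.
Qed.

Let glue (S dS : R -> R) : (forall z : R, is_derive z 1 S (dS z)) ->
  forall z : R, z != d -> is_derive z 1 (fun z => if z <= d then 0 else S z) (if z <= d then 0 else dS z).
Proof.
move=> hS z zd; case: (ltgtP z d) zd => //= h _.
- apply: (@near_eq_is_derive _ _ _ (cst 0)).
  near=> t; rewrite ifT//; apply: ltW; near: t; exact: lt_nbhsl.
- apply: (@near_eq_is_derive _ _ _ S).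
  near=> t; rewrite ifF//; apply/negbTE; rewrite -ltNge; near: t; exact: lt_nbhsr.
Unshelve. all: by end_near. Qed.

Lemma is_derive_cut0 z : z != d -> is_derive z 1 cut0 (cut1 z).
Proof. exact: glue dS0 z. Qed.

Lemma is_derive_cut1 z : z != d -> is_derive z 1 cut1 (cut2 z).
Proof. exact: glue dS1 z. Qed.

Let glueE (S : R -> R) : S d = 0 -> (fun z => if z <= d then 0 else S z) = S \o (fun z => Num.max z d).
Proof.
by move=> Sd; apply/funext => z /=; case: (leP z d) => h; rewrite ?Sd.
Qed.

Let glue_continuous (S dS : R -> R) : (forall z : R, is_derive z 1 S (dS z)) -> S d = 0 ->
  continuous (fun z => if z <= d then 0 else S z).
Proof.
move=> hS Sd; rewrite glueE// => z; apply: continuous_comp.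
  by apply: continuous_max; [exact: cvg_id|exact: cvg_cst].
by apply: differentiable_continuous; apply/derivable1_diffP; have := hS (Num.max z d); case.
Qed.

Let Ed : E d = 1. Proof. by rewrite /E subrr mulr0 oppr0 expR0. Qed.

Lemma cut0_continuous : continuous cut0.
Proof. by apply: (glue_continuous dS0); rewrite /S0 Ed subrr mul0r add0r mulr1 subrr mulr0. Qed.

Lemma cut1_continuous : continuous cut1.
Proof. by apply: (glue_continuous dS1); rewrite /S1 subrr mul0r mulr0. Qed.

Let E_ge0 z : 0 <= E z. Proof. exact: expR_ge0. Qed.

(** This is (1 + x) e^{-x} <= 1 with x = N (z - d). The bounds on [cut0], [cut1], [cut2] and on the
    slope of [ramp] reduce to it. *)
Let E_bnd z : (1 + N * (z - d)) * E z <= 1.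
Proof.
have h : 1 + N * (z - d) <= expR (N * (z - d)) by exact: expR_ge1Dx.
by have := ler_wpM2r (E_ge0 z) h; rewrite /E -expRD addrN expR0.
Qed.

Lemma cut0_bound z : 0 <= cut0 z <= kap / N ^+ 2.
Proof.
rewrite /cut0; case: (leP z d) => zd; first by rewrite lexx divr_ge0// ltW// exprn_gt0.
have N2 : 0 < N ^- 2 by rewrite invr_gt0 exprn_gt0.
have -> : S0 z = kap * (N ^- 2 * (1 - (1 + N * (z - d)) * E z)).
  by rewrite /S0; field; rewrite gt_eqF.
have h := E_bnd z; have h' : 0 <= (1 + N * (z - d)) * E z.
  by rewrite mulr_ge0// addr_ge0// mulr_ge0 ?subr_ge0// ltW.
move: h h'; move: (_ * E z) => e e1 e0.
rewrite mulr_ge0/= ?mulr_ge0 ?subr_ge0 ?(ltW N2)//.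
by rewrite ler_wpM2l// ler_piMr ?(ltW N2)// lerBlDr lerDl.
Qed.

Lemma cut1_bound z : 0 <= cut1 z <= kap / N.
Proof.
rewrite /cut1; case: (leP z d) => zd; first by rewrite lexx divr_ge0// ltW.
have zd0 : 0 <= z - d by rewrite subr_ge0 ltW.
rewrite /S1 !mulr_ge0//= ler_wpM2l// -[leRHS]mul1r ler_pdivlMr//.
apply: le_trans (E_bnd z); rewrite [leRHS](_ : _ = E z + (z - d) * E z * N); last by ring.
by rewrite lerDr.
Qed.

Lemma cut2_bound z : `|cut2 z| <= kap.
Proof.
rewrite /cut2; case: (leP z d) => zd; first by rewrite normr0.
have x0 : 0 <= N * (z - d) by rewrite mulr_ge0 ?subr_ge0 ?ltW.
have h := E_bnd z; have e0 := E_ge0 z; rewrite /S2 normrM (ger0_norm kap0) ler_piMr//.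
apply: le_trans h; rewrite normrM (ger0_norm e0) ler_wpM2r// ler_norml.
by move: x0; move: (N * _) => x x0; lra.
Qed.

Lemma cut2_decay z : d < z -> `|cut2 z| <= kap * 4 / (z - d) / N.
Proof.
move=> zd; rewrite /cut2 (lt_geF zd).
have zd0 : 0 < z - d by rewrite subr_gt0.
have x0 : 0 < N * (z - d) by rewrite mulr_gt0.
have -> : kap * 4 / (z - d) / N = kap * (4 / (N * (z - d))) by field; rewrite !gt_eqF.
rewrite /S2 normrM (ger0_norm kap0) ler_wpM2l// ler_pdivlMr// normrM (ger0_norm (E_ge0 z)).
(* The exponent is halved so that e^y >= 1 + y can be squared: with x = N (z - d) this gives (1 + x
   / 2)^2 e^{-x} <= 1, and |1 - x| x <= (2 + x)^2 produces the constant 4. *)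
have h : 1 + N * (z - d) / 2 <= expR (N * (z - d) / 2) by exact: expR_ge1Dx.
have EE : E z = expR (- (N * (z - d) / 2)) ^+ 2.
  by rewrite expr2 -expRD /E; congr expR; field.
have := ler_wpM2r (expR_ge0 (- (N * (z - d) / 2))) h.
rewrite -expRD addrN expR0 EE; have := expR_ge0 (- (N * (z - d) / 2)).
move: (expR _) => e; move: x0; move: (N * _) => x x0 e0 h1.
have h2 : (1 + x / 2) ^+ 2 * e ^+ 2 <= 1.
  by rewrite -exprMn exprn_ile1// mulr_ge0// addr_ge0// divr_ge0// ltW.
have h3 : `|1 - x| * x <= 4 * (1 + x / 2) ^+ 2.
  have : `|1 - x| <= 1 + x by rewrite ler_norml; lra.
  by move: (`|_|) => y hy; nra.
have := ler_wpM2r (exprn_ge0 2 e0) h3; move: (`|_|) => y; nra.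
Qed.

Lemma ramp_cut2 z : kap * ramp z = kap * (if d < z then 1 else 0) - cut2 z.
Proof. by rewrite /ramp /cut2 /S2; case: (leP z d) => zd; ring. Qed.

Lemma ramp_lipschitz x y : 0 <= x -> 0 <= y -> `|ramp y - ramp x| <= 2 * N * `|y - x|.
Proof.
move=> x0 y0.
pose S3 (z : R) : R := 1 - (1 - N * (z - d)) * E z.
pose dS3 (z : R) : R := N * (2 - N * (z - d)) * E z.
have dS (z : R) : is_derive z 1 S3 (dS3 z).
  have h := dE z.
  have -> : S3 = cst 1 - (cst 1 - N \*: (id - cst d : R -> R)) * E.
    by apply/funext => t; rewrite /S3 !fctE /= /GRing.scale /=; ring.
  by apply: is_derive_eq; rewrite /dS3 /GRing.scale /= ?fctE /= /GRing.scale /=; ring.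
apply: (@mvt_bound _ d ramp (fun z => if z <= d then 0 else dS3 z)) => //.
- apply: continuous_subspaceT; apply: (glue_continuous dS).
  by rewrite /S3 Ed subrr mulr0 subr0 mulr1 subrr.
- by move=> z _ zd; exact: (glue dS).
- move=> z _ _ _; case: (leP z d) => zd; first by rewrite normr0 mulr_ge0// ltW.
  have z0 : 0 <= N * (z - d) by rewrite mulr_ge0 ?subr_ge0 ?ltW.
  have h := E_bnd z; have e0 := E_ge0 z; rewrite /dS3 normrM normrM (gtr0_norm N0) (ger0_norm e0).
  rewrite -mulrA (mulrC 2) ler_wpM2l ?(ltW N0)//.
  move: h e0 z0; move: (E z) => e; move: (N * _) => t h e0 t0.
  have : `|2 - t| <= 2 + 2 * t by rewrite ler_norml; lra.
  by move: (`|_|) => u hu; nra.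
Qed.

End cutoff.

Lemma cvg_le_inv (R : realType) (C : R) (u : nat -> R) : (forall n, `|u n| <= C / n.+1%:R) ->
  u n @[n --> \oo] --> 0.
Proof.
move=> h; apply/norm_cvg0P.
have c : (fun n => C * harmonic n) @ \oo --> (0 : R).
  by rewrite -(mulr0 C); apply: cvgMr; exact: cvg_harmonic.
apply: (@squeeze_cvgr _ _ _ _ (cst 0) (fun n => C * harmonic n)) c => //; last exact: cvg_cst.
by apply: nearW => n; rewrite normr_ge0 h.
Qed.

Lemma taylor2_opp (R : realType) (B L : R) (f f1 f2 : R -> R) : taylor2 B L f f1 f2 ->
  taylor2 B L (fun x => - f x) (fun x => - f1 x) (fun x => - f2 x).
Proof.
move=> [[b0 b1 b2] [l0 l1 l2] T]; have oppB (a b : R) : `|- a - - b| = `|a - b| by rewrite -opprD normrN.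
split; [by split=> x; rewrite normrN|by split=> x y; rewrite oppB|move=> x y x0 y0].
apply: le_trans (T x y x0 y0); rewrite -normrN le_eqVlt; apply/orP; left; apply/eqP; congr `|_|; ring.
Qed.

(** The extension to R is by composition with the 1-Lipschitz map max(x, 0). [B] is a Lipschitz
    constant of [f] and [f1] and [L] one of [f2]; their sum covers all three and the expansion. *)
Lemma taylor2_halfline (R : realType) (d B L : R) (f f1 f2 : R -> R) : 0 <= L ->
  (forall x, 0 <= x -> [/\ `|f x| <= B, `|f1 x| <= B & `|f2 x| <= B]) ->
  {within `[0, +oo[, continuous f} -> {within `[0, +oo[, continuous f1} ->
  (forall z : R, 0 < z -> z != d -> is_derive z 1 f (f1 z)) ->
  (forall z : R, 0 < z -> z != d -> is_derive z 1 f1 (f2 z)) ->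
  (forall x y, 0 <= x -> 0 <= y -> `|f2 y - f2 x| <= L * `|y - x|) ->
  taylor2 B (B + L) (fun x => f (Num.max x 0)) (fun x => f1 (Num.max x 0)) (fun x => f2 (Num.max x 0)).
Proof.
move=> L0 bf cf cf1 df df1 l2.
have B0 : 0 <= B by have [h _ _] := bf 0 (lexx 0); exact: le_trans h.
have m0 (x : R) : 0 <= Num.max x 0 by rewrite le_max lexx orbT.
have m1 (x y : R) : `|Num.max x 0 - Num.max y 0| <= `|x - y|.
  have h := ler_norm (x - y); have h' := ler_norm (y - x); rewrite distrC in h'; rewrite ler_norml.
  by move: h h'; move: (`|_|) => a h h'; case: (leP x 0); case: (leP y 0) => y0 x0; lra.
have lip (g dg : R -> R) : {within `[0, +oo[, continuous g} ->
    (forall z : R, 0 < z -> z != d -> is_derive z 1 g (dg z)) ->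
    (forall x, 0 <= x -> `|dg x| <= B) -> forall x y, `|g (Num.max x 0) - g (Num.max y 0)| <= (B + L) * `|x - y|.
  move=> cg hg bg x y; apply: (@le_trans _ _ (B * `|Num.max x 0 - Num.max y 0|)).
    by apply: (mvt_bound cg hg) => // t t0 _ _; apply: bg; exact: ltW.
  by apply: ler_pM => //; rewrite lerDl.
split.
- by split=> x; have [] := bf _ (m0 x).
- split; [apply: (lip _ _ cf df)|apply: (lip _ _ cf1 df1)|]; try by move=> x x0; have [] := bf x x0.
  move=> x y; apply: (le_trans (l2 _ _ _ _)) => //.
  by apply: ler_pM => //; rewrite lerDr.
- move=> x y x0 y0; rewrite (max_l x0) (max_l y0).
  apply: (le_trans (taylor2_of_lipschitz cf cf1 df df1 (fun t t0 => l2 x t x0 t0) L0 x0 y0)).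
  by rewrite ler_wpM2r ?exprn_ge0// lerDr.
Qed.

(** * Passage to the limit in the test functions *)

Section generator_limit.
Context (R : realType) d (T : measurableType d) (P : probability T R)
  (F : R -> set (set T)) (W U : R -> T -> R) (mu sigma u0 z r : R).
Hypotheses (hF : filtration F) (hW : std_brownian P F W) (hU : admissible F u0 U).
Hypotheses (sigma0 : 0 < sigma) (u00 : 0 < u0) (z0 : 0 <= z) (r0 : 0 < r).
Variables (B : R) (L_ : nat -> R) (f_ f1_ f2_ : nat -> R -> R) (f f1 f2 : R -> R).
Hypothesis fT : forall n, taylor2 B (L_ n) (f_ n) (f1_ n) (f2_ n).
Hypothesis f_cvg : forall x, 0 <= x -> f_ n x @[n --> \oo] --> f x.
Hypothesis f1_cvg : forall x, 0 <= x -> f1_ n x @[n --> \oo] --> f1 x.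
Hypothesis f2_cvg : forall x, 0 <= x -> f2_ n x @[n --> \oo] --> f2 x.
Notation D := (Dlim W U mu sigma z).

Lemma Dlim_ge0 p : 0 <= D p.
Proof.
have h : 0 <= Num.max p.1 0 by rewrite le_max lexx orbT.
exact: (@Dproc_ge0 _ _ _ _ _ _ _ mu sigma _ _ hW hU p.2 _ h).
Qed.

Let gen_cvg p : gen mu sigma r (f_ n) (f1_ n) (f2_ n) (D p) (U p.1 p.2) @[n --> \oo] -->
  gen mu sigma r f f1 f2 (D p) (U p.1 p.2).
Proof.
have D0 := Dlim_ge0 p; rewrite /gen; apply: cvgD; last by apply: cvgMr; exact: f2_cvg.
apply: cvgD; last by apply: cvgMl; exact: f1_cvg.
by apply: cvgB; apply: cvgMr; [exact: f_cvg|exact: f1_cvg].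
Qed.

Let mgen n : measurable_fun setT (fun p => gen mu sigma r (f_ n) (f1_ n) (f2_ n) (D p) (U p.1 p.2)).
Proof.
have [_ _ mU] := hU.
exact: (measurable_gen mu sigma r (fT n) (Dlim_meas mu sigma hF hW hU z0) mU).
Qed.

Lemma measurable_gen_limit : measurable_fun setT (fun p => gen mu sigma r f f1 f2 (D p) (U p.1 p.2)).
Proof.
have h (p : R * T) : setT p -> gen mu sigma r (f_ n) (f1_ n) (f2_ n) (D p) (U p.1 p.2) @[n --> \oo] -->
    gen mu sigma r f f1 f2 (D p) (U p.1 p.2) by move=> _; exact: gen_cvg.
exact: (measurable_fun_cvg mgen h).
Qed.

Let gen_bound n s w : `[0, +oo[%classic s ->
  `|gen mu sigma r (f_ n) (f1_ n) (f2_ n) (D (s, w)) (U s w)| <= gen_bnd mu sigma u0 r B.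
Proof.
rewrite /= in_itv/= andbT => s0; apply: (gen_le mu sigma r0 (fT n)); exact: (U_norm hU).
Qed.

Lemma gen_limit_bound s w : 0 <= s ->
  `|gen mu sigma r f f1 f2 (D (s, w)) (U s w)| <= gen_bnd mu sigma u0 r B.
Proof.
move=> s0; apply: (cvgr_to_le (cvg_norm (@gen_cvg (s, w)))); near=> n.
by apply: gen_bound; rewrite /= in_itv/= andbT.
Unshelve. all: by end_near. Qed.

(** Only the bound [B] is uniform in n. The constants [L_ n] may diverge, because the conclusion of
    [dynkin_ge0] no longer contains them; this is what allows a discontinuous limit [f2]. *)
Lemma dynkin_limit_ge0 : (forall n, f1_ n 0 <= 0) -> 0 <= f z + Ex P (fun w =>
  Rintegral lebesgue_measure `[0, +oo[ (fun s => expR (- (r * s)) * gen mu sigma r f f1 f2 (D (s, w)) (U s w))).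
Proof.
move=> f10.
have phi0 (s : R) : `[0, +oo[%classic s -> 0 <= expR (- (r * s)) by move=> _; exact: expR_ge0.
have c := wint_Ex_cvg (P := P) (measurable_itv `[0, +oo[) (discount_meas r) phi0
  (@discount_integrable R r r0 0) mgen measurable_gen_limit gen_bound (fun s w _ => @gen_cvg (s, w)).
have c2 : f_ n z + Ex P (fun w => Rintegral lebesgue_measure `[0, +oo[ (fun s =>
    expR (- (r * s)) * gen mu sigma r (f_ n) (f1_ n) (f2_ n) (D (s, w)) (U s w))) @[n --> \oo] -->
  f z + Ex P (fun w => Rintegral lebesgue_measure `[0, +oo[ (fun s =>
    expR (- (r * s)) * gen mu sigma r f f1 f2 (D (s, w)) (U s w))).
  by apply: cvgD; [exact: f_cvg|exact: c].
by apply: (cvgr_to_ge c2); near=> n; exact: (dynkin_ge0 mu hF hW hU sigma0 u00 z0 r0 (fT n) (f10 n)).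
Unshelve. all: by end_near. Qed.

End generator_limit.

Lemma sup_scale_itv (R : realType) (b c : R) : 0 <= c ->
  sup [set b * u | u in `[0, c]] = c * Num.max b 0.
Proof.
move=> c0.
have ub : ubound [set b * u | u in `[0, c]] (c * Num.max b 0).
  move=> y [u /=]; rewrite in_itv/= => /andP[u0 uc] <-; case: (leP b 0) => b0; nra.
have ne (v : R) : 0 <= v <= c -> [set b * u | u in `[0, c]] (b * v).
  by move=> h; exists v => //=; rewrite in_itv.
apply/eqP; rewrite eq_le; apply/andP; split.
  by apply: ge_sup ub; exists (b * 0); apply: ne; rewrite lexx.
have hs : has_sup [set b * u | u in `[0, c]].
  by split; [by exists (b * 0); apply: ne; rewrite lexx|by exists (c * Num.max b 0)].
case: (leP b 0) => b0.
  have -> : c * 0 = b * 0 by rewrite !mulr0.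
  by apply: sup_upper_bound => //; apply: ne; rewrite lexx.
by rewrite mulrC; apply: sup_upper_bound => //; apply: ne; rewrite lexx c0.
Qed.

(** * Solutions of the HJB equation *)

Lemma right_deriv_cvg (R : realType) (f : R -> R) (l : R) : right_deriv f 0 l ->
  f x @[x --> 0^'+] --> f 0.
Proof.
move=> hf.
have c : f 0 + (f (0 + t) - f 0) / t * t @[t --> 0^'+] --> f 0 + l * 0.
  apply: cvgD; first exact: cvg_cst.
  by apply: cvgM => //; apply: cvg_at_right_filter; exact: cvg_id.
rewrite mulr0 addr0 in c; apply: cvg_trans c; apply: near_eq_cvg.
near=> t; have t0 : t != 0 by rewrite gt_eqF//; near: t; exact: nbhs_right_gt.
by rewrite add0r divfK// addrC subrK.
Unshelve. all: by end_near. Qed.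

(** Turns monotonicity of the solution into the boundary sign that [vU_le_hjb] asks for. *)
Lemma right_deriv_le0 (R : realType) (f : R -> R) (l : R) :
  (forall x y, 0 <= x -> x <= y -> f y <= f x) -> right_deriv f 0 l -> l <= 0.
Proof.
move=> fdec hf; apply: (cvgr_to_le hf); near=> t.
have t0 : 0 < t by near: t; exact: nbhs_right_gt.
by rewrite add0r ler_pdivrMr// mul0r subr_le0; apply: fdec => //; exact: ltW.
Unshelve. all: by end_near. Qed.

(* Around a maximum point of |f1| on a bounded interval, the mean value theorem gives a point at
   distance at most 1 / (2 K) where |f1| is at most 4 K H; between them f1 moves by at most
   half of 1 + max |f1|. *)
Lemma derivative_bounded (R : realType) (d H K : R) (f f1 f2 : R -> R) : 0 < K ->
  (forall x, 0 <= x -> `|f x| <= H) -> {within `[0, +oo[, continuous f} ->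
  {within `[0, +oo[, continuous f1} ->
  (forall z : R, 0 < z -> is_derive z 1 f (f1 z)) ->
  (forall z : R, 0 < z -> z != d -> is_derive z 1 f1 (f2 z)) ->
  (forall x, 0 <= x -> `|f2 x| <= K * (1 + `|f1 x|)) ->
  forall x, 0 <= x -> `|f1 x| <= 8 * K * H + 1.
Proof.
move=> K0 fH cf cf1 df df1 f2K x x0.
pose l := (2 * K)^-1; have l0 : 0 < l by rewrite invr_gt0 mulr_gt0.
(* The interval has length at least 2 l, so from a maximum point anywhere in it one can move by l
   and stay inside. *)
pose N := x + 2 * l; have N0 : 0 <= N by rewrite addr_ge0// mulr_ge0// ltW.
have cN : {within `[0, N], continuous (fun t => `|f1 t|)}.
  have c : {within `[0, N], continuous f1} by apply: continuous_subspaceW cf1; exact: subset_itvl.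
  by move=> t; apply: cvg_norm; exact: c.
have [a] := EVT_max N0 cN; rewrite in_itv/= => /andP[a0 aN] amax.
apply: (@le_trans _ _ `|f1 a|).
  by apply: amax; rewrite in_itv/= x0 lerDl mulr_ge0// ltW.
set M := `|f1 a| in amax *.
have [b [b0 bN ab]] : exists b, [/\ 0 <= b, b <= N & `|a - b| = l].
  case: (leP a l) => al.
    exists (a + l); split; first by rewrite addr_ge0// ltW.
      by rewrite /N; lra.
    by rewrite opprD addrA subrr add0r normrN gtr0_norm.
  exists (a - l); split; first by rewrite subr_ge0 ltW.
    by lra.
  by rewrite opprB addrC subrK gtr0_norm.
have [c [c0 cN' cl ca]] : exists c, [/\ 0 <= c, c <= N, `|f1 c| * l <= 2 * H & `|a - c| <= l].
  have mv p q : 0 <= p -> p < q -> exists2 c, p < c < q & f q - f p = f1 c * (q - p).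
    move=> p0 pq.
    have dE z : z \in `]p, q[ -> is_derive z 1 f (f1 z).
      by rewrite in_itv/= => /andP[pz _]; apply: df; exact: le_lt_trans pz.
    have cpq : {within `[p, q], continuous f}.
      apply: continuous_subspaceW cf => t /=; rewrite !in_itv/= andbT => /andP[pt _].
      exact: le_trans pt.
    by have [c] := MVT pq dE cpq; rewrite in_itv/= => h ->; exists c.
  have fin c p q : 0 <= p -> 0 <= q -> `|q - p| = l -> f q - f p = f1 c * (q - p) -> `|f1 c| * l <= 2 * H.
    move=> p0 q0 <- e; rewrite -normrM -e; apply: (le_trans (ler_normB _ _)).
    by have := fH _ p0; have := fH _ q0; lra.
  case: (ltgtP a b) ab => [ab|ba|<-] abl.
  - have [c /andP[ac cb] e] := mv _ _ a0 ab; exists c; split.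
    + exact: ltW (le_lt_trans a0 ac).
    + exact: le_trans (ltW cb) bN.
    + by apply: (fin _ _ _ a0 b0 _ e); rewrite distrC.
    + by rewrite -abl !ltr0_norm ?subr_lt0//; lra.
  - have [c /andP[bc ca] e] := mv _ _ b0 ba; exists c; split.
    + exact: ltW (le_lt_trans b0 bc).
    + exact: le_trans (ltW ca) aN.
    + exact: (fin _ _ _ b0 a0 abl e).
    + by rewrite -abl !gtr0_norm ?subr_gt0//; lra.
  - by move: abl l0; rewrite subrr normr0 => <-; rewrite ltxx.
have dc : `|f1 a - f1 c| <= K * (1 + M) * `|a - c|.
  apply: (mvt_bound cf1 df1 c0 a0) => t t0 tc ta; apply: (le_trans (f2K _ (ltW t0))).
  rewrite ler_wpM2l ?(ltW K0)// lerD2l; apply: amax; rewrite in_itv/= ltW//=.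
  case: (leP a c) tc ta => h.
    by rewrite (ler0_norm (_ : a - c <= 0)) ?subr_le0// !ler_norml; lra.
  by rewrite (gtr0_norm (_ : 0 < a - c)) ?subr_gt0// !ler_norml; lra.
have M0 : 0 <= M by exact: normr_ge0.
have h1 : `|f1 c| <= 4 * K * H.
  have e : l * (2 * K) = 1 by rewrite mulVf// gt_eqF// mulr_gt0.
  have K20 : 0 <= 2 * K by rewrite mulr_ge0// ltW.
  have := ler_wpM2r K20 cl; rewrite -[X in X <= _]mulrA e mulr1.
  by move=> h; apply: (le_trans h); rewrite le_eqVlt; apply/orP; left; apply/eqP; ring.
have h2 : K * (1 + M) * `|a - c| <= (1 + M) / 2.
  apply: (@le_trans _ _ (K * (1 + M) * l)).
    by apply: ler_wpM2l => //; rewrite mulr_ge0 ?(ltW K0)// addr_ge0.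
  by rewrite le_eqVlt; apply/orP; left; apply/eqP; rewrite /l; field; rewrite gt_eqF.
have h3 : M <= `|f1 a - f1 c| + `|f1 c|.
  by rewrite /M -[X in `|X| <= _](subrK (f1 c)); exact: ler_normD.
lra.
Qed.

Lemma growth_arith (R : realDomainType) (a m b c e u v : R) : e <= 1 -> 0 < u -> 0 < u * v ->
  0 <= b -> 0 <= m -> 0 <= a -> c <= b + m * a + u * (v + a) ->
  e + c <= (2 + b + m + u * (v + 1)) * (1 + a).
Proof.
move=> e1 u0 uv b0 m0 a0 cb.
have ab := mulr_ge0 a0 b0; have auv := mulr_ge0 a0 (ltW uv); have ua := mulr_ge0 (ltW u0) a0; lra.
Qed.

Section hjb.
Context (R : realType) (mu sigma u0 r beta d : R) (h h1 h2 : R -> R).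
Hypotheses (sigma0 : 0 < sigma) (u00 : 0 < u0) (r0 : 0 < r) (beta0 : 0 < beta).
Hypothesis hS : HJB_solution mu sigma u0 r beta d h h1 h2.

(** The HJB equation solved for h'' reads h'' = kap (1_{z > d} + g), with the supremum evaluated to
    u0 max(beta + h', 0). As [g] turns out to be Lipschitz, [kap] is the height of the jump of h''
    at d. *)
Let kap : R := 2 / sigma ^+ 2.
Let g z : R := r * h z + mu * h1 z - u0 * Num.max (beta + h1 z) 0.
Let H : R := `|(beta * u0 - 1) / r| + `|beta * u0 / r|.

Let kap0 : 0 < kap. Proof. by rewrite divr_gt0// exprn_gt0. Qed.

Let h_bnd z : 0 <= z -> `|h z| <= H.
Proof.
move=> z0; have [hb _ _ _ _] := hS; have /andP[] := hb z z0; rewrite /H.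
set a := (_ - _) / r; set b := _ / r => az zb.
have hb' := ler_norm b; have ha := ler_norm (- a); rewrite normrN in ha.
by have a0 := normr_ge0 a; have b0 := normr_ge0 b; rewrite ler_norml; apply/andP; split; lra.
Qed.

Let h_derive (z : R) : 0 < z -> is_derive z 1 h (h1 z).
Proof. by move=> z0; have [_ [dh _ _] _ _ _] := hS; exact: dh. Qed.

Let h1_derive (z : R) : 0 < z -> z != d -> is_derive z 1 h1 (h2 z).
Proof.
move=> z0; have [_ _ [dl _ _ _] [dr _] _] := hS.
by case: (ltgtP z d) => // zd _; [apply: dl; rewrite z0|exact: dr].
Qed.

Let h_within : {within `[0, +oo[, continuous h}.
Proof.
have [_ [_ rh _] _ _ _] := hS.
apply/continuous_within_itvcyP; split; last exact: right_deriv_cvg rh.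
move=> z; rewrite in_itv/= andbT => z0.
by apply: differentiable_continuous; apply/derivable1_diffP; have := h_derive z0; case.
Qed.

Let h1_within : {within `[0, +oo[, continuous h1}.
Proof. by have [_ [_ _ c] _ _ _] := hS. Qed.

Let h2E z : 0 <= z -> h2 z = kap * ((if d < z then 1 else 0) + g z).
Proof.
move=> z0; have [_ _ _ _ e] := hS; rewrite -(e z z0) sup_scale_itv ?ltW// /g /kap; field.
by rewrite gt_eqF.
Qed.

Lemma hjb_gen z u : 0 <= z -> gen mu sigma r h h1 h2 z u =
  (if d < z then 1 else 0) - beta * u - (u0 * Num.max (beta + h1 z) 0 - (beta + h1 z) * u).
Proof.
move=> z0; have [_ _ _ _ e] := hS; rewrite -(e z z0) sup_scale_itv ?ltW// /gen; ring.
Qed.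

Lemma hjb_gen_le z u : 0 <= z -> 0 <= u <= u0 ->
  gen mu sigma r h h1 h2 z u <= (if d < z then 1 else 0) - beta * u.
Proof.
move=> z0 /andP[ul ur]; rewrite hjb_gen// gerBl subr_ge0.
by case: (leP (beta + h1 z) 0) => b0; nra.
Qed.

Lemma hjb_gen_ustar z : 0 <= z ->
  gen mu sigma r h h1 h2 z (if - beta <= h1 z then u0 else 0) =
  (if d < z then 1 else 0) - beta * (if - beta <= h1 z then u0 else 0).
Proof.
move=> z0; rewrite hjb_gen//; case: (leP (- beta) (h1 z)) => b0.
  by rewrite max_l; [ring|lra].
by rewrite max_r; [ring|lra].
Qed.

Let gen_opp z u : gen mu sigma r (fun x => - h x) (fun x => - h1 x) (fun x => - h2 x) z u =
  - gen mu sigma r h h1 h2 z u.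
Proof. by rewrite /gen; ring. Qed.

Let K : R := kap * (2 + r * H + `|mu| + u0 * (beta + 1)).

Let H0 : 0 <= H. Proof. by rewrite addr_ge0. Qed.

Let K0 : 0 < K.
Proof.
rewrite mulr_gt0// ltr_wpDr ?mulr_ge0 ?addr_ge0 ?ltW//.
by rewrite ltr_wpDr// ltr_wpDr// mulr_ge0// ltW.
Qed.

Let g_bnd z : 0 <= z -> `|g z| <= r * H + `|mu| * `|h1 z| + u0 * (beta + `|h1 z|).
Proof.
move=> z0; rewrite /g; apply: (le_trans (ler_normB _ _)); apply: lerD.
  apply: (le_trans (ler_normD _ _)); rewrite !normrM (gtr0_norm r0) lerD2r.
  by rewrite ler_pM2l// h_bnd.
rewrite normrM (gtr0_norm u00) ler_pM2l//.
case: (leP (beta + h1 z) 0) => b0; first by rewrite normr0 addr_ge0// ltW.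
by rewrite gtr0_norm// lerD2l ler_norm.
Qed.

Let h2_growth z : 0 <= z -> `|h2 z| <= K * (1 + `|h1 z|).
Proof.
move=> z0; rewrite h2E// normrM (gtr0_norm kap0) /K -mulrA ler_pM2l//.
apply: (le_trans (ler_normD _ _)).
have i1 : `|(if d < z then 1 else 0) : R| <= 1 by case: ifP; rewrite ?normr1 ?normr0.
have := g_bnd z0; have := normr_ge0 (h1 z); have := normr_ge0 mu.
have : 0 <= r * H by rewrite mulr_ge0// ltW.
have := mulr_gt0 u00 beta0; move: i1 u00; exact: growth_arith.
Qed.

Let B1 : R := 8 * K * H + 1.

(** The notion of solution bounds h only. The equation bounds |h''| by an affine function of |h'|,
    and together with the bound on h this is what [derivative_bounded] takes as input. *)
Let h1_bnd z : 0 <= z -> `|h1 z| <= B1.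
Proof. exact: (derivative_bounded K0 h_bnd h_within h1_within h_derive h1_derive h2_growth). Qed.

Let B2 : R := K * (1 + B1).

Let B10 : 0 <= B1. Proof.
have k := ltW K0; have h8 : 0 <= 8 * K by exact: mulr_ge0.
by apply: addr_ge0 => //; exact: mulr_ge0.
Qed.

Let h2_bnd z : 0 <= z -> `|h2 z| <= B2.
Proof.
move=> z0; apply: (le_trans (h2_growth z0)).
by rewrite ler_pM2l// lerD2l h1_bnd.
Qed.

Let B20 : 0 <= B2. Proof. by apply: mulr_ge0; [exact: ltW|exact: addr_ge0]. Qed.

Let Lg : R := r * B1 + `|mu| * B2 + u0 * B2.

Let Lg0 : 0 <= Lg.
Proof.
have r1 := ltW r0; have u1 := ltW u00.
by apply: addr_ge0; first apply: addr_ge0; exact: mulr_ge0.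
Qed.

Let g_lipschitz x y : 0 <= x -> 0 <= y -> `|g y - g x| <= Lg * `|y - x|.
Proof.
move=> x0 y0.
have l0 : `|h y - h x| <= B1 * `|y - x|.
  apply: (mvt_bound (d := d) h_within (fun z z0 _ => h_derive z0) x0 y0) => z z0 _ _.
  by apply: h1_bnd; exact: ltW.
have l1 : `|h1 y - h1 x| <= B2 * `|y - x|.
  by apply: (mvt_bound h1_within h1_derive x0 y0) => z z0 _ _; apply: h2_bnd; exact: ltW.
have lm : `|Num.max (beta + h1 y) 0 - Num.max (beta + h1 x) 0| <= B2 * `|y - x|.
  apply: le_trans l1; have a1 := ler_norm (h1 y - h1 x); have a2 := ler_norm (h1 x - h1 y).
  rewrite distrC in a2; rewrite ler_norml; move: a1 a2; move: (`|_|) => a a1 a2.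
  by case: (leP (beta + h1 x) 0); case: (leP (beta + h1 y) 0) => *; lra.
have -> : g y - g x = r * (h y - h x) + mu * (h1 y - h1 x) -
  u0 * (Num.max (beta + h1 y) 0 - Num.max (beta + h1 x) 0) by rewrite /g; ring.
have -> : Lg * `|y - x| = r * (B1 * `|y - x|) + `|mu| * (B2 * `|y - x|) + u0 * (B2 * `|y - x|).
  by rewrite /Lg; ring.
apply: (le_trans (ler_normB _ _)); apply: lerD.
  apply: (le_trans (ler_normD _ _)); rewrite !normrM (gtr0_norm r0); apply: lerD.
    by rewrite ler_pM2l.
  exact: ler_wpM2l.
by rewrite normrM (gtr0_norm u00) ler_pM2l.
Qed.

Let N (n : nat) : R := n.+1%:R.
Let N1 n : 1 <= N n. Proof. by rewrite ler1n. Qed.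

Let f_ n z := h z - cut0 kap d (N n) z.
Let f1_ n z := h1 z - cut1 kap d (N n) z.
Let f2_ n z := h2 z - cut2 kap d (N n) z.

Let f2E n z : 0 <= z -> f2_ n z = kap * (g z + ramp d (N n) z).
Proof. by move=> z0; rewrite /f2_ h2E// [RHS]mulrDr ramp_cut2; ring. Qed.

Let L n : R := kap * (Lg + 2 * N n).

(** The first constant is independent of n, as [dynkin_limit_ge0] requires; the second grows with n
    through the slope of [ramp]. Lipschitz continuity of [f2_] is read off from [f2E], where the
    jump has been replaced by [ramp]. *)
Let f_taylor2 n : taylor2 (H + B1 + B2 + kap) (H + B1 + B2 + kap + L n)
  (fun x => f_ n (Num.max x 0)) (fun x => f1_ n (Num.max x 0)) (fun x => f2_ n (Num.max x 0)).
Proof.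
have N0 : 0 < N n by exact: lt_le_trans (N1 n).
have k0 := ltW kap0.
apply: (@taylor2_halfline _ d).
- by rewrite mulr_ge0// addr_ge0// mulr_ge0// ltW.
- move=> x x0.
  have sum3 (a b c : R) : 0 <= a -> 0 <= b -> 0 <= c -> [/\ a <= a + b + c, b <= a + b + c & c <= a + b + c].
    by move=> a0 b0 c0; split; lra.
  have [s0 s1 s2] := sum3 _ _ _ H0 B10 B20.
  split; apply: (le_trans (ler_normB _ _)); apply: lerD.
  + exact: le_trans (h_bnd x0) s0.
  + have /andP[c1 c2] := cut0_bound d k0 (N1 n) x; rewrite (ger0_norm c1).
    apply: (le_trans c2); rewrite ler_pdivrMr ?exprn_gt0//.
    by apply: ler_peMr => //; exact: exprn_ege1.
  + exact: le_trans (h1_bnd x0) s1.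
  + have /andP[c1 c2] := cut1_bound d k0 (N1 n) x; rewrite (ger0_norm c1).
    by apply: (le_trans c2); rewrite ler_pdivrMr//; exact: ler_peMr.
  + exact: le_trans (h2_bnd x0) s2.
  + exact: cut2_bound.
- by apply: within_continuousB => //; apply: continuous_subspaceT; exact: cut0_continuous.
- by apply: within_continuousB => //; apply: continuous_subspaceT; exact: cut1_continuous.
- move=> z z0 zd; have := h_derive z0; have := is_derive_cut0 kap (N1 n) zd => i1 i2.
  by have -> : f_ n = h - cut0 kap d (N n) by []; exact: is_deriveB.
- move=> z z0 zd; have := h1_derive z0 zd; have := is_derive_cut1 kap (N n) zd => i1 i2.
  by have -> : f1_ n = h1 - cut1 kap d (N n) by []; exact: is_deriveB.
- move=> x y x0 y0; rewrite !f2E// -mulrBr normrM (gtr0_norm kap0) /L -mulrA ler_pM2l//.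
  have -> : g y + ramp d (N n) y - (g x + ramp d (N n) x) = (g y - g x) + (ramp d (N n) y - ramp d (N n) x) by ring.
  apply: (le_trans (ler_normD _ _)); rewrite mulrDl; apply: lerD; first exact: g_lipschitz.
  exact: ramp_lipschitz.
Qed.

Let cvg_sub (a : R) (b : nat -> R) : b n @[n --> \oo] --> 0 -> a - b n @[n --> \oo] --> a.
Proof. by move=> hb; rewrite -[X in _ --> X]subr0; apply: cvgB => //; exact: cvg_cst. Qed.

Let f_cvg x : f_ n x @[n --> \oo] --> h x.
Proof.
apply: cvg_sub; apply: (@cvg_le_inv _ kap) => n.
have /andP[c1 c2] := cut0_bound d (ltW kap0) (N1 n) x; rewrite (ger0_norm c1).
have N0 : 0 < N n by exact: lt_le_trans (N1 n).
apply: (le_trans c2); rewrite ler_pM2l// lef_pV2 ?posrE ?exprn_gt0//.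
by rewrite expr2 ler_peMr// ltW.
Qed.

Let f1_cvg x : f1_ n x @[n --> \oo] --> h1 x.
Proof.
apply: cvg_sub; apply: (@cvg_le_inv _ kap) => n.
by have /andP[c1 c2] := cut1_bound d (ltW kap0) (N1 n) x; rewrite (ger0_norm c1).
Qed.

Let f2_cvg x : f2_ n x @[n --> \oo] --> h2 x.
Proof.
(* At x = d the cutoff takes its left value 0, in accordance with h'' being the left second
   derivative there. Convergence thus holds at every point, and no exceptional set of times has to
   be discarded. *)
apply: cvg_sub; case: (leP x d) => xd.
  have -> : (fun n => cut2 kap d (N n) x) = cst 0 by apply/funext => n; rewrite /cut2 xd.
  exact: cvg_cst.
by apply: (@cvg_le_inv _ (kap * 4 / (x - d))) => n; exact: (cut2_decay (ltW kap0) (N1 n) xd).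
Qed.

Section dynkin.
Context dO (T : measurableType dO) (P : probability T R)
  (F : R -> set (set T)) (W U : R -> T -> R) (z : R).
Hypotheses (hF : filtration F) (hW : std_brownian P F W) (hU : admissible F u0 U) (z0 : 0 <= z).
Hypothesis (d0 : 0 < d).
Notation leb := (@lebesgue_measure R).

(** The correction lives to the right of [d] and d > 0, so the boundary derivative is the same for
    all n and keeps the sign, or the vanishing, of h'(0). *)
Let f1_at0 n : f1_ n (Num.max 0 0) = h1 0.
Proof. by rewrite /f1_ maxxx /cut1 (ltW d0) subr0. Qed.

Let phi0 (s : R) : `[0, +oo[%classic s -> 0 <= expR (- (r * s)).
Proof. by move=> _; exact: expR_ge0. Qed.

Let G (p : R * T) := gen mu sigma r h h1 h2 (Dlim W U mu sigma z p) (U p.1 p.2).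
(** Minus the running reward: in this form the HJB equation bounds the generator, whence the sign in
    [vU_Ex]. *)
Let k (p : R * T) : R := (if d < Dlim W U mu sigma z p then 1 else 0) - beta * U p.1 p.2.

Let fmax_cvg x : 0 <= x -> f_ n (Num.max x 0) @[n --> \oo] --> h x.
Proof. by move=> x0; rewrite (max_l x0); exact: f_cvg. Qed.

Let f1max_cvg x : 0 <= x -> f1_ n (Num.max x 0) @[n --> \oo] --> h1 x.
Proof. by move=> x0; rewrite (max_l x0); exact: f1_cvg. Qed.

Let f2max_cvg x : 0 <= x -> f2_ n (Num.max x 0) @[n --> \oo] --> h2 x.
Proof. by move=> x0; rewrite (max_l x0); exact: f2_cvg. Qed.

Let mG : measurable_fun setT G.
Proof. exact: (measurable_gen_limit mu sigma r hF hW hU z0 f_taylor2 fmax_cvg f1max_cvg f2max_cvg). Qed.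

Let G_bnd s w : `[0, +oo[%classic s -> `|G (s, w)| <= gen_bnd mu sigma u0 r (H + B1 + B2 + kap).
Proof.
rewrite /= in_itv/= andbT => s0.
exact: (gen_limit_bound mu sigma z hW hU r0 f_taylor2 fmax_cvg f1max_cvg f2max_cvg w s0).
Qed.

Let mI : measurable_fun setT (fun p : R * T => if d < Dlim W U mu sigma z p then 1 else 0 : R).
Proof.
have mD := Dlim_meas mu sigma hF hW hU z0.
apply: measurable_fun_ifT => //; apply: measurable_fun_ltr => //; exact: mD.
Qed.

Let mU : measurable_fun setT (fun p : R * T => U p.1 p.2).
Proof. by have [] := hU. Qed.

Let mk : measurable_fun setT k.
Proof. by apply: measurable_funB; [exact: mI|exact: measurable_funM]. Qed.

Let I_bnd p : `|(if d < Dlim W U mu sigma z p then 1 else 0) : R| <= 1.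
Proof. by case: ifP; rewrite ?normr1 ?normr0. Qed.

Let k_bnd s w : `[0, +oo[%classic s -> `|k (s, w)| <= 1 + beta * u0.
Proof.
rewrite /= in_itv/= andbT => s0; apply: (le_trans (ler_normB _ _)); apply: lerD; first exact: I_bnd.
by rewrite normrM (gtr0_norm beta0) ler_pM2l//; exact: (U_norm hU).
Qed.

Lemma vU_Ex : vU P mu sigma r beta d W U z =
  - Ex P (fun w => Rintegral leb `[0, +oo[ (fun s => expR (- (r * s)) * k (s, w))).
Proof.
have mD := measurable_itv `[0, +oo[ : measurable (`[0, +oo[%classic : set R).
have iphi := @discount_integrable R r r0 0; have mphi := discount_meas r.
rewrite -ExN; last exact: (wint_rint P mD mphi phi0 iphi mk k_bnd).
apply: (@eq_Ex _ _ _ P) => w.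
have iI : leb.-integrable `[0, +oo[ (EFin \o (fun s : R => expR (- (r * s)) *
    (if d < Dlim W U mu sigma z (s, w) then 1 else 0))).
  apply: (wint_integrable mD mphi phi0 iphi (C := 1)); first exact: (measurable_section1 w mI).
  by move=> s _; exact: I_bnd.
have iU : leb.-integrable `[0, +oo[ (EFin \o (fun s : R => expR (- (r * s)) * U s w)).
  apply: (wint_integrable mD mphi phi0 iphi (C := u0)); first exact: (measurable_section1 w mU).
  by move=> s; rewrite /= in_itv/= andbT => s0; exact: (U_norm hU).
have ibU : leb.-integrable `[0, +oo[ (EFin \o (fun s : R => beta * (expR (- (r * s)) * U s w))).
  have h' : leb.-integrable `[0, +oo[ (fun s : R => beta%:E *
    (EFin \o (fun s : R => expR (- (r * s)) * U s w)%R) s)%E by exact: integrableZl.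
  exact: h'.
rewrite -RintegralZl//.
have -> : Rintegral leb `[0, +oo[ (fun t => expR (- (r * t)) *
    (if d < Dproc mu sigma W U z t w then 1 else 0)) =
  Rintegral leb `[0, +oo[ (fun s => expR (- (r * s)) *
    (if d < Dlim W U mu sigma z (s, w) then 1 else 0)).
  apply: eq_Rintegral => s; rewrite inE/= in_itv/= andbT => s0; by rewrite DlimE.
rewrite -[LHS]opprK; congr (- _); rewrite opprB -RintegralB//.
by apply: eq_Rintegral => s _; rewrite /k /= mulrBr mulrCA.
Qed.

Lemma vU_le_hjb : h1 0 <= 0 -> vU P mu sigma r beta d W U z <= h z.
Proof.
move=> h10.
have mD := measurable_itv `[0, +oo[ : measurable (`[0, +oo[%classic : set R).
have iphi := @discount_integrable R r r0 0; have mphi := discount_meas r.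
have J0 : 0 <= h z + Ex P (fun w => Rintegral leb `[0, +oo[ (fun s =>
    expR (- (r * s)) * G (s, w))).
  apply: (dynkin_limit_ge0 (f := h) (f1 := h1) (f2 := h2) mu hF hW hU sigma0 u00 z0 r0 f_taylor2) => //.
  by move=> n; rewrite f1_at0.
have Gk : Ex P (fun w => Rintegral leb `[0, +oo[ (fun s => expR (- (r * s)) * G (s, w))) <=
    Ex P (fun w => Rintegral leb `[0, +oo[ (fun s => expR (- (r * s)) * k (s, w))).
  apply: (wint_Ex_le P mD mphi phi0 iphi mG mk G_bnd k_bnd) => s w.
  rewrite /= in_itv/= andbT => s0; apply: hjb_gen_le; first exact: (Dlim_ge0 mu sigma z hW hU).
  by have [hU0 _ _] := hU; exact: hU0.
by rewrite vU_Ex -subr_ge0 opprK; apply: (le_trans J0); exact: (lerD (lexx (h z)) Gk).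
Qed.

Lemma hjb_le_vU : h1 0 = 0 ->
  (forall t w, 0 <= t -> U t w = if - beta <= h1 (Dproc mu sigma W U z t w) then u0 else 0) ->
  h z <= vU P mu sigma r beta d W U z.
Proof.
move=> h10 Ustar.
have mD := measurable_itv `[0, +oo[ : measurable (`[0, +oo[%classic : set R).
have iphi := @discount_integrable R r r0 0; have mphi := discount_meas r.
have J0 : 0 <= - h z + Ex P (fun w => Rintegral leb `[0, +oo[ (fun s =>
  expR (- (r * s)) * gen mu sigma r (fun x => - h x) (fun x => - h1 x) (fun x => - h2 x)
    (Dlim W U mu sigma z (s, w)) (U s w))).
  apply: (dynkin_limit_ge0 (f := fun x => - h x) (f1 := fun x => - h1 x) (f2 := fun x => - h2 x)
    mu hF hW hU sigma0 u00 z0 r0 (fun n => taylor2_opp (f_taylor2 n))).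
  - by move=> x x0; apply: cvgN; exact: fmax_cvg.
  - by move=> x x0; apply: cvgN; exact: f1max_cvg.
  - by move=> x x0; apply: cvgN; exact: f2max_cvg.
  - by move=> n; rewrite f1_at0 h10 oppr0.
have e : Ex P (fun w => Rintegral leb `[0, +oo[ (fun s =>
  expR (- (r * s)) * gen mu sigma r (fun x => - h x) (fun x => - h1 x) (fun x => - h2 x)
    (Dlim W U mu sigma z (s, w)) (U s w))) =
  Ex P (fun w => Rintegral leb `[0, +oo[ (fun s => expR (- (r * s)) * (-1 * k (s, w)))).
  apply: eq_Ex => w; apply: eq_Rintegral => s; rewrite inE/= in_itv/= andbT => s0.
  congr (_ * _); have D0 := Dlim_ge0 mu sigma z hW hU (s, w).
  by rewrite /k /= (Ustar s w s0) -(DlimE _ _ _ _ _ _ s0) -hjb_gen_ustar// gen_opp mulN1r.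
by rewrite e (wint_ExZ P mD mphi phi0 iphi (-1) mk k_bnd) mulN1r -vU_Ex addrC subr_ge0 in J0.
Qed.

End dynkin.

End hjb.

(** * Verification of the value function *)

Theorem theorem1p4 (R : realType) (dO : measure_display) (Omega : measurableType dO)
  (P : probability Omega R) (F : R -> set (set Omega)) (W : R -> Omega -> R)
  (mu sigma u0 r beta d : R) (h h1 h2 : R -> R) :
  complete_prob P -> filtration F -> std_brownian P F W ->
  0 < sigma -> 0 < u0 -> 0 < r -> 0 < beta -> 0 < d ->
  HJB_solution mu sigma u0 r beta d h h1 h2 ->
  (forall x y, 0 <= x -> x <= y -> h y <= h x) ->
  (forall U, admissible F u0 U -> forall z, 0 <= z ->
     vU P mu sigma r beta d W U z <= h z) /\
  (h1 0 = 0 ->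
   forall z, 0 <= z ->
   forall Ustar, admissible F u0 Ustar ->
     (forall t w, 0 <= t ->
        Ustar t w = (if - beta <= h1 (Dproc mu sigma W Ustar z t w) then u0 else 0)) ->
     h z = vfun P F mu sigma u0 r beta d W z /\
     vfun P F mu sigma u0 r beta d W z = vU P mu sigma r beta d W Ustar z).
Proof.
move=> _ hF hW sigma0 u00 r0 beta0 d0 hS hdec.
have h10 : h1 0 <= 0 by have [_ [_ rh _] _ _ _] := hS; exact: right_deriv_le0 hdec rh.
have le_h U (hU : admissible F u0 U) z (z0 : 0 <= z) : vU P mu sigma r beta d W U z <= h z.
  exact: (vU_le_hjb sigma0 u00 r0 beta0 hS hF hW hU z0 d0 h10).
split=> // h10E z z0 Us hUs UsE.
have ge_h : h z <= vU P mu sigma r beta d W Us z.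
  exact: (hjb_le_vU sigma0 u00 r0 beta0 hS hF hW hUs z0 d0 h10E UsE).
have vUs : vU P mu sigma r beta d W Us z = h z by apply/le_anti; rewrite ge_h le_h.
suff vE : vfun P F mu sigma u0 r beta d W z = h z by rewrite vE vUs.
(* [sup] on the reals is meaningful for nonempty sets with an upper bound: [h z] is an upper bound
   and, through [Us], a member of the set. *)
have ub : ubound [set vU P mu sigma r beta d W U z | U in admissible F u0] (h z).
  by move=> v [U hU <-]; exact: le_h.
have im : [set vU P mu sigma r beta d W U z | U in admissible F u0] (h z) by exists Us.
apply/le_anti/andP; split; first by apply: ge_sup ub; exists (h z).
by apply: sup_upper_bound => //; split; exists (h z).
Qed.
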